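(* Let $A$ and $B$ be nonsingular real $2\times 2$ matrices such that $|\det(AB)|\le 1$, and let $h\in L^{\infty}(\mathbb{R}^2)$ be a functional Gabor frame multiplier with respect to the lattices $A\mathbb{Z}^2$ and $B\mathbb{Z}^2$. Then $h$ is unimodular (i.e. $|h(\mathbf{x})|=1$ for a.e. $\mathbf{x}\in\mathbb{R}^2$) and, for all $\mathbf{l},\mathbf{k}\in\mathbb{Z}^2$ with $\mathbf{k}\neq\mathbf{0}$, $$h(\mathbf{x})\overline{h(\mathbf{x}-(B^T)^{-1}\mathbf{k})}=h(\mathbf{x}-A\mathbf{l})\overline{h(\mathbf{x}-A\mathbf{l}-(B^T)^{-1}\mathbf{k})}\quad\text{for a.e. }\mathbf{x}\in\mathbb{R}^2 .$$
   Context: Functions are complex valued. Given nonsingular real $d\times d$ matrices $A,B$, a function $g\in L^2(\mathbb{R}^d)$ is a Parseval (or normalized tight) Gabor frame generator with respect to the lattices $A\mathbb{Z}^d$ and $B\mathbb{Z}^d$ if $$\sum_{\mathbf{l},\mathbf{k}\in\mathbb{Z}^d}\big|\langle f, e^{2\pi i\langle B\mathbf{k},\mathbf{t}\rangle}g(\mathbf{t}-A\mathbf{l})\rangle\big|^2=\|f\|^2$$ for every $f\in L^2(\mathbb{R}^d)$. A function $h\in L^{\infty}(\mathbb{R}^d)$ is a functional Gabor frame multiplier (with respect to these lattices) if $hg$ is a Parseval Gabor frame generator whenever $g$ is a Parseval Gabor frame generator. Here $d=2$. *)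

(* Defs.v *)
From mathcomp Require Import all_boot all_order all_algebra.
From mathcomp Require Import all_classical all_reals all_analysis.
From mathcomp Require Import complex.

Set Implicit Arguments.
Unset Strict Implicit.
Unset Printing Implicit Defensive.

Import Order.TTheory GRing.Theory Num.Theory.
Import numFieldNormedType.Exports.
Import ComplexField.

Local Open Scope classical_set_scope.
Local Open Scope ring_scope.
Local Open Scope complex_scope.

(* R^2 with the product Borel sigma-algebra: measurable below means Borel
   measurable. Every class in L^2 or L^oo has a Borel representative, and
   {ae plane_measure, _} holds outside a subset of a Borel null set, i.e.
   outside a Lebesgue null set. *)
Definition plane (R : realType) : Type :=
  (measurableTypeR R * measurableTypeR R)%type.

Definition plane_measure (R : realType) :
    {measure set (measurableTypeR R * measurableTypeR R) -> \bar R} :=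
  ((@lebesgue_measure R) \x (@lebesgue_measure R))%E.

Definition dot (R : realType) (x y : plane R) : R := x.1 * y.1 + x.2 * y.2.

(* The point M k of the lattice M Z^2. *)
Definition lattice_pt (R : realType) (M : 'M[R]_2) (k : 'cV[int]_2) : plane R :=
  let v : 'cV[R]_2 := M *m map_mx intr k in (v 0 0, v 1 0).

Definition expi (R : realType) (t : R) : R[i] := cos t +i* sin t.

(* R[i] carries no sigma-algebra in the library. *)
Definition cmeasurable (R : realType) (f : plane R -> R[i]) : Prop :=
  measurable_fun [set: plane R] (fun x => complex.Re (f x)) /\
  measurable_fun [set: plane R] (fun x => complex.Im (f x)).

(* Normc.normc is the modulus with values in R; `|z| has values in R[i]. *)
Definition cLnorm (R : realType) (p : \bar R) (f : plane R -> R[i]) : \bar R :=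
  Lnorm (@plane_measure R) p (fun x => (Normc.normc (f x))%:E).

Definition in_Lp (R : realType) (p : \bar R) (f : plane R -> R[i]) : Prop :=
  cmeasurable f /\ (cLnorm p f < +oo)%E.

Definition cintegral (R : realType) (f : plane R -> R[i]) : R[i] :=
  (\int[@plane_measure R]_x complex.Re (f x)) +i*
  (\int[@plane_measure R]_x complex.Im (f x)).

Definition inner (R : realType) (f g : plane R -> R[i]) : R[i] :=
  cintegral (fun t => f t * (g t)^*).

Definition gabor_atom (R : realType) (A B : 'M[R]_2) (g : plane R -> R[i])
    (l k : 'cV[int]_2) : plane R -> R[i] :=
  fun t => expi (2 * pi * dot (lattice_pt B k) t) * g (t - lattice_pt A l).

Definition parseval_gabor (R : realType) (A B : 'M[R]_2)
    (g : plane R -> R[i]) : Prop :=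
  in_Lp 2%:E g /\
  forall f : plane R -> R[i], in_Lp 2%:E f ->
    (\esum_(lk in [set: 'cV[int]_2 * 'cV[int]_2])
       (Normc.normc (inner f (gabor_atom A B g lk.1 lk.2)) ^+ 2)%:E
     = cLnorm 2%:E f ^+ 2)%E.

Definition gabor_multiplier (R : realType) (A B : 'M[R]_2)
    (h : plane R -> R[i]) : Prop :=
  in_Lp +oo%E h /\
  forall g : plane R -> R[i], parseval_gabor A B g ->
    parseval_gabor A B (fun x => h x * g x).

(* Main.v *)
From HB Require Import structures.
Require Import Defs.
From mathcomp Require Import all_boot all_order all_algebra.
From mathcomp Require Import all_classical all_reals all_analysis.
From mathcomp Require Import complex measurable_realfun.
From mathcomp Require Import ring lra zify.

(* Write Λ = A Z^2, Γ = C Z^2 with C = (B^T)^-1, and K = |det C|; the hypothesis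
   on det(AB) says |det A| <= K. Parseval's identity on a Γ-tile turns the sum
   over the frequencies B k into an integral, so the Gabor sums of f are
   K times integrals of |f(x) g(x-λ)^* + f(x-γ) g(x-γ-λ)^*|^2 when the supports
   are small. Testing a Parseval generator h g on functions living on E and
   E - γ gives pointwise identities for K Σ_λ |hg(x-λ) + β hg(x-γ-λ)|^2.

   A set packing by both lattices extends to one that also tiles by Λ, and its
   indicator is a generator: this gives |h| = 1. When λ is not in Γ, one takes
   the indicator with two pieces E, E-λ split into
   1_E + 1_{E-γ} + 1_{E-λ} - 1_{E-γ-λ}; the sign isolates
   h(x) h(x-γ)^* = h(x-λ) h(x-λ-γ)^*. This settles the case where Λ is not
   contained in Γ, the group property covering the λ in Γ.

   If Λ is contained in Γ, the two lattices coincide by comparing determinants.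
   Then the step functions on the cells whose values are the coefficients of a
   Blaschke factor along a line, or of a product of two of them, are generators.
   All coefficients but one being positive, the equality case of the triangle
   inequality forces h to be multiplicative along lines, and a numerical estimate
   excludes the remaining sign on squares. *)

Set Implicit Arguments.
Unset Strict Implicit.
Unset Printing Implicit Defensive.

Import Order.TTheory GRing.Theory Num.Theory.
Import numFieldNormedType.Exports.
Import ComplexField.
Import HBNNSimple.

Local Open Scope classical_set_scope.
Local Open Scope ring_scope.
Local Open Scope complex_scope.

(** The signed indicator needs [E] and [E - λ] to be disjoint modulo Γ, so it says nothing for λ in
    Γ and fails altogether when Λ lies in Γ. On equal lattices a step function with values [u l],
    scaled by K^(-1/2), is a generator exactly when the Fourier series with coefficients [u] has
    modulus 1 on the torus. Among trigonometric polynomials only monomials have this property, and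
    they give no more than |h| = 1; so infinitely many cells have to carry mass, and a Blaschke
    factor is the simplest such symbol. With its zero at 1/2 it has real coefficients, a single one
    of them negative, at index 0. The test parameter β may be a function of the point: β(x) = h(x)
    conj h(x+γ) aligns the two phases at just that index, and every other term then obeys the
    triangle inequality in the same direction. For a product of two Blaschke factors negative
    products occur along both axes, so this argument is lost and a numerical bound takes its
    place. *)

Local Notation idx := ('cV[int]_2).

(** * Sums, translations and linear maps *)

Section countable_sums.
Context {d} {T : measurableType d} {R : realType}.
Variable mu : {measure set T -> \bar R}.
Local Open Scope ereal_scope.

(** Turns a countable sum into a series, where monotone convergence is available; integers that code
    no index contribute 0. *)
Lemma esum_pickle (I : countType) (a : I -> \bar R) : (forall i, 0 <= a i) ->
  \esum_(i in [set: I]) a i = \sum_(n <oo) oapp a 0 (pickle_inv n).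
Proof.
move=> a0; rewrite nneseries_esumT; last by move=> n; case: (pickle_inv _) => /=.
rewrite (esumID (range (@pickle I))) //; last by move=> i _; case: (pickle_inv _).
rewrite [X in _ = _ + X]esum1 ?adde0; last first.
  move=> n [_ /= hn]; case E : (pickle_inv n) => [x|] //=.
  by exfalso; apply: hn; exists x => //; have /= := @pickle_invK I n; rewrite E.
rewrite setTI (esum_image setT); last by move=> x y _ _; exact: (pcan_inj (@choice.pickleK I)).
by apply: eq_esum => i _; rewrite pickleK_inv.
Qed.

Lemma measurable_esum (I : countType) (D : set T) (f : I -> T -> \bar R) :
  (forall i x, 0 <= f i x) -> (forall i, measurable_fun D (f i)) ->
  measurable_fun D (fun x => \esum_(i in [set: I]) f i x).
Proof.
move=> f0 mf; under eq_fun do rewrite esum_pickle//.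
apply: ge0_emeasurable_sum => [n x _ _|n _]; first by case: (pickle_inv _) => /=.
by case: (pickle_inv _) => [i|] //=.
Qed.

Lemma ge0_integral_esum (I : countType) (D : set T) (f : I -> T -> \bar R) :
  measurable D -> (forall i x, 0 <= f i x) -> (forall i, measurable_fun D (f i)) ->
  \int[mu]_(x in D) (\esum_(i in [set: I]) f i x) =
  \esum_(i in [set: I]) \int[mu]_(x in D) f i x.
Proof.
move=> mD f0 mf; under eq_integral do rewrite esum_pickle//.
rewrite integral_nneseries//.
- rewrite esum_pickle; last by move=> i; apply: integral_ge0.
  apply: eq_eseriesr => n _; case: (pickle_inv _) => [i|] //=.
  by rewrite integral0.
- by move=> n; case: (pickle_inv _) => [i|] //=.
- by move=> n x _; case: (pickle_inv _) => /=.
Qed.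

Lemma esumZl (I : choiceType) (r : R) (a : I -> \bar R) (J : set I) :
  (0 <= r)%R -> (forall i, 0 <= a i) ->
  \esum_(i in J) (r%:E * a i) = r%:E * \esum_(i in J) a i.
Proof.
move=> r0 a0; rewrite le_eqVlt in r0; case/orP : r0 => [/eqP <-|r0].
  by rewrite mul0e esum1// => i _; rewrite mul0e.
have le (b : I -> \bar R) (s : R) : (0 < s)%R -> (forall i, 0 <= b i) ->
    \esum_(i in J) (s%:E * b i) <= s%:E * \esum_(i in J) b i.
  move=> s0 b0; apply: ge_ereal_sup => _ [X [finX XJ] <-].
  rewrite -ge0_mule_fsumr// lee_pmul2l ?lte_fin//.
  by apply: ereal_sup_ubound; exists X.
(* The inequality [le] for [r] is one half; the same inequality for [r^-1] is the other. *)
apply/eqP; rewrite eq_le le//=.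
rewrite -[leRHS]mul1e -(@mulfV _ r) ?gt_eqF// EFinM -muleA.
rewrite lee_pmul2l ?lte_fin//.
rewrite (_ : \esum_(i in J) a i = \esum_(i in J) ((r^-1)%:E * (r%:E * a i))).
  by apply: le; rewrite ?invr_gt0// => i; rewrite mule_ge0// lee_fin ltW.
by apply: eq_esum => i _; rewrite muleA -EFinM mulVf ?mul1e// gt_eqF.
Qed.

End countable_sums.

(** The pushforward bundled as a measure, the form in which the uniqueness theorems for Lebesgue and
    product measures take it. *)
Definition pushm {d1 d2} {T1 : measurableType d1} {T2 : measurableType d2}
    {R : realType} (m : {measure set T1 -> \bar R}) (f : T1 -> T2)
    (mf : measurable_fun [set: T1] f) : {measure set T2 -> \bar R} :=
  measure_function_pushforward__canonical__measure_function_Measure m mf.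

Lemma measurable_preimage {d1 d2} {T1 : measurableType d1}
    {T2 : measurableType d2} (f : T1 -> T2) (A : set T2) :
  measurable_fun [set: T1] f -> measurable A -> measurable (f @^-1` A).
Proof. by move=> mf mA; rewrite -[_ @^-1` _]setTI; exact: mf. Qed.

Section translation.
Context {R : realType}.
Notation P := (plane R).
Notation mu := (@plane_measure R).
Local Open Scope ereal_scope.

Lemma lebesgue_measure_translate (a : R) (A : set (measurableTypeR R)) :
  measurable A ->
  lebesgue_measure ((fun x : measurableTypeR R => (x + a)%R : measurableTypeR R) @^-1` A) =
  lebesgue_measure A.
Proof.
move=> mA.
have mf : measurable_fun [set: measurableTypeR R]
    (fun x : measurableTypeR R => (x + a)%R : measurableTypeR R).
  by apply: measurable_funD.
rewrite -[LHS]/(pushforward (@lebesgue_measure R) (fun x : measurableTypeR R => (x + a)%R : measurableTypeR R) A).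
apply/esym/(lebesgue_measure_unique (mu := pushm lebesgue_measure mf)) => //= _ [[b c]] _ <-.
rewrite /pushforward /=.
rewrite (_ : _ @^-1` _ = [set` `](b - a)%R, (c - a)%R]]); last first.
  by apply/seteqP; split => x /=; rewrite !in_itv/= ltrBlDr lerBrDr.
rewrite !lebesgue_measure_itv/= !lte_fin ltrD2r.
by case: ifPn => // _; rewrite -!EFinB; congr EFin; ring.
Qed.

Lemma measurable_translate (v : P) :
  measurable_fun [set: P] (fun x : P => (x + v)%R : P).
Proof.
apply/measurable_fun_pairP; split.
  rewrite (_ : _ \o _ = fun x : P => (x.1 + v.1)%R)//.
  by apply: measurable_funD.
rewrite (_ : _ \o _ = fun x : P => (x.2 + v.2)%R)//.
by apply: measurable_funD.
Qed.

Lemma plane_measure_translate (v : P) (A : set P) : measurable A ->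
  mu ((fun x : P => (x + v)%R : P) @^-1` A) = mu A.
Proof.
move=> mA; have mt := measurable_translate v.
pose m' := pushm mu mt.
rewrite -[LHS]/(m' A); apply/esym/product_measure_unique => //.
move=> A1 A2 mA1 mA2; rewrite /m' /= /pushforward.
rewrite (_ : _ @^-1` _ =
  ((fun x : measurableTypeR R => (x + v.1)%R : measurableTypeR R) @^-1` A1) `*`
  ((fun x : measurableTypeR R => (x + v.2)%R : measurableTypeR R) @^-1` A2))//.
have m1 : measurable ((fun x : measurableTypeR R => (x + v.1)%R : measurableTypeR R) @^-1` A1).
  by apply: measurable_preimage => //; apply: measurable_funD.
have m2 : measurable ((fun x : measurableTypeR R => (x + v.2)%R : measurableTypeR R) @^-1` A2).
  by apply: measurable_preimage => //; apply: measurable_funD.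
by rewrite product_measure1E//; congr (_ * _); exact: lebesgue_measure_translate.
Qed.

Lemma ge0_integral_translate (v : P) (f : P -> \bar R) :
  measurable_fun [set: P] f -> (forall x, 0 <= f x) ->
  \int[mu]_x f (x + v)%R = \int[mu]_x f x.
Proof.
move=> mf f0; have mt := measurable_translate v.
transitivity (\int[pushm mu mt]_x f x); last first.
  by apply: eq_measure_integral => /= A mA _; exact: plane_measure_translate.
have E := @ge0_integral_pushforward _ _ _ _ R _ mt mu setT f measurableT mf (fun y _ => f0 y).
by rewrite preimage_setT in E; exact: esym E.
Qed.

End translation.

(** * Linear changes of variables in the plane *)

Section linear_maps.
Context {R : realType}.
Notation P := (plane R).
Notation mu := (@plane_measure R).

Definition mulv (M : 'M[R]_2) (x : P) : P :=
  (M 0 0 * x.1 + M 0 1 * x.2, M 1 0 * x.1 + M 1 1 * x.2).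

Lemma mulvM (M N : 'M[R]_2) x : mulv (M *m N) x = mulv M (mulv N x).
Proof.
rewrite /mulv /= !mxE !big_ord_recl !big_ord0 /= !addr0.
rewrite (_ : lift 0 0 = 1); last exact/val_inj.
by congr (_, _); ring.
Qed.

Lemma mulv1 x : mulv 1%:M x = x.
Proof.
by case: x => a b; rewrite /mulv !mxE /=; congr (_, _); rewrite !(mul1r, mul0r, addr0, add0r).
Qed.

Lemma mulvD M x y : mulv M (x + y) = mulv M x + mulv M y.
Proof. by rewrite /mulv /=; congr (_, _) => /=; ring. Qed.

Lemma mulvN M x : mulv M (- x) = - mulv M x.
Proof. by rewrite /mulv /=; congr (_, _) => /=; ring. Qed.

Lemma mulvK M x : M \in unitmx -> mulv (invmx M) (mulv M x) = x.
Proof. by move=> uM; rewrite -mulvM mulVmx// mulv1. Qed.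

Lemma mulvVK M x : M \in unitmx -> mulv M (mulv (invmx M) x) = x.
Proof. by move=> uM; rewrite -mulvM mulmxV// mulv1. Qed.

Lemma measurable_mulv M : measurable_fun [set: P] (mulv M).
Proof.
apply/measurable_fun_pairP; split.
  rewrite (_ : _ \o _ = fun x : P => M 0 0 * x.1 + M 0 1 * x.2)//.
  by apply: measurable_funD; apply: measurable_funM.
rewrite (_ : _ \o _ = fun x : P => M 1 0 * x.1 + M 1 1 * x.2)//.
by apply: measurable_funD; apply: measurable_funM.
Qed.

Lemma measurable_mulv_preimage M (Z : set P) : measurable Z ->
  measurable (mulv M @^-1` Z).
Proof. by move=> mZ; rewrite -[X in measurable X]setTI; exact: measurable_mulv. Qed.

Lemma lebesgue_measure_scale (a : R) (A : set (measurableTypeR R)) :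
  a != 0 -> measurable A ->
  (`|a|%:E * lebesgue_measure ((fun x : measurableTypeR R => (a * x)%R : measurableTypeR R) @^-1` A) =
  lebesgue_measure A)%E.
Proof.
move=> a0 mA.
have mf : measurable_fun [set: measurableTypeR R]
    (fun x : measurableTypeR R => (a * x)%R : measurableTypeR R).
  by apply: measurable_funM.
pose m' : {measure set _ -> \bar R} := [the measure _ _ of
  mscale (NngNum (normr_ge0 a)) (pushm (@lebesgue_measure R) mf)].
rewrite -[LHS]/(m' A).
apply/esym/lebesgue_measure_unique => //= _ [[b c]] _ <-.
rewrite /m' /= /mscale /= /pushforward /=.
have [a1|a1] := ltP 0 a.
  rewrite (_ : _ @^-1` _ = [set` `]b / a, c / a]]); last first.
    apply/seteqP; split => x /=; rewrite !in_itv/= ltr_pdivrMr// ler_pdivlMr//.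
      by rewrite !(mulrC a).
    by rewrite !(mulrC a).
  rewrite !lebesgue_measure_itv/= !lte_fin ltr_pM2r ?invr_gt0//.
  case: ifPn => [_|]; last by rewrite mule0.
  by rewrite -!EFinB -EFinM; congr EFin; rewrite gtr0_norm//; field.
have {a1}a1 : a < 0 by rewrite lt_neqAle a0.
rewrite (_ : _ @^-1` _ = [set` `[c / a, b / a[]); last first.
  apply/seteqP; split => x /=; rewrite !in_itv/= ler_ndivrMr// ltr_ndivlMr//.
    by rewrite !(mulrC a) andbC.
  by rewrite !(mulrC a) andbC.
rewrite !lebesgue_measure_itv/= !lte_fin ltr_nM2r ?invr_lt0//.
case: ifPn => [_|]; last by rewrite mule0.
by rewrite -!EFinB -EFinM; congr EFin; rewrite ltr0_norm//; field.
Qed.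

Definition scales_measure (M : 'M[R]_2) := forall Z : set P, measurable Z ->
  (`|\det M|%:E * mu (mulv M @^-1` Z) = mu Z)%E.

Lemma scales_measureM M N : scales_measure M -> scales_measure N ->
  scales_measure (M *m N).
Proof.
move=> sM sN Z mZ.
have -> : mulv (M *m N) @^-1` Z = mulv N @^-1` (mulv M @^-1` Z).
  by apply/seteqP; split => x /=; rewrite mulvM.
rewrite det_mulmx normrM EFinM -muleA sN ?sM//.
exact: measurable_mulv_preimage.
Qed.

Definition mx2 (a b c d : R) : 'M[R]_2 :=
  \matrix_(i, j) if i == 0 then (if j == 0 then a else b)
                 else (if j == 0 then c else d).

Lemma det_mx2 (M : 'M[R]_2) : \det M = M 0 0 * M 1 1 - M 0 1 * M 1 0.
Proof.
rewrite (expand_det_row _ 0) !big_ord_recl big_ord0 /cofactor !det_mx11 !mxE.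
rewrite [lift (lift ord0 ord0) 0](_ : _ = 0 :> 'I_2); last exact/val_inj.
rewrite [lift 0 0](_ : _ = 1 :> 'I_2); last exact/val_inj.
rewrite /= ?addn0 ?add0n ?expr0 ?expr1 addr0; ring.
Qed.

Lemma scales_diag a d : a != 0 -> d != 0 -> scales_measure (mx2 a 0 0 d).
Proof.
move=> a0 d0 Z mZ; have mM := measurable_mulv (mx2 a 0 0 d).
pose m' : {measure set _ -> \bar R} := [the measure _ _ of
  mscale (NngNum (normr_ge0 (\det (mx2 a 0 0 d)))) (pushm mu mM)].
rewrite -[LHS]/(m' Z); apply/esym/product_measure_unique => //.
move=> A1 A2 mA1 mA2; rewrite /m' /= /mscale /= /pushforward /=.
rewrite (_ : _ @^-1` _ =
  ((fun x : measurableTypeR R => (a * x)%R : measurableTypeR R) @^-1` A1) `*`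
  ((fun x : measurableTypeR R => (d * x)%R : measurableTypeR R) @^-1` A2)); last first.
  by apply/seteqP; split => -[x y]; rewrite /mulv /= !mxE /= !mul0r addr0 add0r.
have m1 : measurable ((fun x : measurableTypeR R => (a * x)%R : measurableTypeR R) @^-1` A1).
  by apply: measurable_preimage => //; apply: measurable_funM.
have m2 : measurable ((fun x : measurableTypeR R => (d * x)%R : measurableTypeR R) @^-1` A2).
  by apply: measurable_preimage => //; apply: measurable_funM.
rewrite product_measure1E// -(lebesgue_measure_scale a0 mA1) -(lebesgue_measure_scale d0 mA2).
rewrite det_mx2 !mxE /= mul0r subr0 normrM EFinM.
by rewrite muleACA.
Qed.

(** On each vertical section the shear is a translation, so the lengths of the sections are
    unchanged. *)
Lemma scales_lower c : scales_measure (mx2 1 0 c 1).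
Proof.
move=> Z mZ; rewrite det_mx2 !mxE /= mul0r subr0 mulr1 normr1 mul1e.
rewrite /plane_measure /= /product_measure1.
apply: eq_integral => x _ /=.
have mS : measurable (xsection Z x) by exact: measurable_xsection.
rewrite -(lebesgue_measure_translate (c * x) mS); congr (lebesgue_measure _).
apply/seteqP; split => y /=; rewrite /xsection /= !inE /mulv /= !mxE /= !mul1r mul0r addr0.
  by rewrite addrC.
by rewrite addrC.
Qed.

Lemma scales_upper b : scales_measure (mx2 1 b 0 1).
Proof.
move=> Z mZ; rewrite det_mx2 !mxE /= mulr0 subr0 mulr1 normr1 mul1e.
(* This shear translates the horizontal sections, so the order of integration is exchanged first. *)
have mE W : measurable W -> mu W = (lebesgue_measure \x^ lebesgue_measure)%E W.
  move=> mW; apply: product_measure_unique => // A1 A2 mA1 mA2.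
  exact: product_measure2E.
rewrite !mE//; last exact: measurable_mulv_preimage.
rewrite /= /product_measure2.
apply: eq_integral => y _ /=.
have mS : measurable (ysection Z y) by exact: measurable_ysection.
rewrite -(lebesgue_measure_translate (b * y) mS); congr (lebesgue_measure _).
by apply/seteqP; split => x /=; rewrite /ysection /= !inE /mulv /= !mxE /= !mul1r mul0r add0r.
Qed.

(** A lower-diagonal-upper factorisation reduces the claim to a diagonal matrix and two shears. When
    the corner entry vanishes, subtracting the second row from the first makes it nonzero. *)
Lemma plane_measure_scale (M : 'M[R]_2) : M \in unitmx -> scales_measure M.
Proof.
have H (N : 'M[R]_2) : N 0 0 != 0 -> \det N != 0 -> scales_measure N.
  move=> n0 dN; set a := N 0 0; set b := N 0 1; set c := N 1 0; set d := N 1 1.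
  have -> : N = mx2 1 0 (c / a) 1 *m (mx2 a 0 0 (d - b * c / a) *m mx2 1 (b / a) 0 1).
    apply/matrixP => i j; rewrite !mxE !big_ord_recl !big_ord0 !mxE /=.
    rewrite !big_ord_recl !big_ord0 !mxE /=.
    case: i => -[|[|//]] hi; case: j => -[|[|//]] hj /=.
    - by rewrite !(mul0r, mulr0, mul1r, mulr1, addr0, add0r); congr (N _ _); exact/val_inj.
    - rewrite !(mul0r, mulr0, mul1r, mulr1, addr0, add0r) mulrCA mulfV ?mulr1//.
      by congr (N _ _); exact/val_inj.
    - rewrite !(mul0r, mulr0, mul1r, mulr1, addr0, add0r) divfK//.
      by congr (N _ _); exact/val_inj.
    - rewrite !(mul0r, mulr0, mul1r, mulr1, addr0, add0r).
      transitivity d; first by congr (N _ _); exact/val_inj.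
      by field.
  apply: scales_measureM; first exact: scales_lower.
  apply: scales_measureM; last exact: scales_upper.
  apply: scales_diag => //.
  move: dN; rewrite det_mx2 -/a -/b -/c -/d => dN.
  apply: contraNneq dN => e; rewrite (_ : _ - _ = a * (d - b * c / a)).
    by rewrite e mulr0.
  by field.
rewrite unitmxE unitfE => dM.
have [m0|m0] := eqVneq (M 0 0) 0; last exact: H.
have -> : M = mx2 1 1 0 1 *m (mx2 1 (-1) 0 1 *m M).
  rewrite mulmxA (_ : mx2 1 1 0 1 *m _ = 1%:M) ?mul1mx//.
  apply/matrixP => i j; rewrite !mxE !big_ord_recl !big_ord0 !mxE /=.
  by case: i => -[|[|//]] hi; case: j => -[|[|//]] hj /=; ring.
apply: scales_measureM; first exact: scales_upper.
have e00 : (mx2 1 (-1) 0 1 *m M) 0 0 = - M 1 0.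
  rewrite !mxE !big_ord_recl !big_ord0 !mxE /= m0.
  rewrite (_ : lift 0 0 = 1); last exact/val_inj.
  by ring.
have dd : \det (mx2 1 (-1) 0 1 *m M) = \det M.
  by rewrite det_mulmx [X in X * _]det_mx2 !mxE /=; ring.
apply: H; rewrite ?dd// e00 oppr_eq0.
by apply: contraNneq dM => m1; rewrite det_mx2 m0 m1; apply/eqP; ring.
Qed.

End linear_maps.

Section countable.
Context {R : realType}.

Lemma esum_single (I : choiceType) (a : I -> \bar R) (k0 : I) :
  (0 <= a k0)%E -> (forall k, k != k0 -> a k = 0%E) ->
  (\esum_(k in [set: I]) a k = a k0)%E.
Proof.
move=> a0 a1; rewrite -[RHS]esum_set1// [RHS]esum_mkcond.
apply: eq_esum => k _.
by case: ifPn => //; rewrite notin_setE /= => /eqP; exact: a1.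
Qed.

Lemma negligible_bigcup_countable {d} {T : measurableType d}
    (m : {measure set T -> \bar R}) (I : countType) (F : I -> set T) :
  (forall i, m.-negligible (F i)) -> m.-negligible (\bigcup_i F i).
Proof.
move=> nF; suff : m.-negligible (\bigcup_n oapp F set0 (pickle_inv n)).
  by apply: negligibleS => x [i _ Fx]; exists (pickle i) => //; rewrite pickleK_inv.
apply: negligible_bigcup => n; case: (pickle_inv n) => [i|] //=.
exact: negligible_set0.
Qed.

Lemma measurable_patch {d} {T : measurableType d} (D : set T) (f : T -> \bar R) :
  measurable D -> measurable_fun [set: T] f -> measurable_fun [set: T] (f \_ D).
Proof.
by move=> mD mf; apply/(measurable_restrictT f) => //; exact: measurable_funTS.
Qed.

Lemma fin_num_subset_measure {d} {T : measurableType d}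
    (m : {measure set T -> \bar R}) (A B : set T) : measurable A ->
  measurable B -> A `<=` B -> m B \is a fin_num -> m A \is a fin_num.
Proof.
move=> mA mB AB; rewrite !ge0_fin_numE//; apply: le_lt_trans.
by apply: le_measure; rewrite ?inE.
Qed.

Lemma mule_le_cancel (a b : \bar R) (p q : R) : a \is a fin_num ->
  b \is a fin_num -> 0 < p -> (0 <= a)%E -> (p%:E <= q%:E)%E ->
  (b * p%:E = a * q%:E)%E -> (a <= b)%E.
Proof.
move=> fa fb; rewrite -(fineK fa) -(fineK fb) -!EFinM !lee_fin => p0 a0 pq [E].
by nra.
Qed.

Lemma adde_le_cancel (a b : \bar R) : a \is a fin_num -> (0 <= b)%E ->
  (a + b <= a)%E -> b = 0%E.
Proof.
move=> fa b0; rewrite -[X in (_ <= X)%E]adde0 leeD2lE// => b1.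
by apply/eqP; rewrite eq_le b1 b0.
Qed.

End countable.

(** * Packings and tiles *)

Section lattices.
Context {R : realType}.
Notation P := (plane R).
Notation mu := (@plane_measure R).
Implicit Types (M : 'M[R]_2) (k : idx).

Lemma lattice_ptE M k : lattice_pt M k = mulv M ((k 0 0)%:~R, (k 1 0)%:~R).
Proof.
rewrite /lattice_pt /mulv /= !mxE !big_ord_recl !big_ord0 /= !mxE !addr0.
by rewrite [lift ord0 ord0](_ : _ = 1 :> 'I_2); last exact/val_inj.
Qed.

Lemma lattice_ptD M k j : lattice_pt M (k + j) = lattice_pt M k + lattice_pt M j.
Proof. by rewrite !lattice_ptE -mulvD !mxE !intrD. Qed.

Lemma lattice_ptN M k : lattice_pt M (- k) = - lattice_pt M k.
Proof. by rewrite !lattice_ptE -mulvN !mxE !intrN. Qed.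

Lemma lattice_ptB M k j : lattice_pt M (k - j) = lattice_pt M k - lattice_pt M j.
Proof. by rewrite lattice_ptD lattice_ptN. Qed.

Lemma lattice_pt0 M : lattice_pt M 0 = 0.
Proof. by rewrite -(subrr 0) lattice_ptB subrr. Qed.

Lemma lattice_pt_inj M : M \in unitmx -> injective (lattice_pt M).
Proof.
move=> uM k j; rewrite !lattice_ptE => /(congr1 (mulv (invmx M))).
rewrite !mulvK// => -[] /intr_inj e0 /intr_inj e1.
apply/matrixP => a b; rewrite (ord1 b); case: a => -[|[|//]] ha.
  by rewrite (_ : Ordinal ha = 0) ?e0//; exact/val_inj.
by rewrite (_ : Ordinal ha = 1) ?e1//; exact/val_inj.
Qed.

(** Exact disjointness of the translates, with no null set set aside; a [tile] is likewise an exact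
    set of coset representatives. *)
Definition packing M (S : set P) :=
  forall k x, S x -> S (x + lattice_pt M k) -> k = 0.

Definition saturation M (S : set P) : set P :=
  [set x | exists k, S (x + lattice_pt M k)].

Definition tile M (S : set P) :=
  packing M S /\ forall x, saturation M S x.

Definition invariant_set M (W : set P) := forall k x, W x -> W (x + lattice_pt M k).

Definition unit_square : set P := `[0, 1[ `*` `[0, 1[.

Definition cell M : set P := mulv (invmx M) @^-1` unit_square.

Lemma measurable_cell M : measurable (cell M).
Proof. by apply: measurable_mulv_preimage; apply: measurableX. Qed.

Lemma cell_measure M : M \in unitmx -> mu (cell M) = (`|\det M|)%:E.
Proof.
move=> uM; rewrite -(plane_measure_scale uM); last exact: measurable_cell.
rewrite (_ : _ @^-1` _ = unit_square); last first.
  by apply/seteqP; split => x; rewrite /cell /= mulvK.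
have -> : (mu unit_square = lebesgue_measure (`[0%R, 1%R[%classic : set R) * lebesgue_measure (`[0%R, 1%R[%classic : set R))%E.
  exact: product_measure1E.
by rewrite !lebesgue_measure_itv/= lte_fin ltr01 oppr0 adde0 !mule1.
Qed.

Lemma tile_cell M : M \in unitmx -> tile M (cell M).
Proof.
move=> uM; split => [k x|x].
  rewrite /cell /= mulvD lattice_ptE mulvK// /unit_square /= !in_itv /=.
  case=> /andP[a0 a1] /andP[b0 b1] [/andP[c0 c1] /andP[d0 d1]].
  have h (n : int) (t : R) : 0 <= t -> t < 1 -> 0 <= t + n%:~R -> t + n%:~R < 1 -> n = 0.
    move=> t0 t1 s0 s1.
    have : (-1)%:~R < n%:~R :> R by rewrite intrN; lra.
    have : n%:~R < 1%:~R :> R by lra.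
    by rewrite !ltr_int; clear; lia.
  apply/matrixP => i j; rewrite (ord1 j) mxE; case: i => -[|[|//]] hi.
    by rewrite (_ : Ordinal hi = 0); [exact: (h _ _ a0 a1 c0 c1)|exact/val_inj].
  by rewrite (_ : Ordinal hi = 1); [exact: (h _ _ b0 b1 d0 d1)|exact/val_inj].
set y := mulv (invmx M) x.
exists (\col_i (if i == 0 then - Num.floor y.1 else - Num.floor y.2)).
rewrite /cell /= mulvD lattice_ptE mulvK// -/y /unit_square /= !in_itv /= !mxE /=.
rewrite !intrN !subr_ge0 !ge_floor/= !ltrBlDl.
by split; rewrite -[X in _ < _ + X]/(1%:~R) -intrD floorD1_gt.
Qed.

#[local] Opaque cell.

Lemma measurable_shift (S : set P) (v : P) : measurable S ->
  measurable ((fun x : P => x + v) @^-1` S).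
Proof. by move=> mS; apply: measurable_preimage => //; exact: measurable_translate. Qed.

Lemma saturationE M S :
  saturation M S = \bigcup_k ((fun x : P => x + lattice_pt M k) @^-1` S).
Proof. by apply/seteqP; split => [x [k Sx]|x [k _ Sx]]; exists k. Qed.

Lemma measurable_saturation M S : measurable S -> measurable (saturation M S).
Proof.
move=> mS; rewrite saturationE; apply: countable_bigcupT_measurable => // k.
exact: measurable_shift.
Qed.

Lemma sub_saturation M S : S `<=` saturation M S.
Proof. by move=> x Sx; exists 0; rewrite lattice_pt0 addr0. Qed.

Lemma saturation_invariant M S : invariant_set M (saturation M S).
Proof.
move=> k x [j Sx]; exists (j - k); rewrite lattice_ptB.
by rewrite (_ : _ + _ + _ = x + lattice_pt M j)//; ring.
Qed.

Lemma invariantC M W : invariant_set M W -> invariant_set M (~` W).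
Proof.
move=> iW k x nW Wx; apply: nW; have := iW (- k) _ Wx.
by rewrite lattice_ptN addrK.
Qed.

Lemma invariant_setE M W k x : invariant_set M W ->
  (x + lattice_pt M k \in W) = (x \in W).
Proof.
move=> iW; apply/idP/idP; rewrite !inE => Wx; last exact: iW.
by have := iW (- k) _ Wx; rewrite lattice_ptN addrK.
Qed.

Lemma packing_sub M S S' : S' `<=` S -> packing M S -> packing M S'.
Proof. by move=> SS pS k x /SS Sx /SS Sy; exact: pS Sx Sy. Qed.

Lemma packing_uniq M S x k j : packing M S ->
  S (x + lattice_pt M k) -> S (x + lattice_pt M j) -> k = j.
Proof.
move=> pS Sk Sj; apply/esym/eqP; rewrite -subr_eq0; apply/eqP/(pS _ _ Sk).
by rewrite lattice_ptB (_ : _ + _ + _ = x + lattice_pt M j)//; ring.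
Qed.

Lemma saturationI M S W : invariant_set M W ->
  saturation M (S `&` W) = saturation M S `&` W.
Proof.
move=> iW; apply/seteqP; split => x.
  move=> [k [Sx Wx]]; split; first by exists k.
  by have := invariant_setE k x iW; rewrite (mem_set Wx) => /esym/set_mem.
by move=> [[k Sx] Wx]; exists k; split => //; exact: iW.
Qed.

(** Unfolding: the plane splits into the translates of [T], and each is moved back to [T] by
    translation invariance. *)
Lemma ge0_integral_tile M T (f : P -> \bar R) : tile M T -> measurable T ->
  measurable_fun [set: P] f -> (forall x, 0 <= f x)%E ->
  (\int[mu]_x f x =
   \int[mu]_(x in T) (\esum_(k in [set: idx]) f (x + lattice_pt M k)%R))%E.
Proof.
move=> [pT cT] mT mf f0.
have mft v : measurable_fun [set: P] (fun x : P => f (x + v)).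
  by apply: measurableT_comp => //; exact: measurable_translate.
rewrite ge0_integral_esum//; last first.
  by move=> k; apply: measurable_funTS; exact: mft.
have mg k : measurable_fun [set: P] (fun x : P => if x - lattice_pt M k \in T then f x else 0%E).
  have -> : (fun x : P => if x - lattice_pt M k \in T then f x else 0%E) =
    f \_ ((fun x : P => x - lattice_pt M k) @^-1` T).
    by apply/funext => x; rewrite patchE; congr (if _ then _ else _); apply/idP/idP; rewrite !inE.
  by apply: measurable_patch => //; exact: measurable_shift.
transitivity (\esum_(k in [set: idx]) \int[mu]_x
    (if (x - lattice_pt M k)%R \in T then f x else 0))%E.
  rewrite -ge0_integral_esum//; last by move=> k x; case: ifP.
  apply: eq_integral => x _; have [k Tx] := cT x.
  rewrite (esum_single (k0 := - k)).
  - by rewrite lattice_ptN opprK mem_set.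
  - by case: ifP.
  - move=> j jk; case: ifPn => //; rewrite inE -lattice_ptN => Tj.
    by move: jk; rewrite (packing_uniq pT Tx Tj) opprK eqxx.
apply: eq_esum => k _.
rewrite -(ge0_integral_translate (lattice_pt M k))//; last by move=> x; case: ifP.
by rewrite [RHS]integral_mkcond; apply: eq_integral => x _; rewrite patchE addrK.
Qed.

(** A packing set can be carried into a tile coset by coset, and a periodic integrand does not
    notice the move. *)
Lemma ge0_integral_packing M T S (f : P -> \bar R) : tile M T -> measurable T ->
  packing M S -> measurable S ->
  measurable_fun [set: P] f -> (forall x, 0 <= f x)%E ->
  (forall k x, f (x + lattice_pt M k) = f x) ->
  (\int[mu]_(x in S) f x = \int[mu]_(x in T `&` saturation M S) f x)%E.
Proof.
move=> tT mT pS mS mf f0 pf.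
have mfS : measurable_fun [set: P] (f \_ S).
  exact: measurable_patch.
rewrite integral_mkcond (ge0_integral_tile tT)//; last first.
  by move=> x; rewrite patchE; case: ifP.
rewrite integral_mkcondr; apply: eq_integral => x _.
rewrite patchE; case: ifPn => [|/negP nx].
  rewrite inE => -[k Sx]; rewrite (esum_single (k0 := k)).
  - by rewrite patchE mem_set// pf.
  - by rewrite patchE; case: ifP.
  - move=> j jk; rewrite patchE; case: ifPn => //; rewrite inE => Sj.
    by move: jk; rewrite (packing_uniq pS Sj Sx) eqxx.
apply: esum1 => k _; rewrite patchE; case: ifPn => //; rewrite inE => Sx.
by exfalso; apply: nx; rewrite inE; exists k.
Qed.

Lemma packing_measure M T S : tile M T -> measurable T -> packing M S ->
  measurable S -> mu S = mu (T `&` saturation M S).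
Proof.
move=> tT mT pS mS.
have := @ge0_integral_packing M T S (cst 1%E) tT mT pS mS (measurable_cst _) (fun=> lee01) (fun _ _ => erefl).
rewrite !integral_cst ?mul1e//.
by apply: measurableI => //; exact: measurable_saturation.
Qed.

Lemma tile_measureI M T T' W : tile M T -> measurable T -> tile M T' ->
  measurable T' -> measurable W -> invariant_set M W ->
  mu (T `&` W) = mu (T' `&` W).
Proof.
move=> tT mT tT' mT' mW iW.
rewrite (packing_measure tT' mT' (packing_sub (@subIsetl _ T W) tT.1)); last exact: measurableI.
rewrite saturationI//; congr (mu _); apply/seteqP; split => x.
  by move=> [Tx []].
by move=> [Tx Wx]; split => //; split => //; exact: tT.2.
Qed.

Lemma tile_shift M T v : tile M T -> tile M ((fun x : P => x + v) @^-1` T).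
Proof.
move=> [pT cT]; split.
  move=> k x /= Tx Tk; apply: (pT k _ Tx).
  by rewrite (_ : _ + _ + _ = x + lattice_pt M k + v)//; ring.
move=> x; have [k Tk] := cT (x + v); exists k => /=.
by rewrite (_ : _ + _ + _ = x + v + lattice_pt M k)//; ring.
Qed.

Lemma plane_measure_sigma_finite : sigma_finite [set: P] mu.
Proof.
have u1 : (1%:M : 'M[R]_2) \in unitmx by exact: unitmx1.
pose F n : set P := oapp (fun k => (fun x : P => x + lattice_pt 1%:M k) @^-1` cell 1%:M)
  set0 (pickle_inv n).
have mc := measurable_cell (1%:M : 'M[R]_2).
exists F.
  apply/seteqP; split => // x _; have [k ck] := (tile_cell u1).2 x.
  by exists (pickle k) => //; rewrite /F pickleK_inv.
move=> n; rewrite /F; case: (pickle_inv n) => [k|] /=; last by rewrite measure0.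
split; first exact: measurable_shift.
rewrite [X in (X < _)%E](_ : _ = mu (cell 1%:M)); last exact: plane_measure_translate.
by rewrite cell_measure// ltry.
Qed.

(* Fubini on the set of (x, y) in T x T' with x + y in W: by invariance, the
   sections have measure mu (T' `&` W) and mu (T `&` W). *)
Lemma tile_density M N T T' W : tile M T -> measurable T -> tile N T' ->
  measurable T' -> measurable W -> invariant_set M W -> invariant_set N W ->
  (mu (T' `&` W) * mu T = mu (T `&` W) * mu T')%E.
Proof.
move=> tT mT tT' mT' mW iM iN.
pose ms : {sigma_finite_measure set (measurableTypeR R * measurableTypeR R)%type -> \bar R} :=
  HB.pack (Measure.sort mu) (Measure.on mu)
    (Measure_isSigmaFinite.Build _ _ _ mu plane_measure_sigma_finite).
have madd : measurable_fun [set: P * P] (fun z : P * P => z.1 + z.2 : P).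
  apply/measurable_fun_pairP; split.
    rewrite (_ : _ \o _ = fun z : P * P => z.1.1 + z.2.1)//.
    apply: measurable_funD; first exact: (measurableT_comp measurable_fst measurable_fst).
    exact: (measurableT_comp measurable_fst measurable_snd).
  rewrite (_ : _ \o _ = fun z : P * P => z.1.2 + z.2.2)//.
  apply: measurable_funD; first exact: (measurableT_comp measurable_snd measurable_fst).
  exact: (measurableT_comp measurable_snd measurable_snd).
pose Z : set (P * P) := (T `*` T') `&` ((fun z : P * P => z.1 + z.2 : P) @^-1` W).
have xZ x : T x -> T' `&` [set y | W (x + y)] = xsection Z x.
  clear mT mT' mW; move=> Tx; apply/seteqP; split => y.
    by move=> [Ty Wy]; rewrite /xsection /= inE.
  by rewrite /xsection /= inE => -[[]].
have xZ0 x : ~ T x -> xsection Z x = set0.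
  clear mT mT' mW; move=> Tx; apply/seteqP; split => y //=.
  by rewrite /xsection /= inE => -[[]].
have yZ y : T' y -> T `&` [set x | W (y + x)] = ysection Z y.
  clear mT mT' mW; move=> Ty; apply/seteqP; split => x.
    by move=> [Tx Wx]; rewrite /ysection /= inE; split => //=; rewrite addrC.
  by rewrite /ysection /= inE => -[[Tx _] Wy]; split => //=; rewrite addrC.
have yZ0 y : ~ T' y -> ysection Z y = set0.
  clear mT mT' mW; move=> Ty; apply/seteqP; split => x //=.
  by rewrite /ysection /= inE => -[[]].
have mZ : measurable Z.
  apply: measurableI; first exact: measurableX.
  exact: measurable_preimage.
have cstI (S : set P) c : measurable S -> (0 <= c)%E ->
    (\int[mu]_x (if x \in S then c else 0) = c * mu S)%E.
  move=> mS c0; transitivity (\int[mu]_(x in S) cst c x)%E; last by rewrite integral_cst.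
  by rewrite [RHS]integral_mkcond; apply: eq_integral => x _; rewrite patchE.
have E : (\int[ms]_x ms (xsection Z x) = \int[ms]_y ms (ysection Z y))%E.
  rewrite -[LHS]/((ms \x ms)%E Z) -[RHS]/((ms \x^ ms)%E Z).
  by apply: product_measure_unique => // A1 A2 mA1 mA2; exact: product_measure2E.
have sec (M' : 'M[R]_2) S (x : P) : tile M' S -> measurable S -> invariant_set M' W ->
    mu (S `&` [set y | W (x + y)]) = mu (S `&` W).
  move=> tS mS iW.
  have mS' : measurable ((fun z : P => z - x) @^-1` S) by exact: measurable_shift.
  rewrite (_ : S `&` _ = (fun y : P => y + x) @^-1` (((fun z : P => z - x) @^-1` S) `&` W)).
    rewrite plane_measure_translate; last exact: measurableI.
    exact: tile_measureI (tile_shift (- x) tS) _ tS _ _ _.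
  by apply/seteqP; split => y /=; rewrite addrK addrC.
rewrite -(cstI T _ mT (measure_ge0 mu _)) -(cstI T' _ mT' (measure_ge0 mu _)).
transitivity (\int[ms]_x ms (xsection Z x))%E.
  apply: eq_integral => x _; case: ifPn => [/set_mem Tx|/negP Tx].
    rewrite -(xZ x Tx); exact: esym (sec N T' x tT' mT' iN).
  by rewrite (xZ0 x (fun Tx' => Tx (mem_set Tx'))) measure0.
apply: etrans E _; apply: eq_integral => y _; case: ifPn => [/set_mem Ty|/negP Ty].
  by rewrite -(yZ y Ty); exact: (sec M T y tT mT iM).
by rewrite (yZ0 y (fun Ty' => Ty (mem_set Ty'))) measure0.
Qed.

(** The free set [Z] lets one step serve both lattices: it receives the saturation by the other
    lattice. *)
Lemma packing_step M S Q Z : packing M S -> packing M Q ->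
  packing M (S `|` (Q `\` (saturation M S `|` Z))).
Proof.
move=> pS pQ k x [Sx|[Qx nx]] [Sy|[Qy ny]].
- exact: pS Sx Sy.
- exfalso; apply: ny; left; exists (- k).
  by rewrite lattice_ptN addrK.
- by exfalso; apply: nx; left; exists k.
- exact: pQ Qx Qy.
Qed.

Lemma invariant_null M T W : tile M T -> measurable T -> measurable W ->
  invariant_set M W -> mu (T `&` W) = 0%E -> mu W = 0%E.
Proof.
move=> tT mT mW iW h.
suff : mu.-negligible W by move/negligibleP; apply.
have -> : W = \bigcup_k ((fun x : P => x + lattice_pt M k) @^-1` (T `&` W)).
  apply/seteqP; split => x.
    by move=> Wx; have [k Tx] := tT.2 x; exists k => //; split => //; exact: iW.
  move=> [k _ [_ Wx]]; have := invariant_setE k x iW.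
  by rewrite (mem_set Wx) => /esym/set_mem.
apply: negligible_bigcup_countable => k; apply/negligibleP.
  by apply: measurable_shift; exact: measurableI.
by apply: etrans (plane_measure_translate _ _) h; exact: measurableI.
Qed.

(* Exhaust the plane by the countably many sets (D + l) `&` (D' + g), each of
   which packs by both lattices. The points not covered by the Λ-translates of
   the resulting maximal set Om form W; the invariant set W + Γ then has too
   small a density along Λ compared with its density along Γ, unless W is null. *)
Lemma bipacking_extend (M N : 'M[R]_2) (Om0 : set P) :
  M \in unitmx -> N \in unitmx -> (mu (cell M) <= mu (cell N))%E ->
  measurable Om0 -> packing M Om0 -> packing N Om0 ->
  exists Om : set P, [/\ measurable Om, Om0 `<=` Om, packing M Om, packing N Om &
    mu (~` saturation M Om) = 0%E].
Proof.
move=> uM uN leMN mOm0 pM0 pN0.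
pose Q n : set P := if pickle_inv n is Some kj then
  ((fun x : P => x + lattice_pt M kj.1) @^-1` cell M) `&`
  ((fun x : P => x + lattice_pt N kj.2) @^-1` cell N) else set0.
have mQ n : measurable (Q n).
  rewrite /Q; case: (pickle_inv n) => [[k j]|] //=.
  by apply: measurableI; apply: measurable_shift; exact: measurable_cell.
have pMQ n : packing M (Q n).
  rewrite /Q; case: (pickle_inv n) => [[k j]|] //=.
  by apply: packing_sub; [exact: subIsetl|exact: (tile_shift _ (tile_cell uM)).1].
have pNQ n : packing N (Q n).
  rewrite /Q; case: (pickle_inv n) => [[k j]|] //=.
  by apply: packing_sub; [exact: subIsetr|exact: (tile_shift _ (tile_cell uN)).1].
pose fix om n := if n is n'.+1 then
  om n' `|` (Q n' `\` (saturation M (om n') `|` saturation N (om n'))) else Om0.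
have mom n : measurable (om n).
  elim: n => [|n ih] //=; apply: measurableU => //; apply: measurableD => //.
  by apply: measurableU; exact: measurable_saturation.
have pMom n : packing M (om n).
  by elim: n => [|n ih] //=; exact: packing_step.
have pNom n : packing N (om n).
  by elim: n => [|n ih] //=; rewrite [X in _ `\` X]setUC; exact: packing_step.
have subom m n : (m <= n)%N -> om m `<=` om n.
  move=> /subnK <-; elim: (n - m)%N => [|i ih] //= x omx; left; exact: ih.
have pUn (K : 'M[R]_2) : (forall n, packing K (om n)) -> packing K (\bigcup_n om n).
  move=> pK k x [m _ omx] [n _ omy]; apply: (pK (maxn m n) _ x).
    by apply: subom omx; exact: leq_maxl.
  by apply: subom omy; exact: leq_maxr.
set Om := \bigcup_n om n.
have mOm : measurable Om by exact: bigcupT_measurable.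
have pMO : packing M Om by exact: pUn.
have pNO : packing N Om by exact: pUn.
exists Om; split => //; first by move=> x omx; exists 0%N.
(* A point of [Q n] lies in one of the two saturations at stage [n], or else it is added at stage
   [n.+1]. *)
have cov x : saturation M Om x \/ saturation N Om x.
  have [k Mk] := (tile_cell uM).2 x; have [j Nj] := (tile_cell uN).2 x.
  pose n := pickle (k, j).
  have Qx : Q n x by rewrite /Q /n pickleK_inv.
  have [[[i omx]|[i omx]]|nx] := pselect ((saturation M (om n) `|` saturation N (om n)) x).
  - by left; exists i; exists n.
  - by right; exists i; exists n.
  - by left; apply: sub_saturation; exists n.+1 => //=; right.
set W := ~` saturation M Om.
have mW : measurable W by apply: measurableC; exact: measurable_saturation.
have iW : invariant_set M W by apply: invariantC; exact: saturation_invariant.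
pose V := saturation N W.
have mV : measurable V by exact: measurable_saturation.
have iNV : invariant_set N V by exact: saturation_invariant.
have iMV : invariant_set M V.
  move=> k x [j Wx]; exists j; rewrite addrAC; exact: iW.
have WV : W `<=` V by exact: sub_saturation.
have VO : V `<=` saturation N Om.
  move=> x [j Wx]; case: (cov (x + lattice_pt N j)) => // -[i Ox].
  by exists (j + i); rewrite lattice_ptD addrA.
have tM := tile_cell uM; have tN := tile_cell uN.
have mM := measurable_cell M; have mN := measurable_cell N.
have mOV : measurable (Om `&` V) by exact: measurableI.
(* Inside [V] the set [Om] meets every N-coset exactly once, so there it has full density along
   [N]. *)
have e1 := packing_measure tN mN (packing_sub (@subIsetl _ Om V) pNO) mOV.
have e2 := packing_measure tM mM (packing_sub (@subIsetl _ Om V) pMO) mOV.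
rewrite saturationI// (setIidr VO) in e1.
rewrite saturationI// in e2.
have fM : mu (cell M) \is a fin_num by rewrite cell_measure.
have fN : mu (cell N) \is a fin_num by rewrite cell_measure.
have fMV : mu (cell M `&` V) \is a fin_num.
  by apply: (fin_num_subset_measure _ _ _ fM) => //; exact: measurableI.
have dens := tile_density tM mM tN mN mV iMV iNV.
(* The density of [V] is the same along both lattices, and the cell of [M] is the smaller one. *)
have le1 : (mu (cell M `&` V) <= mu (cell N `&` V))%E.
  have fNV : mu (cell N `&` V) \is a fin_num.
    exact: (fin_num_subset_measure (measurableI _ _ mN mV) mN (@subIsetl _ _ _) fN).
  rewrite (cell_measure uM) (cell_measure uN) in dens leMN.
  apply: mule_le_cancel fMV fNV _ _ _ dens => //.
  by rewrite normr_gt0; move: uM; rewrite unitmxE unitfE.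
have spl : (mu (cell M `&` V) = mu (cell M `&` (saturation M Om `&` V)) + mu (cell M `&` W))%E.
  rewrite -measureU.
  - congr (mu _); apply/seteqP; split => x.
      move=> [cx Vx]; have [sx|sx] := pselect (saturation M Om x).
        exact: or_introl (conj cx (conj sx Vx)).
      exact: or_intror (conj cx sx).
    move=> [[cx [_ Vx]]|[cx Wx]]; first exact: conj cx Vx.
    exact: (conj cx (WV _ Wx)).
  - exact: measurableI mM (measurableI _ _ (measurable_saturation M mOm) mV).
  - exact: measurableI mM mW.
  - rewrite -subset0 => x [[_ [sx _]] [_ Wx]]; exact: (Wx sx).
(* By [e1] and [e2] the covered part of [V] in the cell of [M] has the full measure of [V] in the
   cell of [N]; with [le1] and [spl] nothing is left for [W]. *)
apply: (invariant_null tM mM mW iW).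
rewrite -e1 e2 in le1.
have f2 : mu (cell M `&` (saturation M Om `&` V)) \is a fin_num.
  exact: (fin_num_subset_measure (measurableI _ _ mM (measurableI _ _
    (measurable_saturation M mOm) mV)) mM (@subIsetl _ _ _) fM).
rewrite spl in le1; exact: (adde_le_cancel f2 (measure_ge0 mu _) le1).
Qed.

End lattices.

(** * Square-integrable complex functions *)

Section complex_modulus.
Context {R : realType}.
Implicit Types z w : R[i].

(** The squared modulus, real valued and free of roots, so that pointwise identities are polynomial
    identities in real and imaginary parts. *)
Definition nsq z : R := complex.Re z ^+ 2 + complex.Im z ^+ 2.

Lemma nsq_ge0 z : 0 <= nsq z.
Proof. by rewrite addr_ge0// sqr_ge0. Qed.

Lemma normc_sqr z : Normc.normc z ^+ 2 = nsq z.
Proof. by case: z => a b; rewrite /Normc.normc sqr_sqrtr// addr_ge0// sqr_ge0. Qed.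

Lemma normr_nsq z : `|z| = (Num.sqrt (nsq z))%:C.
Proof. by rewrite normc_def. Qed.

Lemma nsqM z w : nsq (z * w) = nsq z * nsq w.
Proof. by case: z w => a b [c d]; rewrite /nsq /=; ring. Qed.

Lemma nsqJ z : nsq z^*%C = nsq z.
Proof. by case: z => a b; rewrite /nsq /=; ring. Qed.

Lemma nsqN z : nsq (- z) = nsq z.
Proof. by case: z => a b; rewrite /nsq /=; ring. Qed.

Lemma nsq_real (r : R) : nsq r%:C = r ^+ 2.
Proof. by rewrite /nsq /=; ring. Qed.

Lemma nsq0 : nsq 0 = 0.
Proof. by rewrite /nsq /=; ring. Qed.

Lemma nsq1 : nsq 1 = 1.
Proof. by rewrite /nsq /=; ring. Qed.

Lemma nsq_eq0 z : nsq z = 0 -> z = 0.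
Proof.
case: z => a b /eqP; rewrite /nsq /= paddr_eq0 ?sqr_ge0// !sqrf_eq0.
by move=> /andP[/eqP-> /eqP->].
Qed.

Lemma nsqD z w : nsq (z + w) = nsq z + nsq w + 2 * complex.Re (z * w^*%C).
Proof. by case: z w => a b [c d]; rewrite /nsq /=; ring. Qed.

Lemma nsqD_le z w : nsq (z + w) <= 2 * nsq z + 2 * nsq w.
Proof.
case: z w => a b [c d]; rewrite /nsq /=.
have := sqr_ge0 (a - c); have := sqr_ge0 (b - d); nra.
Qed.

Lemma mulJ z : z * z^*%C = (nsq z)%:C.
Proof. by case: z => a b; rewrite /nsq /=; congr (_ +i* _); rewrite /=; ring. Qed.

Lemma unimodular_mulJ z : nsq z = 1 -> z * z^*%C = 1.
Proof. by rewrite mulJ => ->. Qed.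

Lemma ReD z w : complex.Re (z + w) = complex.Re z + complex.Re w.
Proof. by case: z w => a b [c d]. Qed.

Lemma ImD z w : complex.Im (z + w) = complex.Im z + complex.Im w.
Proof. by case: z w => a b [c d]. Qed.

Lemma ReM z w : complex.Re (z * w) =
  complex.Re z * complex.Re w - complex.Im z * complex.Im w.
Proof. by case: z w => a b [c d]. Qed.

Lemma ImM z w : complex.Im (z * w) =
  complex.Re z * complex.Im w + complex.Im z * complex.Re w.
Proof. by case: z w => a b [c d]. Qed.

Lemma ReJ z : complex.Re z^*%C = complex.Re z.
Proof. by case: z. Qed.

Lemma ImJ z : complex.Im z^*%C = - complex.Im z.
Proof. by case: z. Qed.

Lemma conjcM z w : (z * w)^*%C = z^*%C * w^*%C.
Proof. exact: rmorphM. Qed.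

Lemma conjcD z w : (z + w)^*%C = z^*%C + w^*%C.
Proof. exact: rmorphD. Qed.

End complex_modulus.

Lemma sqre_poweR {R : realType} (x : \bar R) : (0 <= x)%E -> (x ^+ 2 = x `^ 2)%E.
Proof.
case: x => [r|_|//]; last by rewrite poweRyr ?pnatr_eq0//= mulyy.
by rewrite lee_fin => r0; rewrite /= powR_mulrn// expr2 EFinM.
Qed.

Section complex_functions.
Context {R : realType}.
Notation P := (plane R).
Notation mu := (@plane_measure R).
Implicit Types f g : P -> R[i].

Definition chi (D : set P) (x : P) : R[i] := (\1_D x)%:C.

Lemma cmeasurableD f g : cmeasurable f -> cmeasurable g ->
  cmeasurable (fun x => f x + g x).
Proof.
move=> [f1 f2] [g1 g2]; split.
  by under eq_fun do rewrite ReD; exact: measurable_funD.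
by under eq_fun do rewrite ImD; exact: measurable_funD.
Qed.

Lemma cmeasurableM f g : cmeasurable f -> cmeasurable g ->
  cmeasurable (fun x => f x * g x).
Proof.
move=> [f1 f2] [g1 g2]; split.
  by under eq_fun do rewrite ReM; apply: measurable_funB; exact: measurable_funM.
by under eq_fun do rewrite ImM; apply: measurable_funD; exact: measurable_funM.
Qed.

Lemma cmeasurableJ f : cmeasurable f -> cmeasurable (fun x => (f x)^*%C).
Proof.
move=> [f1 f2]; split; first by under eq_fun do rewrite ReJ.
by under eq_fun do rewrite ImJ; exact: measurable_funN.
Qed.

Lemma cmeasurable_cst (c : R[i]) : cmeasurable (fun=> c).
Proof. by split. Qed.

Lemma cmeasurable_real (u : P -> R) : measurable_fun [set: P] u ->
  cmeasurable (fun x => (u x)%:C).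
Proof. by move=> mu'; split. Qed.

Lemma cmeasurable_chi D : measurable D -> cmeasurable (chi D).
Proof. by move=> mD; apply: cmeasurable_real; exact: measurable_indic. Qed.

Lemma cmeasurable_shift v f : cmeasurable f -> cmeasurable (fun x => f (x + v)).
Proof.
move=> [f1 f2]; have mt := @measurable_translate R v.
by split; [exact: (measurableT_comp f1 mt)|exact: (measurableT_comp f2 mt)].
Qed.

Lemma measurable_nsq f : cmeasurable f -> measurable_fun [set: P] (fun x => nsq (f x)).
Proof. by move=> [f1 f2]; apply: measurable_funD; exact: measurable_funX. Qed.

Lemma measurable_ensq f : cmeasurable f ->
  measurable_fun [set: P] (fun x => (nsq (f x))%:E).
Proof. by move=> cf; apply/measurable_EFinP; exact: measurable_nsq. Qed.

Lemma pintD (u v : P -> R) : measurable_fun [set: P] u -> measurable_fun [set: P] v ->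
  (forall x, 0 <= u x) -> (forall x, 0 <= v x) ->
  (\int[mu]_x (u x + v x)%:E = \int[mu]_x (u x)%:E + \int[mu]_x (v x)%:E)%E.
Proof.
move=> mu' mv u0 v0; rewrite -ge0_integralD//.
- by move=> x _; rewrite lee_fin.
- exact/measurable_EFinP.
- by move=> x _; rewrite lee_fin.
- exact/measurable_EFinP.
Qed.

Lemma pintZ (c : R) (u : P -> R) : measurable_fun [set: P] u -> 0 <= c ->
  (forall x, 0 <= u x) ->
  (\int[mu]_x (c * u x)%:E = c%:E * \int[mu]_x (u x)%:E)%E.
Proof.
move=> mu' c0 u0; rewrite -ge0_integralZl//; first exact/measurable_EFinP.
by move=> x _; rewrite lee_fin.
Qed.

Lemma pintle (u v : P -> R) : measurable_fun [set: P] u -> measurable_fun [set: P] v ->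
  (forall x, 0 <= u x) -> (forall x, u x <= v x) ->
  (\int[mu]_x (u x)%:E <= \int[mu]_x (v x)%:E)%E.
Proof.
move=> mu' mv u0 uv; apply: ge0_le_integral => //.
- by move=> x _; rewrite lee_fin.
- exact/measurable_EFinP.
- exact/measurable_EFinP.
- by move=> x _; rewrite lee_fin.
Qed.

Definition N2 f : \bar R := (\int[mu]_x (nsq (f x))%:E)%E.

Lemma ensq_ge0 f x : (0 <= (nsq (f x))%:E)%E.
Proof. by rewrite lee_fin nsq_ge0. Qed.

Lemma N2_ge0 f : (0 <= N2 f)%E.
Proof. by apply: integral_ge0 => x _; exact: ensq_ge0. Qed.

Lemma cLnorm2_sqr f : (cLnorm 2%:E f ^+ 2 = N2 f)%E.
Proof.
have := @poweR_Lnorm _ _ _ mu (fun x => (Normc.normc (f x))%:E) 2.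
rewrite pnatr_eq0 => /(_ isT); rewrite /cLnorm => h.
transitivity (\int[mu]_x (`|(Normc.normc (f x))%:E| `^ 2))%E.
  by rewrite -h; apply: sqre_poweR; exact: Lnorm_ge0.
apply: eq_integral => x _.
rewrite abse_EFin poweR_EFin powR_mulrn ?normr_ge0// real_normK ?num_real//.
by rewrite normc_sqr.
Qed.

Definition L2 f := cmeasurable f /\ (N2 f < +oo)%E.

Lemma in_Lp2P f : in_Lp 2%:E f <-> L2 f.
Proof.
rewrite /in_Lp /L2 -cLnorm2_sqr; split => -[cf h]; split => //.
  move: h; have := Lnorm_ge0 mu 2%:E (fun x => (Normc.normc (f x))%:E).
  rewrite -/(cLnorm 2%:E f); case: (cLnorm 2%:E f) => //= r _ _.
  by rewrite -EFinM ltry.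
move: h; have := Lnorm_ge0 mu 2%:E (fun x => (Normc.normc (f x))%:E).
rewrite -/(cLnorm 2%:E f); case: (cLnorm 2%:E f) => //= r _ _.
by rewrite ltry.
Qed.

Lemma L2D f g : L2 f -> L2 g -> L2 (fun x => f x + g x).
Proof.
move=> [cf Nf] [cg Ng]; split; first exact: cmeasurableD.
have mf := measurable_nsq cf; have mg := measurable_nsq cg.
apply: (@le_lt_trans _ _ (2%:E * N2 f + 2%:E * N2 g)%E).
  rewrite -!pintZ//; try by move=> x; exact: nsq_ge0.
  rewrite -pintD; try by [apply: measurable_funM|move=> x; rewrite mulr_ge0// nsq_ge0].
  apply: pintle => [|||x]; last exact: nsqD_le.
  - by apply: measurable_nsq; exact: cmeasurableD.
  - by apply: measurable_funD; apply: measurable_funM.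
  - by move=> x; exact: nsq_ge0.
by rewrite lte_add_pinfty// lte_mul_pinfty.
Qed.

Lemma L2M (C : R) (b f : P -> R[i]) : cmeasurable b -> (forall x, nsq (b x) <= C) ->
  L2 f -> L2 (fun x => b x * f x).
Proof.
move=> cb bC [cf Nf]; split; first exact: cmeasurableM.
have C0 : 0 <= C by exact: le_trans (nsq_ge0 (b 0)) (bC 0).
apply: (@le_lt_trans _ _ (C%:E * N2 f)%E); last by rewrite lte_mul_pinfty.
have mf := measurable_nsq cf.
rewrite -pintZ//; last by move=> x; exact: nsq_ge0.
apply: pintle => [|||x]; last by rewrite nsqM ler_wpM2r// nsq_ge0.
- by apply: measurable_nsq; exact: cmeasurableM.
- exact: measurable_funM.
- by move=> x; exact: nsq_ge0.
Qed.

Lemma L2Z (c : R[i]) f : L2 f -> L2 (fun x => c * f x).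
Proof. by apply: (@L2M (nsq c)) => //; exact: cmeasurable_cst. Qed.

Lemma L2B f g : L2 f -> L2 g -> L2 (fun x => f x - g x).
Proof.
move=> Lf Lg; have := L2D Lf (L2Z (-1) Lg).
by under eq_fun do rewrite mulN1r.
Qed.

Lemma nsq_chi D (x : P) : nsq (chi D x) <= 1.
Proof. by rewrite nsq_real indicE; case: (x \in D); rewrite ?expr1n// expr0n. Qed.

Lemma N2_shift v f : cmeasurable f -> N2 (fun x => f (x + v)) = N2 f.
Proof.
move=> cf; apply: (@ge0_integral_translate _ v (fun x => (nsq (f x))%:E)).
  exact: measurable_ensq.
by move=> x; exact: ensq_ge0.
Qed.

Lemma L2_shift v f : L2 f -> L2 (fun x => f (x + v)).
Proof. by move=> [cf Nf]; split; [exact: cmeasurable_shift|rewrite N2_shift]. Qed.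

Lemma N2_chi D : measurable D -> N2 (chi D) = mu D.
Proof.
move=> mD; transitivity (\int[mu]_x (\1_D x)%:E)%E; last by rewrite integral_indic// setIT.
apply: eq_integral => x _; rewrite nsq_real indicE.
by case: (x \in D); rewrite ?expr1n// expr0n.
Qed.

Definition cintegrable f :=
  mu.-integrable [set: P] (EFin \o (fun x => complex.Re (f x))) /\
  mu.-integrable [set: P] (EFin \o (fun x => complex.Im (f x))).

Lemma L2_integrable_nsq f : L2 f -> mu.-integrable [set: P] (fun x => (nsq (f x))%:E).
Proof.
move=> [cf Nf]; apply/integrableP; split; first exact: measurable_ensq.
by under eq_integral do rewrite gee0_abs ?ensq_ge0//.
Qed.

Lemma norm_ReIm_mulJ (z w : R[i]) : `|complex.Re (z * w^*%C)| <= nsq z + nsq w /\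
  `|complex.Im (z * w^*%C)| <= nsq z + nsq w.
Proof.
case: z w => a b [c d]; rewrite /nsq /= !ler_norml.
have := sqr_ge0 (a + c); have := sqr_ge0 (b + d); have := sqr_ge0 (a - c).
have := sqr_ge0 (b - d); have := sqr_ge0 (a + d); have := sqr_ge0 (b + c).
have := sqr_ge0 (a - d); have := sqr_ge0 (b - c).
by move=> *; split; apply/andP; split; nra.
Qed.

Lemma cintegrable_mulJ f g : L2 f -> L2 g -> cintegrable (fun x => f x * (g x)^*%C).
Proof.
move=> Lf Lg; have [cf _] := Lf; have [cg _] := Lg.
have [m1 m2] := cmeasurableM cf (cmeasurableJ cg).
have It := integrableD measurableT (L2_integrable_nsq Lf) (L2_integrable_nsq Lg).
split; apply: (le_integrable measurableT _ _ It); try exact/measurable_EFinP.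
  move=> x _; rewrite /= lee_fin (ger0_norm (addr_ge0 (nsq_ge0 _) (nsq_ge0 _))).
  by have [] := norm_ReIm_mulJ (f x) (g x).
move=> x _; rewrite /= lee_fin (ger0_norm (addr_ge0 (nsq_ge0 _) (nsq_ge0 _))).
by have [] := norm_ReIm_mulJ (f x) (g x).
Qed.

Lemma cintegralD f g : cintegrable f -> cintegrable g ->
  cintegral (fun x => f x + g x) = cintegral f + cintegral g.
Proof.
move=> [f1 f2] [g1 g2]; rewrite /cintegral -[RHS]/(_ +i* _); congr (_ +i* _); rewrite -RintegralD//.
  by apply: eq_Rintegral => x _; rewrite ReD.
by apply: eq_Rintegral => x _; rewrite ImD.
Qed.

Lemma cintegralZ (c : R[i]) f : cintegrable f ->
  cintegral (fun x => c * f x) = c * cintegral f.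
Proof.
move=> [f1 f2]; case: c => a b; rewrite /cintegral -[RHS]/(_ +i* _).
have i1 := integrableZl measurableT a f1; have i2 := integrableZl measurableT b f2.
have i3 := integrableZl measurableT a f2; have i4 := integrableZl measurableT b f1.
congr (_ +i* _).
  rewrite -!RintegralZl// -RintegralB//.
  by apply: eq_Rintegral => x _; rewrite ReM.
rewrite -!RintegralZl// -RintegralD//.
by apply: eq_Rintegral => x _; rewrite ImM.
Qed.

Lemma eq_cintegral f g : f =1 g -> cintegral f = cintegral g.
Proof. by move=> /funext ->. Qed.

Lemma Rintegral_translate v (u : P -> R) : measurable_fun [set: P] u ->
  \int[mu]_x u (x + v) = \int[mu]_x u x.
Proof.
move=> mu'; rewrite /Rintegral; congr fine.
rewrite integralE [in RHS]integralE.
have mE : measurable_fun [set: P] (EFin \o u) by exact/measurable_EFinP.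
have p0 x : (0 <= (EFin \o u)^\+ x)%E by exact: funepos_ge0.
have n0 x : (0 <= (EFin \o u)^\- x)%E by exact: funeneg_ge0.
have E1 := ge0_integral_translate v (measurable_funepos mE) p0.
have E2 := ge0_integral_translate v (measurable_funeneg mE) n0.
rewrite -E1 -E2; congr (_ - _)%E; apply: eq_integral => x _.
  by rewrite !funeposE.
by rewrite !funenegE.
Qed.

Lemma cintegral_translate v f : cmeasurable f ->
  cintegral (fun x => f (x + v)) = cintegral f.
Proof.
move=> [f1 f2]; rewrite /cintegral; congr (_ +i* _).
  exact: (@Rintegral_translate v (fun x => complex.Re (f x))).
exact: (@Rintegral_translate v (fun x => complex.Im (f x))).
Qed.

Lemma innerE f g : inner f g = cintegral (fun t => f t * (g t)^*%C).
Proof. by []. Qed.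

Lemma innerDl f1 f2 g : L2 f1 -> L2 f2 -> L2 g ->
  inner (fun x => f1 x + f2 x) g = inner f1 g + inner f2 g.
Proof.
move=> L1 L2' Lg; rewrite !innerE -cintegralD; try exact: cintegrable_mulJ.
by apply: eq_cintegral => x; rewrite mulrDl.
Qed.

Lemma innerZl c f g : L2 f -> L2 g -> inner (fun x => c * f x) g = c * inner f g.
Proof.
move=> Lf Lg; rewrite !innerE -cintegralZ; last exact: cintegrable_mulJ.
by apply: eq_cintegral => x; rewrite mulrA.
Qed.

Lemma innerZr c f g : L2 f -> L2 g -> inner f (fun x => c * g x) = c^*%C * inner f g.
Proof.
move=> Lf Lg; rewrite !innerE -cintegralZ; last exact: cintegrable_mulJ.
by apply: eq_cintegral => x; rewrite conjcM mulrCA.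
Qed.

Lemma innerBl f1 f2 g : L2 f1 -> L2 f2 -> L2 g ->
  inner (fun x => f1 x - f2 x) g = inner f1 g - inner f2 g.
Proof.
move=> L1 L2' Lg; rewrite -[X in _ + X]mulN1r -innerZl// -innerDl//; last exact: L2Z.
by rewrite !innerE; apply: eq_cintegral => x; rewrite mulN1r.
Qed.

Lemma inner_self f : L2 f -> ((complex.Re (inner f f))%:E = N2 f)%E.
Proof.
move=> Lf; rewrite !innerE /cintegral /= /Rintegral fineK.
  by apply: eq_integral => x _; rewrite mulJ.
have [h _] := cintegrable_mulJ Lf Lf.
exact: integrable_fin_num h.
Qed.

Lemma N2B f g : L2 f -> L2 g -> (N2 (fun x => (f x - g x)%R) =
  (fine (N2 f) + fine (N2 g) - 2 * complex.Re (inner f g))%:E)%E.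
Proof.
move=> Lf Lg.
have [I1 _] := cintegrable_mulJ Lf Lf; have [I2 _] := cintegrable_mulJ Lg Lg.
have [I3 _] := cintegrable_mulJ Lf Lg.
rewrite -(inner_self Lf) -(inner_self Lg) -inner_self; last exact: L2B.
congr EFin; rewrite !innerE /cintegral /=.
rewrite -RintegralZl// -RintegralD// -RintegralB//.
- apply: eq_Rintegral => x _; case: (f x) (g x) => a b [c d] /=; ring.
- exact: (integrableD measurableT I1 I2).
- exact: (integrableZl measurableT 2 I3).
Qed.

End complex_functions.

(** * Characters and Parseval's identity on a tile *)

Section exponentials.
Context {R : realType}.
Implicit Types t : R.

Lemma expiD t u : expi (t + u) = expi t * expi u.
Proof.
rewrite /expi cosD sinD; apply/eqP; rewrite eq_complex /=.
by rewrite eqxx/= addrC [in eqbRHS]addrC [sin t * cos u]mulrC; apply/eqP; ring.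
Qed.

Lemma expi0 : expi (0 : R) = 1.
Proof. by rewrite /expi cos0 sin0. Qed.

Lemma nsq_expi t : nsq (expi t) = 1.
Proof. exact: cos2Dsin2. Qed.

Lemma expiN t : expi (- t) = (expi t)^*%C.
Proof. by rewrite /expi cosN sinN. Qed.

Lemma expi_pi : expi (pi : R) = -1.
Proof. by rewrite /expi cospi sinpi; apply/eqP; rewrite eq_complex /= oppr0 !eqxx. Qed.

Lemma expi_2pi_int (n : int) : expi (2 * pi * n%:~R : R) = 1.
Proof.
have h (m : nat) : expi (2 * pi * m%:R : R) = 1.
  elim: m => [|m ih]; first by rewrite mulr0 expi0.
  rewrite (_ : 2 * pi * m.+1%:R = 2 * pi * m%:R + (pi + pi)).
    by rewrite expiD ih mul1r expiD expi_pi mulrNN mulr1.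
  by rewrite -natr1; ring.
case: n => m; first exact: h.
by rewrite NegzE mulrNz mulrN expiN h conjc1.
Qed.

Lemma expi_real_cos t : ((cos t)%:C = 2^-1%:C * (expi t + expi (- t)))%C.
Proof.
rewrite /expi cosN sinN; apply/eqP; rewrite eq_complex /=.
by apply/andP; split; apply/eqP; field.
Qed.

End exponentials.

Section characters.
Context {R : realType}.
Variable C : 'M[R]_2.
Hypothesis uC : C \in unitmx.
Notation P := (plane R).
Notation mu := (@plane_measure R).
Implicit Types (k j : idx) (p q : P -> R[i]).

(** For [C] the inverse transpose of [B] this is the pairing of [B k] with [x]: the exponentials of
    the frame are the characters of the plane modulo the lattice of [C]. *)
Definition phase k (x : P) : R :=
  (k 0 0)%:~R * (mulv (invmx C) x).1 + (k 1 0)%:~R * (mulv (invmx C) x).2.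

Definition chr k (x : P) : R[i] := expi (2 * pi * phase k x).

Lemma phaseD k x y : phase k (x + y) = phase k x + phase k y.
Proof. by rewrite /phase mulvD /=; ring. Qed.

Lemma chr_shift k x y : chr k (x + y) = chr k x * chr k y.
Proof. by rewrite /chr phaseD mulrDr expiD. Qed.

Lemma chrD k j x : chr (k + j) x = chr k x * chr j x.
Proof. by rewrite /chr -expiD; congr expi; rewrite /phase !mxE !intrD; ring. Qed.

Lemma chrN k x : chr (- k) x = (chr k x)^*%C.
Proof. by rewrite /chr -expiN; congr expi; rewrite /phase !mxE !intrN; ring. Qed.

Lemma chr0 x : chr 0 x = 1.
Proof. by rewrite /chr -[RHS]expi0; congr expi; rewrite /phase !mxE; ring. Qed.

Lemma nsq_chr k x : nsq (chr k x) = 1.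
Proof. exact: nsq_expi. Qed.

Lemma chr_lattice k j : chr k (lattice_pt C j) = 1.
Proof.
rewrite -[RHS](expi_2pi_int (k 0 0 * j 0 0 + k 1 0 * j 1 0)).
by rewrite /chr /phase lattice_ptE mulvK//= intrD !intrM.
Qed.

Lemma chr_periodic k j x : chr k (x + lattice_pt C j) = chr k x.
Proof. by rewrite chr_shift chr_lattice mulr1. Qed.

Lemma measurable_phase k : measurable_fun [set: P] (phase k).
Proof.
have mv := measurable_mulv (invmx C).
have m1 : measurable_fun [set: P] (fun x : P => (mulv (invmx C) x).1).
  exact: (measurableT_comp measurable_fst mv).
have m2 : measurable_fun [set: P] (fun x : P => (mulv (invmx C) x).2).
  exact: (measurableT_comp measurable_snd mv).
by apply: measurable_funD; apply: measurable_funM.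
Qed.

Lemma cmeasurable_chr k : cmeasurable (chr k).
Proof.
have mphase : measurable_fun [set: P] (fun x => 2 * pi * phase k x).
  by apply: measurable_funM => //; exact: measurable_phase.
split.
  apply: (measurableT_comp (_ : measurable_fun setT (@cos R)) mphase).
  by apply: continuous_measurable_fun; exact: continuous_cos.
apply: (measurableT_comp (_ : measurable_fun setT (@sin R)) mphase).
by apply: continuous_measurable_fun; exact: continuous_sin.
Qed.

(** The vector is half a period along a coordinate where [k] does not vanish. Translation by it
    yields the orthogonality of distinct characters. *)
Lemma chr_sign k : k != 0 -> exists v, chr k v = -1.
Proof.
move=> k0.
have [i ki] : exists i : 'I_2, k i 0 != 0.
  apply/existsP; rewrite -negb_forall; apply: contra k0 => /forallP h.
  by apply/eqP/matrixP => i j; rewrite (ord1 j) mxE; exact/eqP.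
have ki' : (k i 0)%:~R != 0 :> R by rewrite intr_eq0.
pose t : R := (2 * (k i 0)%:~R)^-1.
exists (mulv C (if i == 0 then (t, 0) else (0, t))).
rewrite /chr /phase mulvK// -[RHS]expi_pi; congr expi.
case: i ki ki' @t => -[|[|//]] hi; rewrite /= => ki ki'.
  rewrite (_ : Ordinal hi = 0) in ki' *; last exact/val_inj.
  by rewrite /= mulr0 addr0; field.
rewrite (_ : Ordinal hi = 1) in ki' *; last exact/val_inj.
by rewrite /= mulr0 add0r; field.
Qed.

(** Frequencies may repeat in the list, which makes sums and products immediate; [trig_uniq] merges
    them. *)
Definition trig p := exists s : seq (idx * R[i]),
  forall x, p x = \sum_(a <- s) a.2 * chr a.1 x.

Lemma trig_chr k : trig (chr k).
Proof. by exists [:: (k, 1)] => x; rewrite big_seq1 mul1r. Qed.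

Lemma trig_cst c : trig (fun=> c).
Proof. by exists [:: (0, c)] => x; rewrite big_seq1 chr0 mulr1. Qed.

Lemma trigD p q : trig p -> trig q -> trig (fun x => p x + q x).
Proof. by move=> [s hs] [t ht]; exists (s ++ t) => x; rewrite big_cat /= hs ht. Qed.

Lemma trigM p q : trig p -> trig q -> trig (fun x => p x * q x).
Proof.
move=> [s hs] [t ht].
exists [seq (a.1 + b.1, a.2 * b.2) | a <- s, b <- t] => x.
rewrite hs ht big_allpairs_dep mulr_suml; apply: eq_bigr => a _.
by rewrite mulr_sumr; apply: eq_bigr => b _; rewrite /= chrD; ring.
Qed.

Lemma trigZ c p : trig p -> trig (fun x => c * p x).
Proof. by move=> tp; apply: trigM => //; exact: trig_cst. Qed.

Lemma trigB p q : trig p -> trig q -> trig (fun x => p x - q x).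
Proof.
move=> tp tq; have := trigD tp (trigZ (-1) tq).
by under eq_fun do rewrite mulN1r.
Qed.

Lemma trigX p n : trig p -> trig (fun x => p x ^+ n).
Proof.
move=> tp; elim: n => [|n ih]; first by under eq_fun do rewrite expr0; exact: trig_cst.
by under eq_fun do rewrite exprS; exact: trigM.
Qed.

Lemma trig_cmeasurable p : trig p -> cmeasurable p.
Proof.
move=> [s hs]; have -> : p = fun x => \sum_(a <- s) a.2 * chr a.1 x by exact/funext.
elim: s {hs} => [|a s ih].
  by under eq_fun do rewrite big_nil; exact: cmeasurable_cst.
under eq_fun do rewrite big_cons; apply: cmeasurableD => //.
by apply: cmeasurableM; [exact: cmeasurable_cst|exact: cmeasurable_chr].
Qed.

Lemma trig_bounded p : trig p -> exists b : R, forall x, nsq (p x) <= b.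
Proof.
move=> [s hs]; have -> : p = fun x => \sum_(a <- s) a.2 * chr a.1 x by exact/funext.
elim: s {hs} => [|a s [b ih]].
  by exists 0 => x; rewrite big_nil nsq0.
exists (2 * nsq a.2 + 2 * b) => x; rewrite big_cons.
apply: le_trans (nsqD_le _ _) _; rewrite nsqM nsq_chr mulr1 lerD2l.
by rewrite ler_pM2l.
Qed.

Lemma trig_uniq p : trig p -> exists2 s : seq idx, uniq s &
  exists c : idx -> R[i], forall x, p x = \sum_(k <- s) c k * chr k x.
Proof.
move=> [s hs]; have -> : p = fun x => \sum_(a <- s) a.2 * chr a.1 x by exact/funext.
elim: s {hs} => [|[k a] s [r ur [c ih]]].
  by exists [::] => //; exists (fun=> 0) => x; rewrite !big_nil.
have [kr|kr] := boolP (k \in r).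
  exists r => //; exists (fun j => (j == k)%:R * a + c j) => x.
  rewrite big_cons ih /= [RHS](eq_bigr (fun j => (j == k)%:R * a * chr j x + c j * chr j x)); last first.
    by move=> j _; rewrite mulrDl.
  rewrite big_split; congr (_ + _); rewrite (bigD1_seq k)//= (eqxx k) mul1r big1 ?addr0// => j /negPf jk.
  by rewrite jk !mul0r.
exists (k :: r); first by rewrite /= kr.
exists (fun j => if j == k then a else c j) => x.
rewrite !big_cons /= eqxx ih; congr (_ + _); rewrite !big_seq; apply: eq_bigr => j jr.
by case: eqP => // jk; rewrite -jk jr in kr.
Qed.

End characters.

(** * Polynomial approximation of a step *)

Section step_approximation.
Context {R : realType}.
Implicit Types (w : R) (j n : nat).

Lemma bernoulli_ge w n : -1 <= w -> 1 + n%:R * w <= (1 + w) ^+ n.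
Proof.
move=> w1; elim: n => [|n ih]; first by rewrite mul0r addr0 expr0.
rewrite exprS -natr1; have n0 : 0 <= n%:R * (w * w) :> R by rewrite mulr_ge0// -expr2 sqr_ge0.
have w0 : 0 <= 1 + w by lra.
have := ler_wpM2l w0 ih; nra.
Qed.

(* With n = j^2, [1 - (1 - w^n)^(2^(n-j))] tends to the indicator of w > 1/2,
   since 2^(n-j) w^n = 2^-j (2w)^n; hence trigonometric polynomials of a
   cosine approximate indicators of strips. *)
Definition step_poly j w := 1 - (1 - w ^+ (j * j)) ^+ (2 ^ (j * j - j)).

Lemma step_poly_itv j w : 0 <= w -> w <= 1 -> 0 <= step_poly j w <= 1.
Proof.
move=> w0 w1; have a0 : 0 <= w ^+ (j * j) by exact: exprn_ge0.
have a1 : w ^+ (j * j) <= 1 by exact: exprn_ile1.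
have b0 : 0 <= (1 - w ^+ (j * j)) ^+ (2 ^ (j * j - j)).
  by apply: exprn_ge0; rewrite subr_ge0.
have b1 : (1 - w ^+ (j * j)) ^+ (2 ^ (j * j - j)) <= 1.
  by apply: exprn_ile1; lra.
by apply/andP; rewrite /step_poly; split; lra.
Qed.

Lemma pow2_weight j w : (2 ^ (j * j - j))%:R * w ^+ (j * j) =
  (2^-1) ^+ j * (2 * w) ^+ (j * j) :> R.
Proof.
have jj : (j <= j * j)%N by case: j => // j; rewrite leq_pmulr.
rewrite exprMn mulrA; congr (_ * _).
rewrite -{2}(subnK jj) exprD mulrCA -exprMn mulVf ?expr1n ?mulr1 ?natrX//.
Qed.

(** With [a = w ^+ (j * j)] and [m = 2 ^ (j * j - j)], Bernoulli gives [1 - (1 - a) ^+ m <= m a],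
    and [pow2_weight] bounds [m a] by 2^-j as long as [2 * w <= 1]. *)
Lemma step_poly_lo j w : 0 <= w -> w <= 2^-1 -> step_poly j w <= 2^-1 ^+ j.
Proof.
move=> w0 w1; have a1 : w ^+ (j * j) <= 1 by apply: exprn_ile1 => //; lra.
have := @bernoulli_ge (- w ^+ (j * j)) (2 ^ (j * j - j)).
rewrite lerN2 => /(_ a1); rewrite mulrN pow2_weight => h.
have : (2 * w) ^+ (j * j) <= 1 by apply: exprn_ile1; lra.
have h0 : 0 <= 2^-1 ^+ j :> R by exact: exprn_ge0.
move=> /(ler_wpM2l h0); rewrite mulr1 /step_poly; lra.
Qed.

(** Since [(1 - a) (1 + a) <= 1], the defect [(1 - a) ^+ m] is at most the inverse of
    [(1 + a) ^+ m]. By Bernoulli the latter exceeds [m a = (s ^+ j / 2) ^+ j], which is at least 2^j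
    once [s ^+ j >= 4]. *)
Lemma step_poly_hi w : 2^-1 < w -> w <= 1 ->
  exists J, forall j, (J <= j)%N -> 1 - step_poly j w <= 2^-1 ^+ j.
Proof.
move=> w0 w1; pose s := 2 * w; have s1 : 1 < s by rewrite /s; lra.
(* From [J] on, [j (s - 1) > 3], and Bernoulli gives [s ^+ j >= 4]. *)
pose J := (Num.truncn (3 / (s - 1))).+1.
have hs j : (J <= j)%N -> 4 <= s ^+ j.
  move=> Jj; have J1 : 3 / (s - 1) < j%:R.
    by apply: lt_le_trans (truncnS_gt _) _; rewrite ler_nat.
  have := @bernoulli_ge (s - 1) j; rewrite (_ : 1 + (s - 1) = s); last ring.
  have -> : -1 <= s - 1 by lra.
  move=> /(_ isT); rewrite ltr_pdivrMr in J1; last by lra.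
  by lra.
exists J => j Jj; rewrite /step_poly opprB addrC subrK.
set a := w ^+ (j * j); set m := (2 ^ (j * j - j))%N.
have a0 : 0 <= a by apply: exprn_ge0; lra.
have a1 : a <= 1 by apply: exprn_ile1; lra.
have h1 : (1 - a) ^+ m * (1 + a) ^+ m <= 1.
  by rewrite -exprMn; apply: exprn_ile1; nra.
have h2 : 2 ^+ j <= (1 + a) ^+ m.
  have := @bernoulli_ge a m; rewrite (le_trans (lerN10 _) a0).
  move=> /(_ isT); rewrite pow2_weight -/s exprM -exprMn => h.
  suff : 2 ^+ j <= (2^-1 * s ^+ j) ^+ j by lra.
  by apply: lerXn2r; rewrite ?nnegrE//; have := hs _ Jj; lra.
have b0 : 0 <= (1 - a) ^+ m by apply: exprn_ge0; lra.
rewrite exprVn -[_ ^-1]mul1r ler_pdivlMr//.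
by apply: le_trans _ h1; exact: ler_wpM2l.
Qed.

End step_approximation.

(** * Sets with indicators approximable by trigonometric polynomials *)

Section density.
Context {R : realType}.
Variable C : 'M[R]_2.
Hypothesis uC : C \in unitmx.
Notation P := (plane R).
Notation mu := (@plane_measure R).
Implicit Types (k j : idx) (p q F G : P -> R[i]) (D Z : set P).

Lemma N2D_le F G : cmeasurable F -> cmeasurable G ->
  (N2 (fun x => (F x + G x)%R) <= 2%:E * N2 F + 2%:E * N2 G)%E.
Proof.
move=> cf cg; have mf := measurable_nsq cf; have mg := measurable_nsq cg.
rewrite -!pintZ//; try by move=> x; exact: nsq_ge0.
rewrite -pintD; try by [apply: measurable_funM|move=> x; rewrite mulr_ge0// nsq_ge0].
apply: pintle => [|||x]; last exact: nsqD_le.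
- by apply: measurable_nsq; exact: cmeasurableD.
- by apply: measurable_funD; apply: measurable_funM.
- by move=> x; exact: nsq_ge0.
Qed.

Lemma N2_le F G : cmeasurable F -> cmeasurable G ->
  (forall x, nsq (F x) <= nsq (G x)) -> (N2 F <= N2 G)%E.
Proof.
move=> cF cG FG; apply: pintle => //; try exact: measurable_nsq.
by move=> x; exact: nsq_ge0.
Qed.

Lemma N2Z c F : cmeasurable F -> N2 (fun x => c * F x) = ((nsq c)%:E * N2 F)%E.
Proof.
move=> cF; rewrite /N2 -pintZ ?nsq_ge0//; last 2 first.
- exact: measurable_nsq.
- by move=> x; exact: nsq_ge0.
by apply: eq_integral => x _; rewrite nsqM.
Qed.

Lemma cmeasurableB F G : cmeasurable F -> cmeasurable G ->
  cmeasurable (fun x => F x - G x).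
Proof.
move=> cF cG; have := cmeasurableD cF (cmeasurableM (cmeasurable_cst (-1)) cG).
by under eq_fun do rewrite mulN1r.
Qed.

Definition approximable (T : set P) F := forall e : R, 0 < e ->
  exists2 p, trig C p & (N2 (fun x => chi T x * (F x - p x))%R <= e%:E)%E.

Section fixed_window.
Variable T : set P.
Hypothesis mT : measurable T.
Hypothesis fT : mu T \is a fin_num.

Lemma approximable_trig p : trig C p -> approximable T p.
Proof.
move=> tp e e0; exists p => //; rewrite (_ : N2 _ = 0%E) ?lee_fin ?ltW//.
rewrite /N2; under eq_integral do rewrite subrr mulr0 nsq0.
exact: integral0.
Qed.

Lemma approximable_close F : cmeasurable F ->
  (forall e : R, 0 < e -> exists2 G, approximable T G /\ cmeasurable G &
     (N2 (fun x => chi T x * (F x - G x))%R <= e%:E)%E) -> approximable T F.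
Proof.
(* [N2] is a squared norm: [N2D_le] doubles each of the two errors, whence e/4. *)
move=> cF h e e0; have e4 : 0 < e / 4 by lra.
have [G [aG cG] FG] := h _ e4; have [p tp Gp] := aG _ e4.
have cp := trig_cmeasurable tp; have cT := cmeasurable_chi mT.
exists p => //.
rewrite (_ : (fun x => _) = fun x => chi T x * (F x - G x) + chi T x * (G x - p x)); last first.
  by apply/funext => x; rewrite -mulrDr; congr (_ * _); ring.
apply: le_trans (N2D_le _ _) _; try by apply: cmeasurableM => //; exact: cmeasurableB.
rewrite (_ : e%:E = 2%:E * (e / 4)%:E + 2%:E * (e / 4)%:E)%E.
  by apply: leeD; apply: lee_wpmul2l.
by rewrite -!EFinM -EFinD; congr EFin; field.
Qed.

Lemma approximableD F G : cmeasurable F -> cmeasurable G ->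
  approximable T F -> approximable T G -> approximable T (fun x => F x + G x).
Proof.
move=> cF cG aF aG e e0; have e4 : 0 < e / 4 by lra.
have [p tp Fp] := aF _ e4; have [q tq Gq] := aG _ e4.
have cp := trig_cmeasurable tp; have cq := trig_cmeasurable tq.
have cT := cmeasurable_chi mT.
exists (fun x => p x + q x); first exact: trigD.
rewrite (_ : (fun x => _) = fun x => chi T x * (F x - p x) + chi T x * (G x - q x)); last first.
  by apply/funext => x; rewrite -mulrDr; congr (_ * _); ring.
apply: le_trans (N2D_le _ _) _; try by apply: cmeasurableM => //; exact: cmeasurableB.
rewrite (_ : e%:E = 2%:E * (e / 4)%:E + 2%:E * (e / 4)%:E)%E.
  by apply: leeD; apply: lee_wpmul2l.
by rewrite -!EFinM -EFinD; congr EFin; field.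
Qed.

Lemma approximableZ c F : cmeasurable F -> approximable T F ->
  approximable T (fun x => c * F x).
Proof.
move=> cF aF e e0.
have b0 : 0 < nsq c + 1 by have := nsq_ge0 c; lra.
have [p tp Fp] := aF (e / (nsq c + 1)) (divr_gt0 e0 b0).
have cp := trig_cmeasurable tp; have cT := cmeasurable_chi mT.
exists (fun x => c * p x); first exact: trigZ.
rewrite (_ : (fun x => _) = fun x => c * (chi T x * (F x - p x))); last first.
  by apply/funext => x; ring.
rewrite N2Z; last by apply: cmeasurableM => //; exact: cmeasurableB.
apply: (@le_trans _ _ ((nsq c + 1)%:E * (e / (nsq c + 1))%:E)%E).
  by apply: lee_pmul => //; [rewrite lee_fin nsq_ge0|exact: N2_ge0|rewrite lee_fin; lra].
by rewrite -EFinM lee_fin mulrC divfK// gt_eqF.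
Qed.

Lemma approximable_dominated (Fn : nat -> P -> R[i]) F (u : P -> R) :
  (forall n, cmeasurable (Fn n)) -> cmeasurable F ->
  mu.-integrable [set: P] (EFin \o u) -> (forall x, 0 <= u x) ->
  (forall n x, T x -> nsq (F x - Fn n x) <= u x) ->
  (forall x, T x -> nsq (F x - Fn n x) @[n --> \oo] --> 0) ->
  (forall n, approximable T (Fn n)) -> approximable T F.
Proof.
move=> cFn cF iu u0 Fu Fcvg aFn; apply: approximable_close => // e e0.
have cT := cmeasurable_chi mT.
pose v n x := nsq (chi T x * (F x - Fn n x)).
have mv n : measurable_fun [set: P] (EFin \o v n).
  by apply: measurable_ensq; apply: cmeasurableM => //; exact: cmeasurableB.
have vE n x : v n x = if x \in T then nsq (F x - Fn n x) else 0.
  by rewrite /v /chi indicE; case: (x \in T); rewrite ?mul1r// mul0r nsq0.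
have v0 : {ae mu, forall x, setT x -> (EFin \o v n) x @[n --> \oo] --> (cst 0%E : P -> \bar R) x}.
  apply: aeW => x _; apply: cvg_EFin; first exact: nearW.
  have [xT|xT] := boolP (x \in T).
    rewrite (_ : fine \o _ = fun n => nsq (F x - Fn n x)).
      exact: Fcvg (set_mem xT).
    by apply/funext => n; rewrite /= vE xT.
  rewrite (_ : fine \o _ = fun=> 0); first exact: cvg_cst.
  by apply/funext => n; rewrite /= vE (negPf xT).
have vu : {ae mu, forall x n, setT x -> (`|(EFin \o v n) x| <= (EFin \o u) x)%E}.
  apply: aeW => x n _; rewrite /= lee_fin ger0_norm ?nsq_ge0// vE.
  by case: ifPn => [/set_mem Tx|_]; [exact: Fu|exact: u0].
have [_ _ h] := dominated_convergence measurableT mv (measurable_cst _) v0 iu vu.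
rewrite integral0 in h.
move/fine_cvgP: h => [hfin hc].
have [N _ hN] : \forall n \near \oo, (\int[mu]_x (EFin \o v n) x)%E \is a fin_num /\
    fine (\int[mu]_x (EFin \o v n) x)%E < e.
  by apply: filterI => //; exact: (cvgr_lt _ hc).
have [fn hn] := hN N (leqnn N).
exists (Fn N); first by split.
have -> : N2 (fun x => (chi T x * (F x - Fn N x))%R) = (fine (\int[mu]_x (EFin \o v N) x)%E)%:E.
  by rewrite fineK.
by rewrite lee_fin ltW.
Qed.

Lemma approximable_bounded (Fn : nat -> P -> R[i]) F (b : R) :
  (forall n, cmeasurable (Fn n)) -> cmeasurable F ->
  (forall n x, T x -> nsq (F x - Fn n x) <= b) ->
  (forall x, T x -> nsq (F x - Fn n x) @[n --> \oo] --> 0) ->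
  (forall n, approximable T (Fn n)) -> approximable T F.
Proof.
move=> cFn cF Fb Fcvg aFn.
apply: (@approximable_dominated Fn F (fun x => `|b| * \1_T x)) => //.
- have i1 : mu.-integrable [set: P] (EFin \o \1_T : P -> \bar R).
    apply/integrableP; split; first by apply/measurable_EFinP; exact: measurable_indic.
    rewrite (eq_integral (fun x : P => (\1_T x)%:E)).
      by rewrite integral_indic// setIT ltey_eq fT.
    by move=> x _; rewrite /= ger0_norm// indicE.
  exact: (integrableZl measurableT `|b| i1).
- move=> n x Tx; rewrite indicE mem_set// mulr1.
  by apply: le_trans (Fb n x Tx) _; exact: ler_norm.
Qed.

(** The arbitrary factor [p] is what makes goodness pass to intersections: [chi Z x * p x] is
    replaced by a polynomial [q], and then [chi D x * q x] is approximated in turn. *)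
Definition good D := measurable D /\
  forall p, trig C p -> approximable T (fun x => chi D x * p x).

Lemma chiI D Z x : chi (D `&` Z) x = chi D x * chi Z x.
Proof.
rewrite /chi -rmorphM /=; congr (_ %:C); rewrite !indicE in_setI.
by case: (x \in D); case: (x \in Z); rewrite ?mul1r ?mul0r.
Qed.

Lemma chiC D x : chi (~` D) x = 1 - chi D x.
Proof.
rewrite /chi !indicE in_setC; case: (x \in D) => /=.
  by rewrite subrr.
by rewrite subr0.
Qed.

Lemma good_setT : good setT.
Proof.
split => // p tp; rewrite (_ : (fun x => _) = p); first exact: approximable_trig.
by apply/funext => x; rewrite /chi indicT mul1r.
Qed.

Lemma goodC D : good D -> good (~` D).
Proof.
move=> [mD aD]; split; first exact: measurableC.
move=> p tp; have cp := trig_cmeasurable tp; have cD := cmeasurable_chi mD.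
rewrite (_ : (fun x => _) = fun x => p x + -1 * (chi D x * p x)); last first.
  by apply/funext => x; rewrite chiC; ring.
have cDp := cmeasurableM cD cp.
apply: approximableD => //.
- by apply: cmeasurableM => //; exact: cmeasurable_cst.
- exact: approximable_trig.
- by apply: approximableZ => //; exact: aD.
Qed.

Lemma goodI D Z : good D -> good Z -> good (D `&` Z).
Proof.
move=> [mD aD] [mZ aZ]; split; first exact: measurableI.
move=> p tp; have cp := trig_cmeasurable tp.
have cD := cmeasurable_chi mD; have cZ := cmeasurable_chi mZ.
have cT := cmeasurable_chi mT.
apply: approximable_close.
  by apply: cmeasurableM => //; apply: cmeasurable_chi; exact: measurableI.
move=> e e0; have [q tq hq] := aZ p tp e e0; have cq := trig_cmeasurable tq.
exists (fun x => chi D x * q x); first by split; [exact: aD|exact: cmeasurableM].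
apply: le_trans hq; apply: N2_le => [||x].
- apply: cmeasurableM => //; apply: cmeasurableB; apply: cmeasurableM => //.
  by apply: cmeasurable_chi; exact: measurableI.
- by apply: cmeasurableM => //; apply: cmeasurableB => //; exact: cmeasurableM.
rewrite chiI (_ : _ * _ = chi D x * (chi T x * (chi Z x * p x - q x))); last by ring.
by rewrite nsqM ler_piMl ?nsq_ge0// nsq_chi.
Qed.

Lemma good_bigcup (F : (set P)^nat) : (forall n, good (F n)) -> good (\bigcup_n F n).
Proof.
move=> gF; pose G n := \big[setU/set0]_(i < n) F i.
have gU D Z : good D -> good Z -> good (D `|` Z).
  move=> gD gZ; rewrite -[D `|` Z]setCK setCU.
  by apply: goodC; apply: goodI; exact: goodC.
have gG n : good (G n).
  elim: n => [|n ih]; rewrite /G ?big_ord0 ?big_ord_recr /=.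
    by rewrite -setCT; apply: goodC; exact: good_setT.
  exact: gU.
have mU : measurable (\bigcup_n F n).
  by apply: bigcupT_measurable => n; exact: (gF n).1.
split=> // p tp; have cp := trig_cmeasurable tp; have [b pb] := trig_bounded tp.
have cU := cmeasurable_chi mU.
have dE n x : chi (\bigcup_n F n) x * p x - chi (G n) x * p x =
    (chi (\bigcup_n F n) x - chi (G n) x) * p x by rewrite mulrBl.
have GU n : G n `<=` \bigcup_n F n by exact: bigsetU_bigcup.
have dchi n x : nsq (chi (\bigcup_n F n) x - chi (G n) x) <= 1.
  rewrite /chi -rmorphB /= nsq_real !indicE.
  have [xG|xG] := boolP (x \in G n).
    by rewrite (mem_set (GU n x (set_mem xG))) subrr expr0n.
  by rewrite subr0; case: (_ \in _); rewrite ?expr1n ?expr0n.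
apply: (@approximable_bounded (fun n x => chi (G n) x * p x) _ b).
- by move=> n; apply: cmeasurableM => //; apply: cmeasurable_chi; exact: (gG n).1.
- exact: cmeasurableM.
- move=> n x _; rewrite dE nsqM; apply: le_trans (pb x).
  by rewrite ler_piMl// nsq_ge0.
- move=> x _; apply: cvg_near_cst.
  have [[N _ FN]|nx] := pselect ((\bigcup_n F n) x).
    exists N.+1 => // n /= Nn; rewrite dE.
    have Gx : G n x by rewrite /G; exact: (bigsetU_sup Nn FN).
    rewrite /chi !indicE (mem_set Gx) mem_set; last by exists N.
    by rewrite subrr mul0r nsq0.
  exists 0%N => // n _ /=; rewrite dE /chi !indicE memNset// memNset; last first.
    by move=> Gx; apply: nx; exact: GU Gx.
  by rewrite subrr mul0r nsq0.
- by move=> n; exact: (gG n).2.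
Qed.

Lemma good_sigma_algebra : sigma_algebra setT good.
Proof.
split.
- by rewrite -setCT; apply: goodC; exact: good_setT.
- by move=> D gD; rewrite setTD; exact: goodC.
- by move=> F gF; exact: good_bigcup.
Qed.

End fixed_window.
End density.

Section window.
Context {R : realType}.
Implicit Types (a t : R).

(** A cosine bump centred at the midpoint of ]a, 1[ and shifted to cross the level 1/2 exactly at
    [a] and at 1. The difference of cosines is at most 2 in modulus, so dividing by 4 keeps the
    values in [0, 1]. *)
Definition window a t : R :=
  2^-1 + (cos (2 * pi * (t - (a + 1) / 2)) - cos (pi * (1 - a))) / 4.

Lemma window_itv a t : 0 <= window a t <= 1.
Proof.
have := cos_le1 (2 * pi * (t - (a + 1) / 2)); have := cos_le1 (pi * (1 - a)).
have := cos_geN1 (2 * pi * (t - (a + 1) / 2)); have := cos_geN1 (pi * (1 - a)).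
by rewrite /window => *; apply/andP; split; lra.
Qed.

Lemma window_gt a t : 0 <= a < 1 -> 0 <= t < 1 -> (2^-1 < window a t) = (a < t).
Proof.
move=> /andP[a0 a1] /andP[t0 t1]; have p0 := pi_gt0 R.
have -> : (2^-1 < window a t) =
    (cos (pi * (1 - a)) < cos (2 * pi * (t - (a + 1) / 2))).
  by rewrite /window; apply/idP/idP; lra.
(* The argument is folded into [0, pi], where the cosine decreases. Three foldings occur: [t] right
   of the midpoint, left of it by at most 1/2, and farther left, where a full period is added. *)
have H s : cos (2 * pi * (t - (a + 1) / 2)) = cos (pi * s) -> 0 <= s <= 1 ->
    (s < 1 - a) = (a < t) ->
    (cos (pi * (1 - a)) < cos (2 * pi * (t - (a + 1) / 2))) = (a < t).
  move=> -> /andP[s0 s1] <-; rewrite ltr_cos ?ltr_pM2l// in_itv/=.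
    by apply/andP; split; nra.
  by apply/andP; split; nra.
have [tm|tm] := leP ((a + 1) / 2) t.
  apply: (H (2 * (t - (a + 1) / 2))).
  - by congr cos; ring.
  - by apply/andP; split; lra.
  - by apply/idP/idP; lra.
have [tm'|tm'] := leP ((a + 1) / 2 - t) (2^-1).
  apply: (H (2 * ((a + 1) / 2 - t))).
  - by rewrite -cosN; congr cos; ring.
  - by apply/andP; split; lra.
  - by apply/idP/idP; lra.
apply: (H (2 - 2 * ((a + 1) / 2 - t))).
- rewrite (_ : pi * _ = 2 * pi * (t - (a + 1) / 2) + pi *+ 2) ?cosD2pi//.
  by rewrite -mulr_natr; ring.
- by apply/andP; split; lra.
- by apply/idP/idP; lra.
Qed.

End window.

Section cell_density.
Context {R : realType}.
Variable C : 'M[R]_2.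
Notation P := (plane R).
Notation mu := (@plane_measure R).
Implicit Types (k j : idx) (p q F G : P -> R[i]) (D Z : set P).

Lemma trig_window a k : trig C (fun x => (window a (phase C k x))%:C).
Proof.
set th := 2 * pi * ((a + 1) / 2).
have -> : (fun x => (window a (phase C k x))%:C) = (fun x =>
    (2^-1 - cos (pi * (1 - a)) / 4)%:C + (8^-1%:C * expi (- th)) * chr C k x +
    (8^-1%:C * expi th) * chr C (- k) x).
  apply/funext => x; rewrite /window.
  rewrite (_ : _ * (_ - _) = 2 * pi * phase C k x - th); last by rewrite /th; ring.
  rewrite (_ : 2^-1 + _ = (2^-1 - cos (pi * (1 - a)) / 4) +
     4^-1 * cos (2 * pi * phase C k x - th)); last by field.
  rewrite rmorphD rmorphM /= expi_real_cos opprB addrC [_ - th]addrC !expiD -!addrA [in RHS]addrA addrC.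
  rewrite chrN /chr -expiN (_ : 8^-1%:C = 4^-1%:C * 2^-1%:C); last first.
    by rewrite -rmorphM; congr (_%:C); field.
  by rewrite -[RHS]addrA; congr (_ + _); ring.
apply: trigD; first apply: trigD.
- exact: trig_cst.
- by apply: trigZ; exact: trig_chr.
- by apply: trigZ; exact: trig_chr.
Qed.

Lemma trig_step_poly n (w : P -> R) : trig C (fun x => (w x)%:C) ->
  trig C (fun x => (step_poly n (w x))%:C).
Proof.
move=> tw; rewrite /step_poly.
under eq_fun do rewrite rmorphB rmorphXn rmorphB rmorphXn /=.
apply: trigB; first exact: trig_cst.
apply: trigX; apply: trigB; first exact: trig_cst.
exact: trigX.
Qed.

Section window_sets.
Variable T : set P.
Hypothesis mT : measurable T.
Hypothesis fT : mu T \is a fin_num.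

Lemma eq_good D Z : measurable Z -> (forall x, T x -> (D x <-> Z x)) ->
  good C T D -> good C T Z.
Proof.
move=> mZ DZ [mD aD]; split=> // p tp e e0; have [q tq hq] := aD p tp e e0.
exists q => //; apply: le_trans hq; apply: pintle; last move=> x.
- apply: measurable_nsq; apply: cmeasurableM; first exact: cmeasurable_chi.
  apply: cmeasurableB; last exact: trig_cmeasurable tq.
  by apply: cmeasurableM; [exact: cmeasurable_chi|exact: trig_cmeasurable tp].
- apply: measurable_nsq; apply: cmeasurableM; first exact: cmeasurable_chi.
  apply: cmeasurableB; last exact: trig_cmeasurable tq.
  by apply: cmeasurableM; [exact: cmeasurable_chi|exact: trig_cmeasurable tp].
- by move=> x; exact: nsq_ge0.
rewrite /chi !indicE; have [/set_mem Tx|xT] := boolP (x \in T); last by rewrite !mul0r.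
suff -> : (x \in D) = (x \in Z) by [].
by apply/idP/idP => /set_mem h; apply/mem_set; apply/(DZ x Tx).
Qed.

(** [step_poly n] of the window converges boundedly to the indicator of the strip at every point of
    [T]. For [a] outside [0, 1[ the strip contains all of [T] or misses it. *)
Lemma good_strip k a : (forall x, T x -> 0 <= phase C k x < 1) ->
  good C T [set x | a < phase C k x].
Proof.
move=> ph; have mS : measurable [set x | a < phase C k x].
  rewrite (_ : [set x | _] = phase C k @^-1` `]a, +oo[); last first.
    by apply/seteqP; split=> x; rewrite /= in_itv/= andbT.
  by apply: measurable_preimage; [exact: measurable_phase|exact: measurable_itv].
have [a0|a0] := ltP a 0.
  apply: (eq_good mS _ (good_setT C T)) => x /ph /andP[h _]; split=> // _.
  exact: lt_le_trans a0 h.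
have [a1|a1] := leP 1 a.
  apply: (eq_good mS _ (@goodC _ C T mT _ (good_setT C T))) => x /ph /andP[_ h]; split.
    by rewrite setCT.
  by move=> /= ax; have := lt_trans ax h; rewrite ltNge a1.
have aI : 0 <= a < 1 by rewrite a0 a1.
split=> // p tp; have cp := trig_cmeasurable tp; have [b pb] := trig_bounded tp.
pose w x := window a (phase C k x).
have tw n : trig C (fun x => (step_poly n (w x))%:C).
  by apply: trig_step_poly; exact: trig_window.
have w01 x : 0 <= w x <= 1 by exact: window_itv.
pose d n x := \1_[set x | a < phase C k x] x - step_poly n (w x).
have dE n x : chi [set x | a < phase C k x] x * p x - (step_poly n (w x))%:C * p x =
    (d n x)%:C * p x.
  by rewrite /chi -mulrBl; congr (_ * _); apply: esym; exact: rmorphB.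
have d1 n x : `|d n x| <= 1.
  have /andP[w0 w1] := w01 x; have := step_poly_itv n w0 w1.
  rewrite /d indicE; case: (x \in _) => /andP[s0 s1]; rewrite ler_norml;
  by apply/andP; split; rewrite /=; lra.
have dd n x : nsq ((d n x)%:C * p x) <= `|d n x| * b.
  rewrite nsqM nsq_real -real_normK ?num_real// expr2; apply: ler_pM => //.
    exact: nsq_ge0.
  by rewrite ler_piMr.
have b0 : 0 <= b by apply: le_trans (nsq_ge0 _) (pb 0).
apply: (@approximable_bounded _ C T mT fT (fun n x => (step_poly n (w x))%:C * p x) _ b).
- by move=> n; apply: cmeasurableM => //; exact: trig_cmeasurable (tw n).
- by apply: cmeasurableM => //; exact: cmeasurable_chi.
- move=> n x _; rewrite dE; apply: le_trans (dd n x) _; rewrite ler_piMl//.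
- move=> x Tx; have /andP[w0 w1] := w01 x.
  have dlim : exists J, forall n, (J <= n)%N -> `|d n x| <= 2^-1 ^+ n.
    have [ax|ax] := boolP (a < phase C k x).
      have [J hJ] : exists J, forall n, (J <= n)%N -> 1 - step_poly n (w x) <= 2^-1 ^+ n.
        by apply: step_poly_hi => //; rewrite window_gt// ph.
      exists J => n /hJ; rewrite /d indicE mem_set//= ger0_norm//.
      by have /andP[_] := step_poly_itv n w0 w1; lra.
    exists 0%N => n _; rewrite /d indicE memNset; last exact/negP.
    rewrite sub0r normrN ger0_norm; last by case/andP: (step_poly_itv n w0 w1).
    by apply: step_poly_lo => //; rewrite leNgt window_gt// ph.
  have [J hJ] := dlim.
  apply: (@squeeze_cvgr _ _ _ _ (fun=> 0) (fun n => 2^-1 ^+ n * b)).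
  + exists J => // n /= Jn; rewrite dE nsq_ge0/=; apply: le_trans (dd n x) _.
    by apply: ler_wpM2r => //; exact: hJ.
  + exact: cvg_cst.
  + rewrite -[0](mul0r b); apply: cvgMl; apply: cvg_expr.
    by rewrite ger0_norm//; lra.
- by move=> n; apply: approximable_trig => //; exact: trigM.
Qed.

Lemma good_phase k (A : set (measurableTypeR R)) :
  (forall x, T x -> 0 <= phase C k x < 1) -> measurable A ->
  good C T [set x | A (phase C k x)].
Proof.
move=> ph; have -> : measurable A = (@RGenOInfty.G R).-sigma.-measurable A.
  by rewrite -RGenOInfty.measurableE.
pose Q (A : set R) := good C T [set x | A (phase C k x)].
suff : <<s @RGenOInfty.G R >> `<=` Q by move=> h /h.
apply: smallest_sub.
  have [s0 sC sU] := good_sigma_algebra C mT fT; split.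
  - exact: s0.
  - by move=> B /sC; rewrite !setTD; exact.
  - move=> B hB; have := sU (fun n => [set x | B n (phase C k x)]) hB.
    rewrite /Q; congr (good C T _); apply/seteqP; split=> x [n _ h]; exists n => //.
move=> _ [a ->]; rewrite /Q (_ : [set x | _] = [set x | a < phase C k x]).
  exact: good_strip.
by apply/seteqP; split=> x; rewrite /= in_itv/= andbT.
Qed.

End window_sets.

Hypothesis uC : C \in unitmx.

Lemma fin_num_cell : mu (cell C) \is a fin_num.
Proof. by rewrite cell_measure. Qed.

(** In lattice coordinates the Borel sets are generated by rectangles, and a rectangle is the
    intersection of two sets cut out by the phases of the unit vectors. *)
Lemma good_cell D : measurable D -> good C (cell C) D.
Proof.
move=> mD; have mc := measurable_cell C; have fc := fin_num_cell.
pose Q (Z : set P) := good C (cell C) [set x | Z (mulv (invmx C) x)].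
suff QZ Z : measurable Z -> Q Z.
  have := QZ _ (measurable_mulv_preimage C mD); rewrite /Q; congr (good C _ _).
  by apply/seteqP; split=> x /=; rewrite mulvVK.
rewrite measurable_prod_measurableType.
apply: smallest_sub Z.
  have [s0 sC sU] := good_sigma_algebra C mc fc; split.
  - exact: s0.
  - by move=> B /sC; rewrite !setTD; exact.
  - move=> B hB; have := sU (fun n => [set x | B n (mulv (invmx C) x)]) hB.
    rewrite /Q; congr (good C _ _); apply/seteqP; split=> x [n _ h]; exists n => //.
move=> _ [A mA [B mB <-]].
pose e (i : 'I_2) : idx := \col_j (j == i)%:R.
have e1 x : phase C (e 0) x = (mulv (invmx C) x).1.
  by rewrite /phase !mxE/= mul1r mul0r addr0.
have e2 x : phase C (e 1) x = (mulv (invmx C) x).2.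
  by rewrite /phase !mxE/= mul1r mul0r add0r.
have cellE x : cell C x -> 0 <= (mulv (invmx C) x).1 < 1 /\ 0 <= (mulv (invmx C) x).2 < 1.
  by move=> [/=]; rewrite !in_itv.
have gA : good C (cell C) [set x | A (phase C (e 0) x)].
  by apply: good_phase => // x /cellE[]; rewrite e1.
have gB : good C (cell C) [set x | B (phase C (e 1) x)].
  by apply: good_phase => // x /cellE[_]; rewrite e2.
have := goodI mc gA gB; rewrite /Q; congr (good C _ _).
by apply/seteqP; split=> x; rewrite /= e1 e2.
Qed.

End cell_density.

(** * From the standard cell to arbitrary tiles *)

Section tiles.
Context {R : realType}.
Variable C : 'M[R]_2.
Hypothesis uC : C \in unitmx.
Notation P := (plane R).
Notation mu := (@plane_measure R).
Implicit Types (k j : idx) (p q F G : P -> R[i]) (D Z S T : set P).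

Lemma N2_window T F : measurable T ->
  N2 (fun x => chi T x * F x) = (\int[mu]_(x in T) (nsq (F x))%:E)%E.
Proof.
move=> mT; rewrite [RHS]integral_mkcond; apply: eq_integral => x _.
by rewrite nsqM /chi nsq_real indicE patchE; case: (x \in T) => /=;
  rewrite ?expr1n ?mul1r// expr0n mul0r.
Qed.

Lemma ge0_integral_periodic T (f : P -> \bar R) : tile C T -> measurable T ->
  measurable_fun [set: P] f -> (forall x, 0 <= f x)%E ->
  (forall k x, f (x + lattice_pt C k) = f x) ->
  (\int[mu]_(x in T) f x = \int[mu]_(x in cell C) f x)%E.
Proof.
move=> [pT sT] mT mf f0 fper.
rewrite (ge0_integral_packing (tile_cell uC) (measurable_cell C) pT mT mf f0 fper).
by congr (integral _ _ _); apply/seteqP; split=> [x []//|x cx]; split.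
Qed.

Lemma tile_measure T : tile C T -> measurable T -> mu T = (`|\det C|)%:E.
Proof.
move=> tT mT; rewrite -(cell_measure uC) -[in LHS](setIT T) -[in RHS](setIT (cell C)).
apply: (tile_measureI tT mT (tile_cell uC) (measurable_cell C)); first exact: measurableT.
by [].
Qed.

Definition periodic F := forall k x, F (x + lattice_pt C k) = F x.

Lemma trig_periodic p : trig C p -> periodic p.
Proof.
move=> [s hs] k x; rewrite !hs; apply: eq_bigr => a _.
by rewrite chr_periodic.
Qed.

Lemma N2_tile T F : tile C T -> measurable T -> cmeasurable F -> periodic F ->
  N2 (fun x => chi T x * F x) = N2 (fun x => chi (cell C) x * F x).
Proof.
move=> tT mT cF pF; rewrite !N2_window//; last exact: measurable_cell.
apply: ge0_integral_periodic => //; first exact: measurable_ensq.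
  by move=> x; rewrite lee_fin nsq_ge0.
by move=> k x; rewrite pF.
Qed.

Section density_tile.
Variable T : set P.
Hypothesis tT : tile C T.
Hypothesis mT : measurable T.

Let fT : mu T \is a fin_num.
Proof. by rewrite tile_measure. Qed.

(** On [T] the set [D] agrees with the periodisation [W] of its part in [T]. For periodic functions
    the tile may be exchanged for the standard cell, where [good_cell] applies. *)
Lemma approximable_chi D : measurable D -> approximable C T (chi D).
Proof.
move=> mD e e0; pose W := saturation C (D `&` T).
have mDT : measurable (D `&` T) by exact: measurableI.
have mW : measurable W by exact: measurable_saturation.
have [_ gW] := good_cell uC mW.
have [q tq hq] := gW _ (trig_cst C 1) e e0.
have cq := trig_cmeasurable tq.
have pW : periodic (chi W).
  move=> k x; rewrite /chi !indicE invariant_setE//; exact: saturation_invariant.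
have cW := cmeasurable_chi mW.
exists q => //; apply: le_trans hq.
have -> : (fun x => chi T x * (chi D x - q x)) = (fun x => chi T x * (chi W x - q x)).
  apply/funext => x; rewrite /chi !indicE.
  have [/set_mem Tx|xT] := boolP (x \in T); last by rewrite !mul0r.
  suff -> : (x \in D) = (x \in W) by [].
  apply/idP/idP => /set_mem h; apply/mem_set.
    by apply: sub_saturation; split.
  case: h => k [Dk Tk]; have k0 : k = 0 by exact: tT.1 Tk.
  by rewrite k0 lattice_pt0 addr0 in Dk.
have cB : cmeasurable (fun x => chi W x - q x) by exact: cmeasurableB.
have cB' : cmeasurable (fun x => chi W x * 1 - q x).
  by under eq_fun do rewrite mulr1.
rewrite (N2_tile tT mT cB); last first.
  by move=> k x; rewrite pW (trig_periodic tq).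
by under [in X in (_ <= X)%E]eq_fun do rewrite mulr1.
Qed.

Lemma approximable_sum (I : Type) (s : seq I) (u : I -> P -> R[i]) :
  (forall i, cmeasurable (u i)) -> (forall i, approximable C T (u i)) ->
  cmeasurable (fun x => \sum_(i <- s) u i x) /\
  approximable C T (fun x => \sum_(i <- s) u i x).
Proof.
move=> cu au; elim: s => [|i s [ihc iha]].
  under eq_fun do rewrite big_nil; split; first exact: cmeasurable_cst.
  by apply: approximable_trig => //; exact: trig_cst.
under eq_fun do rewrite big_cons; split; first exact: cmeasurableD.
exact: approximableD.
Qed.

Lemma approximable_nneg (f : P -> R) : measurable_fun [set: P] f ->
  (forall x, 0 <= f x) -> L2 (fun x => (f x)%:C) ->
  approximable C T (fun x => (f x)%:C).
Proof.
move=> mf f0 [cf f2].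
have mf' : measurable_fun [set: P] (EFin \o f) by exact/measurable_EFinP.
pose g n : P -> R := nnsfun_approx measurableT mf' n.
have g0 n x : 0 <= g n x by exact: fun_ge0.
have gcvg x : g n x @[n --> \oo] --> f x.
  have := @cvg_nnsfun_approx _ _ _ _ measurableT _ mf' (fun x _ => f0 x : (0 <= (f x)%:E)%E) x I.
  by move=> h; exact: (fine_cvg h).
have gle n x : g n x <= f x.
  rewrite -(cvg_lim _ (gcvg x))//.
  apply: (@nondecreasing_cvgn_le R (fun n => g n x)).
    move=> i j ij; have := nd_nnsfun_approx measurableT mf' ij.
    by move=> /lefP; exact.
  exact: cvgP (gcvg x).
apply: (@approximable_dominated _ C T mT (fun n x => (g n x)%:C) _ (fun x => f x ^+ 2)).
- by move=> n; exact: cmeasurable_real.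
- exact: cmeasurable_real.
- have := L2_integrable_nsq (conj cf f2 : L2 _).
  by under eq_fun do rewrite nsq_real.
- by move=> x; exact: sqr_ge0.
- move=> n x _; rewrite -rmorphB nsq_real; have := gle n x; have := g0 n x.
  by have := f0 x; nra.
- move=> x _; under eq_fun do rewrite -rmorphB nsq_real.
  rewrite -[0](_ : (f x - f x) ^+ 2 = 0); last by rewrite subrr expr0n.
  have h : f x - g n x @[n --> \oo] --> f x - f x.
    by apply: cvgB; [exact: cvg_cst|exact: gcvg].
  by rewrite expr2; under eq_fun do rewrite expr2; exact: cvgM.
- move=> n.
  have mD c : measurable (g n @^-1` [set c]) by apply: measurable_preimage => //; exact: measurable_set1.
  have chiE c D : (fun x : P => (c * \1_D x)%:C) = fun x => c%:C * chi D x.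
    by apply/funext => x; rewrite rmorphM.
  have mchi c := cmeasurable_chi (mD c).
  under eq_fun do rewrite [g n _]fimfunEord rmorph_sum.
  apply: (approximable_sum _ _ _).2 => i; rewrite chiE.
    by apply: cmeasurableM; [exact: cmeasurable_cst|exact: mchi].
  by apply: approximableZ; [|exact: mchi|exact: approximable_chi].
Qed.

Lemma approximable_real (f : P -> R) : measurable_fun [set: P] f ->
  L2 (fun x => (f x)%:C) -> approximable C T (fun x => (f x)%:C).
Proof.
move=> mf [_ f2].
pose fp x : R := Num.max (f x) 0; pose fm x : R := Num.max (- f x) 0.
have mp : measurable_fun [set: P] fp by apply: measurable_maxr.
have mm : measurable_fun [set: P] fm by apply: measurable_maxr => //; exact: measurableT_comp.
have hl (g : P -> R) : measurable_fun [set: P] g -> (forall x, 0 <= g x) ->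
    (forall x, g x <= `|f x|) -> approximable C T (fun x => (g x)%:C).
  move=> mg g0 gf; apply: approximable_nneg => //; split; first exact: cmeasurable_real.
  apply: le_lt_trans f2; apply: N2_le => [||x]; try exact: cmeasurable_real.
  by rewrite !nsq_real -[f x ^+ 2]real_normK ?num_real// lerXn2r ?nnegrE.
rewrite (_ : (fun x => _) = fun x => (fp x)%:C + -1 * (fm x)%:C); last first.
  apply/funext => x; rewrite mulN1r -rmorphB; congr (_%:C).
  by rewrite /fp /fm !/Num.max; do 2 case: ltP => ?; lra.
apply: approximableD => //; try exact: cmeasurable_real.
- by apply: cmeasurableM; [exact: cmeasurable_cst|exact: cmeasurable_real].
- apply: hl => // x; rewrite /fp; first by rewrite le_max lexx orbT.
  by rewrite ge_max ler_norm normr_ge0.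
- apply: approximableZ => //.
  apply: hl => // x; rewrite /fm; first by rewrite le_max lexx orbT.
  by rewrite ge_max -normrN ler_norm normr_ge0.
Qed.

Lemma approximable_L2 F : L2 F -> approximable C T F.
Proof.
move=> [[mr mi] f2].
have h (u : P -> R) : measurable_fun [set: P] u -> (forall x, u x ^+ 2 <= nsq (F x)) ->
    approximable C T (fun x => (u x)%:C).
  move=> mu0 uF; apply: approximable_real => //; split; first exact: cmeasurable_real.
  apply: le_lt_trans f2; apply: N2_le => // [x].
  by rewrite nsq_real.
rewrite (_ : F = fun x => (complex.Re (F x))%:C + 'i%C * (complex.Im (F x))%:C); last first.
  apply/funext => x; case: (F x) => a b /=.
  by apply/eqP; rewrite eq_complex /=; apply/andP; split; apply/eqP; ring.
apply: approximableD => //; try exact: cmeasurable_real.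
- by apply: cmeasurableM; [exact: cmeasurable_cst|exact: cmeasurable_real].
- by apply: h => // x; rewrite /nsq lerDl sqr_ge0.
- apply: approximableZ => //.
  by apply: h => // x; rewrite /nsq lerDr sqr_ge0.
Qed.

Lemma L2_trig p : trig C p -> L2 (fun x => chi T x * p x).
Proof.
move=> tp; have cp := trig_cmeasurable tp; have [b pb] := trig_bounded tp.
have := L2M cp pb (_ : L2 (chi T)).
under eq_fun do rewrite mulrC; apply.
by split; [exact: cmeasurable_chi|rewrite N2_chi// -ge0_fin_numE].
Qed.

(** Translating the window gives another tile, and a periodic function has the same norm on all
    tiles. *)
Lemma N2_tile_translate v F : cmeasurable F -> periodic F ->
  N2 (fun x => chi T x * F (x + v)) = N2 (fun x => chi T x * F x).
Proof.
move=> cF pF; have tT' : tile C ((fun x : P => x + - v) @^-1` T) by exact: tile_shift.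
have mT' : measurable ((fun x : P => x + - v) @^-1` T) by exact: measurable_shift.
rewrite (_ : (fun x => _) = fun x : P =>
    (fun y => chi ((fun x : P => x + - v) @^-1` T) y * F y) (x + v)).
  have cG : cmeasurable (fun y => chi ((fun x : P => x + - v) @^-1` T) y * F y).
    by apply: cmeasurableM => //; exact: cmeasurable_chi.
  apply: etrans (N2_shift v cG) _.
  by apply: etrans (N2_tile tT' mT' cF pF) _; apply: esym; exact: (N2_tile tT mT cF pF).
apply/funext => x /=; congr (_ * _); rewrite /chi !indicE; congr (_%:R%:C).
by rewrite -[x in LHS](addrK v).
Qed.

Lemma N2_trig_fin p : trig C p -> N2 (fun x => chi T x * p x) \is a fin_num.
Proof. by move=> /L2_trig[_ h]; rewrite ge0_fin_numE// N2_ge0. Qed.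

(* Translating by half a period of [chr (k - j)] exchanges [chr k - c chr j] and
   [chr k + c chr j] up to a unimodular factor. *)
Lemma chr_orthogonal k j : k != j ->
  inner (fun x => chi T x * chr C k x) (fun x => chi T x * chr C j x) = 0.
Proof.
move=> kj; have Lk i := L2_trig (trig_chr C i).
set z := inner _ _.
suff h (c : R[i]) : complex.Re (c^*%C * z) = 0.
  case: z h => a b h; have := h (1 +i* 0); have := h (0 +i* 1).
  by rewrite /= => h1 h2; apply/eqP; rewrite eq_complex /=; apply/andP; split; apply/eqP; lra.
have [v hv] : exists v, chr C (k - j) v = -1 by apply: chr_sign; rewrite ?subr_eq0.
have kv : chr C k v = - chr C j v.
  by rewrite -[in LHS](subrK j k) chrD hv mulN1r.
have tm c' : trig C (fun x => chr C k x - c' * chr C j x).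
  by apply: trigB; [exact: trig_chr|apply: trigZ; exact: trig_chr].
have E1 : N2 (fun x => chi T x * (chr C k x - c * chr C j x)) =
          N2 (fun x => chi T x * (chr C k x - (- c) * chr C j x)).
  rewrite -(@N2_tile_translate v); last 2 first.
  - exact: trig_cmeasurable (tm _).
  - exact: trig_periodic (tm _).
  apply: eq_integral => x _; rewrite !chr_shift kv.
  rewrite (_ : _ - _ = - chr C j v * (chr C k x - - c * chr C j x)); last by ring.
  by rewrite !nsqM nsqN nsq_chr mul1r.
have N2E c' : N2 (fun x => chi T x * (chr C k x - c' * chr C j x)) =
    (fine (N2 (fun x => chi T x * chr C k x)) + nsq c' * fine (N2 (fun x => chi T x * chr C j x))
     - 2 * complex.Re (c'^*%C * z))%:E.
  rewrite (_ : (fun x => _) = fun x => chi T x * chr C k x - c' * (chi T x * chr C j x)); last first.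
    by apply/funext => x; ring.
  rewrite N2B ?innerZr//; last exact: L2Z.
  by rewrite N2Z ?fineM ?N2_trig_fin//; [exact: trig_chr|exact: (Lk j).1].
move: E1; rewrite !N2E nsqN => -[]; rewrite (_ : (- c)^*%C = - c^*%C); last by rewrite rmorphN.
by rewrite mulNr (_ : complex.Re (- _) = - complex.Re (c^*%C * z)) ?raddfN//; lra.
Qed.

Lemma N2_chr k : N2 (fun x => chi T x * chr C k x) = (`|\det C|)%:E.
Proof.
rewrite -(tile_measure tT mT) -(N2_chi mT); apply: eq_integral => x _.
by rewrite nsqM nsq_chr mulr1.
Qed.

End density_tile.
End tiles.

Lemma sum_le_esum {R : realType} (I : choiceType) (s : seq I) (a : I -> \bar R) :
  uniq s -> (forall i, 0 <= a i)%E ->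
  (\sum_(i <- s) a i <= \esum_(i in [set: I]) a i)%E.
Proof.
move=> us a0; apply: esum_ge; exists [set` s]; last by rewrite -fsbig_seq.
by rewrite /fsets /=; split.
Qed.

Lemma esum_le_sums {R : realType} (I : choiceType) (a : I -> \bar R) (b : \bar R) :
  (forall s : seq I, uniq s -> (\sum_(i <- s) a i <= b)%E) ->
  (\esum_(i in [set: I]) a i <= b)%E.
Proof.
move=> h; apply: ge_ereal_sup => _ [A [fA _] <-].
by rewrite fsbig_finite//; apply: h; exact: finmap.fset_uniq.
Qed.

(** * Parseval's identity *)

Section parseval.
Context {R : realType}.
Variable C : 'M[R]_2.
Hypothesis uC : C \in unitmx.
Notation P := (plane R).
Notation mu := (@plane_measure R).
Implicit Types (k j : idx) (p q F G : P -> R[i]) (D Z S T : set P).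

(** Not normalised: a character has squared norm [|\det C|] on a tile, and this is the constant in
    [parseval_tile]. *)
Definition coef F k := cintegral (fun x => F x * (chr C k x)^*%C).

Section on_tile.
Variable T : set P.
Hypothesis tT : tile C T.
Hypothesis mT : measurable T.

Let E k x := chi T x * chr C k x.
Let K : R := `|\det C|.

Let K0 : 0 < K.
Proof. by rewrite normr_gt0 -unitfE -unitmxE. Qed.

Let LE k : L2 (E k).
Proof. exact: (L2_trig uC tT mT (trig_chr C k)). Qed.

Let Lsum (s : seq idx) (a : idx -> R[i]) : L2 (fun x => \sum_(k <- s) a k * E k x).
Proof.
elim: s => [|k s ih].
  under eq_fun do rewrite big_nil; have := L2Z 0 (LE 0).
  by under eq_fun do rewrite mul0r.
by under eq_fun do rewrite big_cons; apply: L2D => //; exact: (L2Z _ (LE k)).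
Qed.

Let inner_sum (s : seq idx) (a : idx -> R[i]) k : k \notin s ->
  inner (fun x => \sum_(k <- s) a k * E k x) (E k) = 0.
Proof.
elim: s => [|j s ih] ks.
  have := innerZl 0 (LE 0) (LE k); rewrite mul0r => h; rewrite -[RHS]h.
  by congr inner; apply/funext => x; rewrite big_nil mul0r.
move: ks; rewrite inE negb_or => /andP[kj ks].
rewrite (_ : (fun x => _) = fun x => a j * E j x + \sum_(k <- s) a k * E k x); last first.
  by apply/funext => x; rewrite big_cons.
rewrite (innerDl (L2Z _ (LE j)) (Lsum s a) (LE k)).
rewrite ih// (innerZl _ (LE j) (LE k)) [X in _ * X](_ : _ = 0) ?mulr0 ?addr0//.
by apply: chr_orthogonal => //; rewrite eq_sym.
Qed.

(** Both halves of Parseval are read off this expansion: Bessel's inequality by inserting the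
    Fourier coefficients, the converse by inserting those of a good approximant. *)
Lemma N2_minus_trig F (s : seq idx) (a : idx -> R[i]) : L2 F -> uniq s ->
  N2 (fun x => F x - \sum_(k <- s) a k * E k x) =
  (fine (N2 F) + \sum_(k <- s) (K * nsq (a k) - 2 * complex.Re ((a k)^*%C * inner F (E k))))%:E.
Proof.
move=> LF; elim: s => [|k s ih]; first by move=> _; rewrite big_nil addr0;
  under eq_fun do rewrite big_nil subr0; rewrite fineK// ge0_fin_numE ?N2_ge0// LF.2.
rewrite /= => /andP[ks us]; have := ih us => {}ih.
rewrite (_ : (fun x => _) = fun x =>
    (F x - \sum_(k <- s) a k * E k x) - a k * E k x); last first.
  by apply/funext => x; rewrite big_cons; ring.
have LG := L2B LF (Lsum s a).
rewrite (N2B LG (L2Z _ (LE k))) ih big_cons (innerZr _ LG (LE k)).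
rewrite (innerBl LF (Lsum s a) (LE k)) inner_sum// subr0 N2Z; last exact: (LE k).1.
rewrite (N2_chr uC tT mT k) -/K.
have fE (b : R) : fine b%:E = b by [].
rewrite -EFinM !fE; congr EFin; ring.
Qed.

Lemma inner_coef F k : (forall x, ~ T x -> F x = 0) -> inner F (E k) = coef F k.
Proof.
move=> F0; apply: eq_cintegral => x; rewrite /E /chi indicE.
have [/set_mem Tx|/negP xT] := boolP (x \in T); first by rewrite mul1r.
by rewrite F0 ?mul0r// => Tx; apply: xT; exact: mem_set.
Qed.

Lemma parseval_tile F : L2 F -> (forall x, ~ T x -> F x = 0) ->
  (\esum_(k in [set: idx]) (nsq (coef F k))%:E = K%:E * N2 F)%E.
Proof.
move=> LF F0; have nF : N2 F \is a fin_num by rewrite ge0_fin_numE ?N2_ge0// LF.2.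
have ip k : inner F (E k) = coef F k by exact: inner_coef.
apply/eqP; rewrite eq_le; apply/andP; split.
  apply: esum_le_sums => s us; rewrite sumEFin -(fineK nF) -EFinM lee_fin.
  (* Bessel: [K^-1%:C * coef F k] are the coefficients of the orthogonal projection, and the squared
     distance to it is nonnegative. *)
  have := N2_ge0 (fun x => F x - \sum_(k <- s) K^-1%:C * coef F k * E k x).
  rewrite (N2_minus_trig (fun k => K^-1%:C * coef F k) LF us) lee_fin => h0.
  rewrite (eq_bigr (fun k => - (K^-1 * nsq (coef F k)))) in h0; last first.
    move=> k _; rewrite ip nsqM nsq_real; case: (coef F k) => x y.
    by rewrite /nsq /=; field; exact: lt0r_neq0.
  rewrite sumrN -mulr_sumr subr_ge0 in h0.
  by rewrite -ler_pdivrMl.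
rewrite -(fineK nF) -EFinM.
apply/lee_addgt0Pr => e e0.
have [p tp hp] := approximable_L2 uC tT mT LF (divr_gt0 e0 K0).
have [s us [c pc]] := trig_uniq tp.
apply: (@le_trans _ _ ((\sum_(k <- s) nsq (coef F k)) + e)%:E); last first.
  rewrite EFinD leeD2r// -sumEFin; apply: sum_le_esum => // k.
  by rewrite lee_fin nsq_ge0.
rewrite lee_fin.
move: hp; rewrite (_ : (fun x => _) = fun x => F x - \sum_(k <- s) c k * E k x); last first.
  apply/funext => x; rewrite mulrBr pc mulr_sumr; congr (_ - _).
    rewrite /chi indicE.
    have [/set_mem Tx|/negP xT] := boolP (x \in T); first by rewrite mul1r.
    by rewrite F0 ?mulr0// => Tx; apply: xT; exact: mem_set.
  by apply: eq_bigr => k _; rewrite /E; ring.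
rewrite N2_minus_trig// lee_fin => hp.
(* Completing the square: no choice of coefficients beats the Fourier ones, so the error of the
   approximant bounds the defect in Bessel's inequality. *)
have hs : - (K^-1 * \sum_(k <- s) nsq (coef F k)) <=
    \sum_(k <- s) (K * nsq (c k) - 2 * complex.Re ((c k)^*%C * inner F (E k))).
  rewrite mulr_sumr -sumrN; apply: ler_sum => k _; rewrite ip.
  have := nsq_ge0 (K%:C * c k - coef F k).
  rewrite nsqD nsqN nsqM nsq_real.
  rewrite (_ : _ * (- _)^*%C = - (K%:C * (c k * (coef F k)^*%C))); last by rewrite rmorphN; ring.
  have -> : complex.Re ((c k)^*%C * coef F k) = complex.Re (c k * (coef F k)^*%C).
    by case: (c k) (coef F k) => x y [z w] /=; ring.
  set u := complex.Re (c k * _).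
  rewrite (_ : complex.Re _ = - (K * u)); last by rewrite /u; case: (c k * _) => x y /=; ring.
  move=> h; rewrite -subr_ge0.
  rewrite (_ : _ - _ = K^-1 * (K ^+ 2 * nsq (c k) + nsq (coef F k) + 2 * - (K * u))).
    by rewrite mulr_ge0// invr_ge0 ltW.
  by field; exact: lt0r_neq0.
have {hs}hp : fine (N2 F) - K^-1 * \sum_(k <- s) nsq (coef F k) <= e / K by lra.
have := ler_wpM2l (ltW K0) hp.
rewrite mulrBr mulrA divff ?lt0r_neq0// mul1r [K * (e / K)]mulrC divfK ?lt0r_neq0//; lra.
Qed.

End on_tile.

(** The set is completed by the points of the cell in cosets that miss it. *)
Lemma packing_in_tile S : measurable S -> packing C S ->
  exists T, [/\ tile C T, measurable T & S `<=` T].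
Proof.
move=> mS pS; have [pc sc] := tile_cell uC.
exists (S `|` (cell C `\` saturation C S)); split.
- split.
    move=> k x [Sx|[cx nx]] [Sk|[ck nk]].
    + exact: pS Sk.
    + by case: nk; exists (- k); rewrite lattice_ptN addrK.
    + by case: nx; exists k.
    + exact: pc ck.
  move=> x; have [sx|nsx] := pselect (saturation C S x).
    by case: sx => k Sk; exists k; left.
  have [k ck] := sc x; exists k; right; split=> // -[j Sj]; apply: nsx.
  by exists (k + j); rewrite lattice_ptD addrA.
- apply: measurableU => //; apply: measurableD; first exact: measurable_cell.
  exact: measurable_saturation.
- by move=> x Sx; left.
Qed.

Lemma parseval_packing S F : measurable S -> packing C S -> L2 F ->
  (forall x, ~ S x -> F x = 0) ->
  (\esum_(k in [set: idx]) (nsq (coef F k))%:E = `|\det C|%:E * N2 F)%E.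
Proof.
move=> mS pS LF F0; have [T [tT mT ST]] := packing_in_tile mS pS.
by apply: (parseval_tile tT mT LF) => x nTx; apply: F0 => Sx; apply: nTx; exact: ST.
Qed.

End parseval.

Lemma esum_pair {R : realType} (I J : choiceType) (a : I -> J -> \bar R) :
  (forall i j, 0 <= a i j)%E ->
  (\esum_(i in [set: I]) \esum_(j in [set: J]) a i j =
   \esum_(p in [set: I * J]) a p.1 p.2)%E.
Proof.
move=> a0; rewrite (esum_esum (J := fun=> setT))//.
by congr (esum _ _); apply/seteqP; split=> p.
Qed.

Lemma reindex_esumT {R : realType} (I J : choiceType) (e : I -> J) (a : J -> \bar R) :
  bijective e -> (\esum_(j in [set: J]) a j = \esum_(i in [set: I]) a (e i))%E.
Proof.
move=> [e' eK e'K]; apply: reindex_esum; split=> //.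
- by move=> i j _ _ /(can_inj eK).
- by move=> j _; exists (e' j).
Qed.

(** * Frame sums *)

Section frames.
Context {R : realType}.
Variables A C : 'M[R]_2.
Hypothesis uC : C \in unitmx.
Notation P := (plane R).
Notation mu := (@plane_measure R).
Notation K := (`|\det C|).
Implicit Types (k l : idx) (f g u v : P -> R[i]) (E S : set P).

(** The Gabor sum in terms of the dual lattice. It is iterated so that Parseval can evaluate the
    inner sum over frequencies for each translate separately. *)
Definition frame_sum g f : \bar R :=
  (\esum_(l in [set: idx]) \esum_(k in [set: idx])
    (nsq (coef C (fun x => f x * (g (x - lattice_pt A l))^*%C) k))%:E)%E.

Definition parseval_frame g := L2 g /\ forall f, L2 f -> frame_sum g f = N2 f.

Lemma L2_chr k g : L2 g -> L2 (fun x => g x * chr C k x).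
Proof.
move=> Lg; have := L2M (@cmeasurable_chr _ C k) (_ : forall x, nsq (chr C k x) <= 1) Lg.
under eq_fun do rewrite mulrC; apply => x; by rewrite nsq_chr.
Qed.

Lemma cintegrable_coef k u v : L2 u -> L2 v ->
  cintegrable (fun x => u x * (v x)^*%C * (chr C k x)^*%C).
Proof.
move=> Lu Lv; have := cintegrable_mulJ Lu (L2_chr k Lv).
by rewrite (_ : (fun x => _) = fun x => u x * (v x)^*%C * (chr C k x)^*%C)//;
  apply/funext => x; rewrite conjcM mulrA.
Qed.

Lemma coefD u v u' v' k : L2 u -> L2 v -> L2 u' -> L2 v' ->
  coef C (fun x => u x * (v x)^*%C + u' x * (v' x)^*%C) k =
  coef C (fun x => u x * (v x)^*%C) k + coef C (fun x => u' x * (v' x)^*%C) k.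
Proof.
move=> Lu Lv Lu' Lv'; rewrite /coef -cintegralD; try exact: cintegrable_coef.
by apply: eq_cintegral => x; rewrite mulrDl.
Qed.

Lemma coef_shift u k j : cmeasurable u ->
  coef C (fun x => u (x + lattice_pt C j)) k = coef C u k.
Proof.
move=> cu; rewrite /coef -[RHS](cintegral_translate (lattice_pt C j)).
  by apply: eq_cintegral => x; rewrite chr_periodic.
by apply: cmeasurableM => //; apply: cmeasurableJ; exact: cmeasurable_chr.
Qed.

(** A coefficient only sees the periodisation: a summand displaced by a lattice vector may be slid
    back, which brings both summands onto one packing set. *)
Lemma coef_fold u v u' v' k j : L2 u -> L2 v -> L2 u' -> L2 v' ->
  coef C (fun x => u x * (v x)^*%C +
    u' (x + lattice_pt C j) * (v' (x + lattice_pt C j))^*%C) k =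
  coef C (fun x => u x * (v x)^*%C + u' x * (v' x)^*%C) k.
Proof.
move=> Lu Lv Lu' Lv'; rewrite !coefD//; try exact: L2_shift.
congr (_ + _); apply: (@coef_shift (fun x => u' x * (v' x)^*%C)).
by apply: cmeasurableM; [exact: Lu'.1|apply: cmeasurableJ; exact: Lv'.1].
Qed.

Lemma N2_disjoint u v : cmeasurable u -> cmeasurable v ->
  (forall x, u x = 0 \/ v x = 0) ->
  N2 (fun x => (u x + v x)%R) = (N2 u + N2 v)%E.
Proof.
move=> cu cv uv; rewrite -pintD.
- apply: eq_integral => x _; congr EFin; rewrite nsqD.
  suff -> : u x * (v x)^*%C = 0 by rewrite /= mulr0 addr0.
  by have [->|->] := uv x; rewrite ?conjc0 ?mul0r ?mulr0.
- exact: measurable_nsq.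
- exact: measurable_nsq.
- by move=> x; exact: nsq_ge0.
- by move=> x; exact: nsq_ge0.
Qed.

Lemma packing_shift S (v : P) : packing C S -> packing C ((fun x : P => x + v) @^-1` S).
Proof. by move=> pS k x /= Sx; rewrite addrAC => Sk; exact: pS Sk. Qed.

Lemma packing_fin_measure S : measurable S -> packing C S -> mu S \is a fin_num.
Proof.
move=> mS pS; rewrite (packing_measure (tile_cell uC) (measurable_cell C) pS mS).
apply: (fin_num_subset_measure _ (measurable_cell C)).
- by apply: measurableI; [exact: measurable_cell|exact: measurable_saturation].
- by move=> x [].
- by rewrite cell_measure.
Qed.

Lemma L2_bounded S (b : R) u : measurable S -> packing C S -> cmeasurable u ->
  (forall x, nsq (u x) <= b) -> (forall x, ~ S x -> u x = 0) -> L2 u.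
Proof.
move=> mS pS cu ub u0; have := L2M cu ub (_ : L2 (chi S)).
rewrite (_ : (fun x => u x * chi S x) = u); last first.
  apply/funext => x; rewrite /chi indicE.
  have [/set_mem Sx|/negP nSx] := boolP (x \in S); first by rewrite mulr1.
  by rewrite u0 ?mul0r// => Sx; apply: nSx; exact: mem_set.
apply; split; first exact: cmeasurable_chi.
by rewrite N2_chi// -ge0_fin_numE//; exact: packing_fin_measure.
Qed.

(** The generator has one piece on [S] and one on [S - γ]. Once the second is slid back, each [l]
    leaves a single function supported on a translate of [S], and Parseval on that packing set gives
    its frequency sum. *)
Lemma packing_frame_sum S (b : R) (phi1 phi2 : P -> R[i]) j f : measurable S ->
  packing C S -> cmeasurable phi1 -> cmeasurable phi2 ->
  (forall x, nsq (phi1 x) <= b) -> (forall x, nsq (phi2 x) <= b) ->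
  (forall x, ~ S x -> phi1 x = 0) -> (forall x, ~ S x -> phi2 x = 0) -> L2 f ->
  frame_sum (fun x => phi1 x + phi2 (x + lattice_pt C j)) f =
  (\esum_(l in [set: idx]) (K%:E * N2 (fun x =>
     (f x * (phi1 (x - lattice_pt A l))^*%C +
      f (x - lattice_pt C j) * (phi2 (x - lattice_pt A l))^*%C)%R)))%E.
Proof.
move=> mS pS c1 c2 b1 b2 s1 s2 Lf; apply: eq_esum => l _.
have L1 := L2_bounded mS pS c1 b1 s1; have L2' := L2_bounded mS pS c2 b2 s2.
pose w := - lattice_pt A l.
have LH : L2 (fun x => f x * (phi1 (x + w))^*%C + f (x - lattice_pt C j) * (phi2 (x + w))^*%C).
  apply: L2D.
    have := L2M (cmeasurableJ (cmeasurable_shift w c1)) _ Lf.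
    by under eq_fun do rewrite mulrC; apply => x; rewrite nsqJ; exact: b1.
  have := L2M (cmeasurableJ (cmeasurable_shift w c2)) _ (L2_shift (- lattice_pt C j) Lf).
  by under eq_fun do rewrite mulrC; apply => x; rewrite nsqJ; exact: b2.
have mSw : measurable ((fun x : P => x + w) @^-1` S) by exact: measurable_shift.
rewrite -(parseval_packing uC mSw (@packing_shift S w pS) LH); last first.
  by move=> x nS; rewrite s1// s2// !conjc0 !mulr0 addr0.
apply: eq_esum => k _; congr (EFin (nsq _)).
rewrite -(@coef_fold f (fun x => phi1 (x + w)) (fun x => f (x - lattice_pt C j))
  (fun x => phi2 (x + w)) k j) //; try exact: L2_shift.
congr (coef C _ k); apply/funext => x; rewrite addrK conjcD mulrDr.
by rewrite addrAC.
Qed.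

(** Parseval is tested on [chi E] plus a copy of [chi E] times conj β moved to [E - γ]; the supports
    are disjoint since [E] packs and [j != 0]. Both sides become integrals over [E], and [E] is
    arbitrary. Letting β vary with the point is what later allows phases to be aligned. *)
Lemma parseval_frame_ae g (beta : P -> R[i]) j : parseval_frame g -> j != 0 ->
  cmeasurable beta ->
  {ae mu, forall x, (\esum_(l in [set: idx])
     (K * nsq (g (x - lattice_pt A l) +
               beta x * g (x - lattice_pt C j - lattice_pt A l)))%:E =
     (1 + nsq (beta x))%:E)%E}.
Proof.
move=> [Lg pg] j0 cb; have cg := Lg.1.
pose u l x := g (x - lattice_pt A l) + beta x * g (x - lattice_pt C j - lattice_pt A l).
have cu l : cmeasurable (u l).
  apply: cmeasurableD; first exact: cmeasurable_shift.
  apply: cmeasurableM => //.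
  rewrite (_ : (fun x => _) = fun x => g (x + (- lattice_pt C j - lattice_pt A l))).
    exact: cmeasurable_shift.
  by apply/funext => x; rewrite addrA.
pose U x := (\esum_(l in [set: idx]) (K * nsq (u l x))%:E)%E.
pose V x := (1 + nsq (beta x))%:E.
have u0 l x : (0 <= (K * nsq (u l x))%:E)%E by rewrite lee_fin mulr_ge0 ?nsq_ge0.
have mu_ l : measurable_fun [set: P] (fun x => (K * nsq (u l x))%:E).
  apply/measurable_EFinP; apply: measurable_funM => //; exact: measurable_nsq.
have mU : measurable_fun [set: P] U by exact: measurable_esum.
have mV : measurable_fun [set: P] V.
  by apply/measurable_EFinP; apply: measurable_funD => //; exact: measurable_nsq.
(* The bound on [beta] over [E] makes the test function square-integrable. *)
have key E (n : R) : measurable E -> packing C E -> (forall x, E x -> nsq (beta x) <= n) ->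
    (\int[mu]_(x in E) V x = \int[mu]_(x in E) U x)%E.
  move=> mE pE bE.
  pose b x := chi E x * (beta x)^*%C.
  have cE := cmeasurable_chi mE.
  have cbb : cmeasurable b by apply: cmeasurableM => //; exact: cmeasurableJ.
  have n0 : forall x, E x -> 0 <= n by move=> x /bE; exact: le_trans (nsq_ge0 _).
  have bM x : nsq (b x) <= `|n| + 1.
    rewrite /b nsqM nsqJ /chi nsq_real indicE.
    have [/set_mem Ex|_] := boolP (x \in E).
      rewrite expr1n mul1r; apply: le_trans (bE x Ex) _.
      by have := ler_norm n; lra.
    by rewrite expr0n mul0r addr_ge0.
  have bS x : ~ E x -> b x = 0.
    by move=> nE; rewrite /b /chi indicE memNset// mul0r.
  have chiS x : ~ E x -> chi E x = 0.
    by move=> nE; rewrite /chi indicE memNset.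
  have LE : L2 (chi E) by exact: (L2_bounded mE pE cE (@nsq_chi R E) chiS).
  have Lb : L2 b by exact: (L2_bounded mE pE cbb bM bS).
  pose f x := chi E x + b (x + lattice_pt C j).
  have Lf : L2 f by apply: L2D => //; exact: L2_shift.
  have fE : N2 f = (\int[mu]_(x in E) V x)%E.
    rewrite N2_disjoint//; last 2 first.
    - exact: cmeasurable_shift.
    - move=> x; have [Ex|nE] := pselect (E x); last by left; exact: chiS.
      by right; apply: bS => Ej; move/eqP: j0; apply; exact: pE Ej.
    rewrite N2_shift// -pintD; last 4 first.
    - exact: measurable_nsq.
    - exact: measurable_nsq.
    - by move=> x; exact: nsq_ge0.
    - by move=> x; exact: nsq_ge0.
    rewrite [RHS]integral_mkcond; apply: eq_integral => x _.
    rewrite /b nsqM nsqJ /chi nsq_real indicE patchE /V.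
    by case: (x \in E); rewrite ?expr1n ?mul1r// expr0n mul0r addr0.
  rewrite -fE -(pg f Lf).
  rewrite integral_mkcond.
  rewrite (eq_integral (fun x => \esum_(l in [set: idx]) (K * nsq (chi E x * (u l x)^*%C))%:E)%E); last first.
    move=> x _; rewrite patchE /chi indicE; case: ifPn => _ /=.
      by apply: eq_esum => l _; rewrite mul1r nsqJ.
    by rewrite esum1// => l _; rewrite mul0r nsq0 mulr0.
  have cw l : cmeasurable (fun x => chi E x * (u l x)^*%C).
    by apply: cmeasurableM => //; exact: cmeasurableJ.
  rewrite ge0_integral_esum//; last 2 first.
  - by move=> l x; rewrite lee_fin mulr_ge0 ?nsq_ge0.
  - move=> l; apply/measurable_EFinP; apply: measurable_funM => //.
    exact: measurable_nsq (cw l).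
  apply: eq_esum => l _.
  rewrite pintZ//; last 2 first.
  - exact: measurable_nsq (cw l).
  - by move=> x; exact: nsq_ge0.
  have Lgl : L2 (fun x => g (x - lattice_pt A l)) by exact: L2_shift.
  have Lgj : L2 (fun x => g (x - lattice_pt C j - lattice_pt A l)).
    by apply: (@L2_shift _ (- lattice_pt C j) (fun x => g (x - lattice_pt A l))).
  have wE : (fun x => chi E x * (u l x)^*%C) = fun x =>
      chi E x * (g (x - lattice_pt A l))^*%C +
      b x * (g (x - lattice_pt C j - lattice_pt A l))^*%C.
    by apply/funext => x; rewrite /u /b conjcD conjcM; ring.
  have LH : L2 (fun x => chi E x * (u l x)^*%C).
    rewrite wE; apply: L2D.
      apply: (L2M cE (@nsq_chi R E)); split; last by rewrite /N2; under eq_integral do rewrite nsqJ; exact: Lgl.2.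
      exact: cmeasurableJ Lgl.1.
    apply: (L2M cbb bM); split; last by rewrite /N2; under eq_integral do rewrite nsqJ; exact: Lgj.2.
    exact: cmeasurableJ Lgj.1.
  rewrite -(parseval_packing uC mE pE LH); last by move=> x nE; rewrite chiS// mul0r.
  apply: eq_esum => k _; congr (EFin (nsq _)).
  rewrite wE -(@coef_fold (chi E) (fun x => g (x - lattice_pt A l)) b
    (fun x => g (x - lattice_pt C j - lattice_pt A l)) k j)//.
  by congr (coef C _ k); apply/funext => x; rewrite addrK mulrDl.
(* Countably many packing sets on which [beta] is bounded cover the plane; on each of them [V] is
   integrable, so equal integrals over all subsets give equality almost everywhere. *)
have cover i (n : nat) : mu.-negligible [set x | cell C (x + lattice_pt C i) /\
    nsq (beta x) <= n%:R /\ U x <> V x].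
  pose D := ((fun x : P => x + lattice_pt C i) @^-1` cell C) `&`
     ((fun x => nsq (beta x)) @^-1` `]-oo, n%:R]).
  have mD : measurable D.
    apply: measurableI; first by apply: measurable_shift; exact: measurable_cell.
    by apply: measurable_preimage; [exact: measurable_nsq|exact: measurable_itv].
  have pD : packing C D.
    apply: (@packing_sub _ _ ((fun x : P => x + lattice_pt C i) @^-1` cell C)); first by move=> x [].
    by apply: packing_shift; exact: (tile_cell uC).1.
  have Db x : D x -> nsq (beta x) <= n%:R by move=> [_]; rewrite /= in_itv.
  have iV : mu.-integrable D V.
    apply/integrableP; split; first exact: measurable_funTS.
    apply: (@le_lt_trans _ _ (\int[mu]_(x in D) (1 + n%:R)%:E)%E).
      apply: ge0_le_integral => //.
      - by apply: measurableT_comp => //; exact: measurable_funTS.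
      - move=> x Dx; rewrite /V abse_EFin lee_fin ger0_norm; last by rewrite addr_ge0 ?nsq_ge0.
        by rewrite lerD2l; exact: Db.
    rewrite integral_cst// ltey_eq fin_numM//; exact: packing_fin_measure.
  have [Z [mZ Z0 ZD]] : ae_eq mu D V U.
    apply: (integral_ae_eq mD iV (measurable_funTS mU)) => E ED mE.
    apply: (key E n%:R mE); first exact: packing_sub ED pD.
    by move=> x /ED; exact: Db.
  exists Z; split=> // x [cx [bx UV]]; apply: ZD => /= h; apply: UV.
  apply: esym; apply: h; split=> //; by rewrite /= in_itv.
apply: (negligibleS _ (negligible_bigcup_countable (fun i => negligible_bigcup (cover i)))).
move=> x /= UV; have [i ci] := (tile_cell uC).2 x.
exists i => //; exists (Num.truncn (nsq (beta x))).+1 => //; split=> //; split=> //.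
by apply: ltW; exact: truncnS_gt.
Qed.

End frames.

Section gabor.
Context {R : realType}.
Variables A B : 'M[R]_2.
Notation P := (plane R).

Lemma phase_dual k (x : P) : phase (invmx B^T) k x = dot (lattice_pt B k) x.
Proof.
rewrite /phase invmxK /dot lattice_ptE /mulv !mxE /=; ring.
Qed.

Lemma inner_atom (f g : P -> R[i]) l k : inner f (gabor_atom A B g l k) =
  coef (invmx B^T) (fun x => f x * (g (x - lattice_pt A l))^*%C) k.
Proof.
apply: eq_cintegral => x; rewrite /gabor_atom -[Num.conj _]/((_ : R[i])^*%C).
by rewrite conjcM /chr phase_dual; ring.
Qed.

Lemma parseval_gaborP g : parseval_gabor A B g <-> parseval_frame A (invmx B^T) g.
Proof.
have E f : frame_sum A (invmx B^T) g f =
    (\esum_(lk in [set: 'cV[int]_2 * 'cV[int]_2])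
       (Normc.normc (inner f (gabor_atom A B g lk.1 lk.2)) ^+ 2)%:E)%E.
  rewrite /frame_sum esum_pair; last by move=> *; rewrite lee_fin nsq_ge0.
  by apply: eq_esum => p _; rewrite normc_sqr inner_atom.
split=> -[Lg h]; split; try exact/in_Lp2P.
  by move=> f /in_Lp2P Lf; rewrite E h// cLnorm2_sqr.
by move=> f /in_Lp2P Lf; rewrite -E h// cLnorm2_sqr.
Qed.

End gabor.

(** The totals are finite, hence so is the common remainder, which can be cancelled. *)
Lemma esum_two_points {R : realType} (I : choiceType) (a b : I -> R) (i j : I) (r : R) :
  (forall k, 0 <= a k) -> (forall k, 0 <= b k) -> i != j ->
  (forall k, k != i -> k != j -> a k = b k) ->
  (\esum_(k in [set: I]) (a k)%:E = r%:E)%E ->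
  (\esum_(k in [set: I]) (b k)%:E = r%:E)%E ->
  a i + a j = b i + b j.
Proof.
move=> a0 b0 ij ab; pose rest (c : I -> R) k := if (k == i) || (k == j) then 0 else c k.
have split_ (c : I -> R) : (forall k, 0 <= c k) ->
   (\esum_(k in [set: I]) (c k)%:E =
   (c i)%:E + ((c j)%:E + \esum_(k in [set: I]) (rest c k)%:E))%E.
  move=> c0; pose d (i0 : I) k := if k == i0 then c k else 0.
  have d0 i0 k : 0 <= d i0 k by rewrite /d; case: ifP.
  have r0 k : 0 <= rest c k by rewrite /rest; case: ifP.
  have dE i0 : (\esum_(k in [set: I]) (d i0 k)%:E = (c i0)%:E)%E.
    rewrite (esum_single (k0 := i0)) ?lee_fin ?d0 /d ?eqxx//.
    by move=> k /negPf ->.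
  have dr k : (0 <= (d j k)%:E + (rest c k)%:E)%E by rewrite adde_ge0// lee_fin.
  rewrite -(dE i) -(dE j) -[X in (_ + X)%E]esumD; try by move=> k _; rewrite lee_fin.
  rewrite -esumD; try by move=> k _; rewrite ?lee_fin//; exact: dr.
  apply: eq_esum => k _; rewrite -!EFinD; congr EFin; rewrite /d /rest.
  have [->|_] := eqVneq k i; first by rewrite (negPf ij) !addr0.
  by have [_|_] := eqVneq k j; rewrite !add0r ?addr0.
have rE : (\esum_(k in [set: I]) (rest a k)%:E = \esum_(k in [set: I]) (rest b k)%:E)%E.
  by apply: eq_esum => k _; rewrite /rest; case: ifPn => // /norP[? ?]; rewrite ab.
rewrite (split_ a a0) (split_ b b0) rE; set X := (\esum_(k in _) (rest b k)%:E)%E.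
case: X => [x| |]//; rewrite -!EFinD => -[h1] [h2]; lra.
Qed.

Section almost_everywhere.
Context {R : realType}.
Notation P := (plane R).
Notation mu := (@plane_measure R).

Lemma ae_imp (Q Q' : P -> Prop) : {ae mu, forall x, Q x} ->
  (forall x, Q x -> Q' x) -> {ae mu, forall x, Q' x}.
Proof. by move=> h QQ; apply: negligibleS h => x /= n /QQ. Qed.

Lemma ae_and (Q Q' : P -> Prop) : {ae mu, forall x, Q x} ->
  {ae mu, forall x, Q' x} -> {ae mu, forall x, Q x /\ Q' x}.
Proof.
move=> h h'; apply: negligibleS (negligibleU h h') => x /= n.
by have [q|] := pselect (Q x); [right=> q'; apply: n|left].
Qed.

Lemma ae_forall (I : countType) (Q : I -> P -> Prop) :
  (forall i, {ae mu, forall x, Q i x}) -> {ae mu, forall x, forall i, Q i x}.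
Proof.
move=> h; apply: negligibleS (negligible_bigcup_countable h) => x /= n.
by apply: contrapT => nn; apply: n => i; apply: contrapT => ni; apply: nn; exists i.
Qed.

Lemma indic_in (F : set P) x : F x -> \1_F x = 1 :> R.
Proof. by move=> h; rewrite indicE mem_set. Qed.

Lemma indic_notin (F : set P) x : ~ F x -> \1_F x = 0 :> R.
Proof. by move=> h; rewrite indicE memNset. Qed.

End almost_everywhere.

(** * Four-point test functions *)

Section multipliers.
Context {R : realType}.
Variables A C : 'M[R]_2.
Hypothesis uA : A \in unitmx.
Hypothesis uC : C \in unitmx.
Notation P := (plane R).
Notation mu := (@plane_measure R).
Notation K := (`|\det C|).
Implicit Types (k l : idx) (f g u v : P -> R[i]) (E S : set P).

Definition frame_multiplier (h : P -> R[i]) := cmeasurable h /\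
  forall g, parseval_frame A C g -> parseval_frame A C (fun x => h x * g x).

Section test_frame.
Variables (Om E : set P) (l0 j : idx) (ka : R).
Hypotheses (mOm : measurable Om) (mE : measurable E).
Notation E' := ((fun x : P => x + lattice_pt A l0) @^-1` E).
Hypothesis pS : packing C (Om `|` (E `|` E')).
Hypothesis OmE : forall x, Om x -> E x -> False.
Hypothesis OmE' : forall x, Om x -> E (x + lattice_pt A l0) -> False.
Hypothesis EE' : forall x, E x -> E (x + lattice_pt A l0) -> False.
(** The sum is the total weight of [nsq (f x)] in the frame sum once the cross terms have cancelled;
    its value 1 makes [test_fun] a Parseval generator. *)
Hypothesis count1 : {ae mu, forall x, (\esum_(l in [set: idx])
  (\1_Om (x - lattice_pt A l) + 2 * ka ^+ 2 *
    (\1_E (x - lattice_pt A l) + \1_E (x + lattice_pt C j - lattice_pt A l)))%:E = 1%:E)%E}.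

(** This normalisation absorbs the factor [K] of Parseval's identity. *)
Let s : R := (Num.sqrt K)^-1.
Let K0 : 0 < K.
Proof. by rewrite normr_gt0 -unitfE -unitmxE. Qed.
Let s2 : K * s ^+ 2 = 1.
Proof. by rewrite /s exprVn sqr_sqrtr ?divff ?lt0r_neq0// ltW. Qed.

Let phi1 (x : P) : R := s * (\1_Om x + ka * (\1_E x + \1_E (x + lattice_pt A l0))).
Let phi2 (x : P) : R := s * (ka * (\1_E x - \1_E (x + lattice_pt A l0))).

(** With λ and γ the points of [l0] and [j], this is [s] times the sum of [1_Om] and [ka] times
    [1_E + 1_(E-λ) + 1_(E-γ) - 1_(E-λ-γ)]. Here [phi2] is the part on the γ-translates, slid back
    next to [phi1]. *)
Definition test_fun (x : P) : R[i] := (phi1 x)%:C + (phi2 (x + lattice_pt C j))%:C.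

Let m1 (F : set P) (v : P) : measurable F -> measurable_fun [set: P] (fun x => \1_F (x + v) : R).
Proof.
move=> mF; rewrite (_ : (fun x => _) = \1_((fun x : P => x + v) @^-1` F) :> (P -> R)).
  by apply: measurable_indic; exact: measurable_shift.
by apply/funext => x; rewrite !indicE.
Qed.

Let mphi1 : measurable_fun [set: P] phi1.
Proof.
apply: measurable_funM => //; apply: measurable_funD => //.
by apply: measurable_funM => //; apply: measurable_funD => //; exact: m1.
Qed.

Let mphi2 : measurable_fun [set: P] phi2.
Proof.
apply: measurable_funM => //.
by apply: measurable_funM => //; apply: measurable_funB => //; exact: m1.
Qed.

Let ind01 (F : set P) x : 0 <= \1_F x :> R /\ \1_F x <= 1 :> R.
Proof. by rewrite indicE; case: (x \in F). Qed.

Let S0 x : ~ (Om `|` (E `|` E')) x -> phi1 x = 0 /\ phi2 x = 0.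
Proof.
move=> nS; have nO : ~ Om x by move=> ?; apply: nS; left.
have nE : ~ E x by move=> ?; apply: nS; right; left.
have nE' : ~ E (x + lattice_pt A l0) by move=> ?; apply: nS; right; right.
rewrite /phi1 /phi2 (indic_notin nO) (indic_notin nE) (indic_notin nE'); split; ring.
Qed.

Let b0 := (s * (1 + 2 * `|ka|)) ^+ 2.
Let phi_le x : phi1 x ^+ 2 <= b0 /\ phi2 x ^+ 2 <= b0.
Proof.
have [u0 u1] := ind01 Om x; have [e0 e1] := ind01 E x.
have [f0 f1] := ind01 E (x + lattice_pt A l0).
have H (t : R) : `|t| <= 1 + 2 * `|ka| -> (s * t) ^+ 2 <= b0.
  move=> ht; rewrite /b0 !exprMn ler_wpM2l ?sqr_ge0//.
  by rewrite -[t ^+ 2]real_normK ?num_real// lerXn2r ?nnegrE// addr_ge0// mulr_ge0.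
split; apply: H.
  apply: le_trans (ler_normD _ _) _; rewrite normrM (ger0_norm u0) (ger0_norm (addr_ge0 e0 f0)).
  rewrite [2 * _]mulrC; apply: lerD => //; apply: ler_wpM2l => //; lra.
rewrite normrM; apply: (@le_trans _ _ (`|ka| * 2)); last by lra.
by apply: ler_wpM2l => //; rewrite ler_norml; lra.
Qed.

Let mS : measurable (Om `|` (E `|` E')).
Proof. by apply: measurableU => //; apply: measurableU => //; exact: measurable_shift. Qed.

Let Lphi (p : P -> R) : measurable_fun [set: P] p ->
  (forall x, ~ (Om `|` (E `|` E')) x -> p x = 0) -> (forall x, p x ^+ 2 <= b0) ->
  L2 (fun x => (p x)%:C).
Proof.
move=> mp p0 pb; apply: (L2_bounded uC mS pS (b := b0)).
- exact: cmeasurable_real.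
- by move=> x; rewrite nsq_real.
- by move=> x /p0 ->.
Qed.

Lemma L2_test_fun : L2 test_fun.
Proof.
apply: L2D.
  by apply: Lphi => // x; [move=> /S0[]|have [] := phi_le x].
apply: (@L2_shift _ _ (fun x => (phi2 x)%:C)).
by apply: Lphi => // x; [move=> /S0[]|have [] := phi_le x].
Qed.

(** The three supports are disjoint, so one term at most is alive at each point. On [E] the two
    values add up; on [E - λ] the minus sign turns the sum into a difference. *)
Let pointwise (z w : R[i]) x : K * nsq (z * ((phi1 x)%:C)^*%C + w * ((phi2 x)%:C)^*%C) =
  \1_Om x * nsq z + ka ^+ 2 * \1_E x * nsq (z + w) +
  ka ^+ 2 * \1_E (x + lattice_pt A l0) * nsq (z - w).
Proof.
have E0 (a b : R) : K * nsq (z * ((s * a)%:C)^*%C + w * ((s * b)%:C)^*%C) =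
    nsq (z * a%:C + w * b%:C).
  rewrite -[RHS]mul1r -[in RHS]s2; case: z w => z1 z2 [w1 w2]; rewrite /nsq /=; ring.
rewrite /phi1 /phi2 E0; case: z w {E0} => z1 z2 [w1 w2].
have [Ox|nO] := pselect (Om x).
  rewrite (indic_in Ox) (indic_notin (OmE Ox)) (indic_notin (OmE' Ox)) /nsq /=; ring.
rewrite (indic_notin nO).
have [Ex|nE] := pselect (E x).
  rewrite (indic_in Ex) (indic_notin (EE' Ex)) /nsq /=; ring.
rewrite (indic_notin nE).
have [Ex|nE'] := pselect (E (x + lattice_pt A l0)).
  rewrite (indic_in Ex) /nsq /=; ring.
rewrite (indic_notin nE') /nsq /=; ring.
Qed.

Lemma parseval_test_fun : parseval_frame A C test_fun.
Proof.
split; first exact: L2_test_fun.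
move=> f Lf; have cf := Lf.1.
rewrite (packing_frame_sum (b := b0) A uC j mS pS (cmeasurable_real mphi1) (cmeasurable_real mphi2))//;
  try by move=> x; rewrite ?nsq_real; have [] := phi_le x.
2: by move=> x /S0[->].
2: by move=> x /S0[_ ->].
have k0 : 0 <= ka ^+ 2 by exact: sqr_ge0.
have i0 F (x : P) : 0 <= \1_F x :> R by exact: (ind01 F x).1.
have mi F (l : idx) : measurable F ->
    measurable_fun [set: P] (fun x : P => \1_F (x - lattice_pt A l) : R) by exact: m1.
pose f' (x : P) := f (x - lattice_pt C j).
have cf' : cmeasurable f' by exact: cmeasurable_shift.
pose q (l : idx) (x : P) : R := \1_Om (x - lattice_pt A l) * nsq (f x) +
  ka ^+ 2 * \1_E (x - lattice_pt A l) * nsq (f x + f' x) +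
  ka ^+ 2 * \1_E (x - lattice_pt A l + lattice_pt A l0) * nsq (f x - f' x).
pose t1 (l : idx) (x : P) : R := (\1_Om (x - lattice_pt A l) +
  2 * ka ^+ 2 * \1_E (x - lattice_pt A l)) * nsq (f x).
pose t2 (l : idx) (x : P) : R :=
  2 * ka ^+ 2 * \1_E (x - lattice_pt A l) * nsq (f' x).
have q0 l x : (0 <= (q l x)%:E)%E.
  by rewrite lee_fin; do ?[exact: nsq_ge0|exact: i0|exact: k0|apply: addr_ge0|apply: mulr_ge0].
have t10 l x : (0 <= (t1 l x)%:E)%E.
  by rewrite lee_fin; do ?[exact: nsq_ge0|exact: i0|exact: k0|exact: ler0n|apply: addr_ge0|apply: mulr_ge0].
have t20 l x : (0 <= (t2 l x)%:E)%E by rewrite lee_fin; do ?[exact: nsq_ge0|exact: i0|exact: k0|exact: ler0n|apply: addr_ge0|apply: mulr_ge0].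
have mt1 l : measurable_fun [set: P] (fun x => (t1 l x)%:E).
  apply/measurable_EFinP; apply: measurable_funM; last exact: measurable_nsq.
  by apply: measurable_funD; [exact: mi|apply: measurable_funM => //; exact: mi].
have mt2 l : measurable_fun [set: P] (fun x => (t2 l x)%:E).
  apply/measurable_EFinP; apply: measurable_funM; last exact: measurable_nsq.
  by apply: measurable_funM => //; exact: mi.
have mt2' l : measurable_fun [set: P] (fun x => (t2 l (x + lattice_pt C j))%:E).
  exact: (measurableT_comp (mt2 l) (measurable_translate (lattice_pt C j))).
have mq l : measurable_fun [set: P] (fun x => (q l x)%:E).
  apply/measurable_EFinP; apply: measurable_funD; first apply: measurable_funD.
  - by apply: measurable_funM; [exact: mi|exact: measurable_nsq].
  - apply: measurable_funM; first by apply: measurable_funM => //; exact: mi.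
    by apply: measurable_nsq; exact: cmeasurableD.
  - apply: measurable_funM; last by apply: measurable_nsq; exact: cmeasurableB.
    apply: measurable_funM => //.
    rewrite (_ : (fun x => _) = (fun x : P => \1_E (x + (- lattice_pt A l + lattice_pt A l0)) : R)).
      exact: m1.
    by apply/funext => x; rewrite addrA.
have qE l : (K%:E * N2 (fun x =>
     (f x * ((phi1 (x - lattice_pt A l))%:C)^*%C +
      f (x - lattice_pt C j) * ((phi2 (x - lattice_pt A l))%:C)^*%C)%R) =
  \int[mu]_x (q l x)%:E)%E.
  rewrite /N2 -pintZ//; last 2 first.
  - have cJ (p : P -> R) : measurable_fun [set: P] p ->
        cmeasurable (fun x => ((p (x - lattice_pt A l))%:C)^*%C).
      by move=> /cmeasurable_real /(cmeasurable_shift (- lattice_pt A l)) /cmeasurableJ.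
    by apply: measurable_nsq; apply: cmeasurableD; apply: cmeasurableM => //; exact: cJ.
  - by move=> x; exact: nsq_ge0.
  by apply: eq_integral => x _; rewrite pointwise.
under eq_esum do rewrite qE.
rewrite -ge0_integral_esum//.
(* Shifting the index by [l0] brings the pieces [E] and [E - λ] to the same point, where the
   parallelogram law removes the cross terms. *)
have reindex x : (\esum_(l in [set: idx]) (q l x)%:E =
    \esum_(l in [set: idx]) (t1 l x)%:E + \esum_(l in [set: idx]) (t2 l x)%:E)%E.
  pose a l : R := ka ^+ 2 * \1_E (x - lattice_pt A l) * nsq (f x - f' x).
  pose b l : R := \1_Om (x - lattice_pt A l) * nsq (f x) +
    ka ^+ 2 * \1_E (x - lattice_pt A l) * nsq (f x + f' x).
  have a0 l : (0 <= (a l)%:E)%E by rewrite lee_fin; do ?[exact: nsq_ge0|exact: i0|exact: k0|apply: addr_ge0|apply: mulr_ge0].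
  have b0' l : (0 <= (b l)%:E)%E.
    by rewrite lee_fin; do ?[exact: nsq_ge0|exact: i0|exact: k0|apply: addr_ge0|apply: mulr_ge0].
  rewrite -esumD//.
  rewrite (eq_esum (b := fun l => (b l)%:E + (a (l - l0))%:E)%E); last first.
    by move=> l _; rewrite -EFinD /q /b /a lattice_ptB opprB addrA [x + _ - _]addrAC.
  rewrite esumD// -(@reindex_esumT _ _ _ (fun l => l - l0) (fun l => (a l)%:E)); last first.
    by exists (fun l => l + l0) => l; rewrite ?addrK ?subrK.
  rewrite -esumD//; apply: eq_esum => l _; rewrite -!EFinD /a /b /t1 /t2; congr EFin.
  have -> : nsq (f x - f' x) = 2 * nsq (f x) + 2 * nsq (f' x) - nsq (f x + f' x).
    by case: (f x) (f' x) => a1 a2 [b1 b2]; rewrite /nsq /=; ring.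
  ring.
under eq_integral do rewrite reindex.
have mT1 : measurable_fun [set: P] (fun x => \esum_(l in [set: idx]) (t1 l x)%:E)%E.
  exact: measurable_esum.
have mT2 : measurable_fun [set: P] (fun x => \esum_(l in [set: idx]) (t2 l x)%:E)%E.
  exact: measurable_esum.
have mT2' : measurable_fun [set: P]
    (fun x => \esum_(l in [set: idx]) (t2 l (x + lattice_pt C j))%:E)%E.
  exact: measurable_esum.
have e0 (u : idx -> P -> R) : (forall l x, (0 <= (u l x)%:E)%E) ->
    forall x, (0 <= \esum_(l in [set: idx]) (u l x)%:E)%E.
  by move=> u0 x; apply: esum_ge0.
rewrite ge0_integralD//; try by move=> x _; exact: e0.
(* The sum of the [t2] involves [f (x - γ)]; translation by γ gathers the whole weight on
   [nsq (f x)]. *)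
rewrite -(@ge0_integral_translate _ (lattice_pt C j) (fun x => \esum_(l in [set: idx]) (t2 l x)%:E)%E)//;
  last exact: e0.
rewrite -ge0_integralD//; try by move=> x _; exact: e0.
apply: ge0_ae_eq_integral => //.
- by apply: emeasurable_funD.
- exact: measurable_ensq.
- by move=> x _; apply: adde_ge0; apply: esum_ge0.
- by move=> x _; rewrite lee_fin nsq_ge0.
apply: (ae_imp count1) => x hx _.
rewrite -esumD//.
rewrite (eq_esum (b := fun l => (nsq (f x))%:E * (\1_Om (x - lattice_pt A l) + 2 * ka ^+ 2 *
    (\1_E (x - lattice_pt A l) + \1_E (x + lattice_pt C j - lattice_pt A l)))%:E)%E).
  rewrite esumZl ?nsq_ge0//; first by rewrite hx mule1.
  by move=> l; rewrite lee_fin; do ?[exact: i0|exact: k0|exact: ler0n|apply: addr_ge0|apply: mulr_ge0].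
move=> l _; rewrite -EFinD -EFinM /t1 /t2 /f' addrK; congr EFin; ring.
Qed.

(** At a point of [E] every index other than 0 and [l0] has [p] or [q] equal to 0, so its term is
    the same for β and -β. Comparing β = 1 with -1 and β = i with -i isolates the real and imaginary
    parts of [p 0 * conj (q 0) + p l0 * conj (q l0) = 0], where [q l0] carries the minus sign. *)
Lemma four_point h : frame_multiplier h -> j != 0 -> l0 != 0 -> packing A E ->
  0 < ka -> {ae mu, forall x, E x ->
    h x * (h (x - lattice_pt C j))^*%C =
    h (x - lattice_pt A l0) * (h (x - lattice_pt A l0 - lattice_pt C j))^*%C}.
Proof.
move=> [ch hm] j0 l00 pE ka0.
have ph := hm _ parseval_test_fun.
pose S := Om `|` (E `|` E').
have g_on y : S y -> test_fun y = (phi1 y)%:C.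
  move=> Sy; have [|_ e2] := @S0 (y + lattice_pt C j).
    by move=> Sj; move/eqP: j0; apply; exact: pS Sj.
  by rewrite /test_fun e2 addr0.
have g_off y : S y -> test_fun (y - lattice_pt C j) = (phi2 y)%:C.
  move=> Sy; have [|e1 _] := @S0 (y - lattice_pt C j).
    move=> Sj; move/eqP: j0; apply; apply: oppr_inj; rewrite oppr0.
    by apply: pS Sy _; rewrite lattice_ptN.
  by rewrite /test_fun e1 subrK add0r.
have g_zero y : ~ S y -> test_fun y = 0 \/ test_fun (y - lattice_pt C j) = 0.
  move=> nS; have [e1 e2] := S0 nS.
  have [Sp|nSp] := pselect (S (y + lattice_pt C j)); last first.
    by left; have [_ e3] := S0 nSp; rewrite /test_fun e1 e3 addr0.
  right; rewrite /test_fun subrK e2.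
  have [Sm|nSm] := pselect (S (y - lattice_pt C j)); last first.
    by have [e3 _] := S0 nSm; rewrite e3 addr0.
  (* Otherwise [y - γ] and [y + γ] both lie in [S], and the packing property gives [j + j = 0]. *)
  exfalso; have := pS (k := j + j) Sm; rewrite lattice_ptD addrA subrK => /(_ Sp).
  move=> jj; move/eqP: j0; apply; apply/matrixP => i i'.
  move/matrixP: jj => /(_ i i'); rewrite !mxE -mulr2n => /eqP.
  by rewrite mulrn_eq0 /= => /eqP.
have N (c : R[i]) := parseval_frame_ae uC ph j0 (cmeasurable_cst c).
apply: (ae_imp (ae_and (N 1) (ae_and (N (-1)) (ae_and (N (0 +i* 1)) (N (- (0 +i* 1))))))).
move=> x [N1 [N2 [N3 N4]]] Ex.
pose p l := h (x - lattice_pt A l) * test_fun (x - lattice_pt A l).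
pose q l := h (x - lattice_pt C j - lattice_pt A l) * test_fun (x - lattice_pt C j - lattice_pt A l).
have pq0 k : k != 0 -> k != l0 -> p k = 0 \/ q k = 0.
  move=> k0 kl; rewrite /p /q ![x - _ - lattice_pt A k]addrAC.
  have nE : ~ E (x - lattice_pt A k).
    rewrite -lattice_ptN => Ek; move/eqP: k0; apply; apply: oppr_inj.
    by rewrite oppr0; exact: pE Ek.
  have nE' : ~ E (x - lattice_pt A k + lattice_pt A l0).
    rewrite -lattice_ptN -addrA -lattice_ptD => Ek; move/eqP: kl; apply.
    by apply/eqP; rewrite -subr_eq0 -oppr_eq0 opprD opprK addrC -[_ - _]addrC; apply/eqP; exact: pE Ek.
  have [Sy|nSy] := pselect (S (x - lattice_pt A k)).
    by right; rewrite g_off// /phi2 (indic_notin nE) (indic_notin nE') subrr !mulr0.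
  by have [->|->] := g_zero _ nSy; [left|right]; rewrite mulr0.
have key (c : R[i]) : nsq c = 1 ->
   (\esum_(l in [set: idx]) (K * nsq (p l + c * q l))%:E = (1 + nsq c)%:E)%E ->
   (\esum_(l in [set: idx]) (K * nsq (p l + - c * q l))%:E = (1 + nsq (- c))%:E)%E ->
   nsq (p 0 + c * q 0) + nsq (p l0 + c * q l0) =
   nsq (p 0 + - c * q 0) + nsq (p l0 + - c * q l0).
  move=> c1; rewrite nsqN => h1 h2.
  have nn (w : idx -> R[i]) k : 0 <= K * nsq (w k) by rewrite mulr_ge0 ?nsq_ge0.
  have := esum_two_points (nn (fun l => p l + c * q l)) (nn (fun l => p l + - c * q l)) _ _ h1 h2.
  move=> /(_ 0 l0); rewrite eq_sym => /(_ l00).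
  rewrite -!mulrDr => e; apply: (mulfI (lt0r_neq0 K0)); apply: e => k k0 kl.
  by have [->|->] := pq0 k k0 kl; rewrite ?mulr0 ?addr0// !add0r !nsqM nsqN.
have SE y : E y -> S y by move=> ?; right; left.
have Ex' : E (x - lattice_pt A l0 + lattice_pt A l0) by rewrite subrK.
have Sx' : S (x - lattice_pt A l0) by right; right.
have nO : ~ Om x by move=> /OmE/(_ Ex).
have nE' : ~ E (x + lattice_pt A l0) by exact: EE' Ex.
have nO' : ~ Om (x - lattice_pt A l0) by move=> /OmE'/(_ Ex').
have nE : ~ E (x - lattice_pt A l0) by move=> /EE'/(_ Ex').
have p0E : p 0 = (s * ka)%:C * h x.
  rewrite /p lattice_pt0 subr0 (g_on _ (SE _ Ex)) /phi1 (indic_notin nO) (indic_in Ex) (indic_notin nE').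
  by rewrite add0r addr0 mulr1 mulrC.
have q0E : q 0 = (s * ka)%:C * h (x - lattice_pt C j).
  rewrite /q lattice_pt0 subr0 (g_off _ (SE _ Ex)) /phi2 (indic_in Ex) (indic_notin nE').
  by rewrite subr0 mulr1 mulrC.
have p1E : p l0 = (s * ka)%:C * h (x - lattice_pt A l0).
  rewrite /p (g_on _ Sx') /phi1 (indic_notin nO') (indic_notin nE) (indic_in Ex').
  by rewrite !add0r mulr1 mulrC.
have q1E : q l0 = - ((s * ka)%:C * h (x - lattice_pt A l0 - lattice_pt C j)).
  rewrite /q addrAC (g_off _ Sx') /phi2 (indic_notin nE) (indic_in Ex').
  by rewrite sub0r mulrN1 mulrN rmorphN mulrN mulrC.
have n1 : nsq (0 +i* 1 : R[i]) = 1 by rewrite /nsq /= expr0n expr1n add0r.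
have e1 := key 1 nsq1 N1 N2.
have e2 := key (0 +i* 1) n1 N3 N4.
have sk : s * ka != 0.
  by rewrite mulf_neq0 ?lt0r_neq0// /s invr_gt0 sqrtr_gt0.
have sk2 : 0 < (s * ka) ^+ 2 by rewrite lt_neqAle sqr_ge0 eq_sym sqrf_eq0 sk.
move: e1 e2; rewrite p0E q0E p1E q1E.
move: (h x) (h (x - lattice_pt C j)) (h (x - lattice_pt A l0)) (h (x - lattice_pt A l0 - lattice_pt C j)).
move=> [a1 a2] [b1 b2] [d1 d2] [f1 f2]; rewrite /nsq /=; set t := s * ka => e1 e2.
have t2 : t ^+ 2 != 0 by exact: lt0r_neq0.
apply/eqP; rewrite eq_complex /=; apply/andP; split; apply/eqP; apply: (mulfI t2); lra.
Qed.

(** With [E] empty the generator is [s] times the indicator of [Om]. At β = 0 the pointwise identity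
    keeps only its term at index 0, where [K * s ^+ 2 = 1]. *)
Lemma test_unimodular h : frame_multiplier h -> packing A Om -> E = set0 ->
  {ae mu, forall x, Om x -> nsq (h x) = 1}.
Proof.
move=> [ch hm] pO E0; have ph := hm _ parseval_test_fun.
have e0 x : \1_E x = 0 :> R by rewrite E0 indicE in_set0.
have gE x : test_fun x = (s * \1_Om x)%:C.
  by rewrite /test_fun /phi1 /phi2 !e0 !(addr0, subr0, mulr0).
have [j' j'0] : exists j' : idx, j' != 0.
  exists (\col_i 1); apply/eqP => /matrixP /(_ 0 0); by rewrite !mxE.
apply: (ae_imp (parseval_frame_ae uC ph j'0 (cmeasurable_cst 0))) => x hx Ox; move: hx; rewrite nsq0 addr0.
rewrite (esum_single (k0 := 0)).
- rewrite lattice_pt0 !subr0 mul0r addr0 nsqM gE nsq_real (indic_in Ox) mulr1.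
  by rewrite mulrCA s2 mulr1 => -[].
- by rewrite lee_fin mulr_ge0 ?nsq_ge0.
- move=> k k0; rewrite mul0r addr0 gE indic_notin ?mulr0 ?mulr0 ?nsq0 ?mulr0//.
  rewrite -lattice_ptN => Ok; move/eqP: k0; apply; apply: oppr_inj.
  by rewrite oppr0; exact: pO Ok.
Qed.

End test_frame.
End multipliers.

(** * Small cells of a lattice *)

Section small_cells.
Context {R : realType}.
Notation P := (plane R).
Implicit Types (M : 'M[R]_2) (k i : idx).

(** The cells of the lattice refined by [n]. Countably many cover the plane, so an almost everywhere
    statement can be proved on one small cell at a time. *)
Definition grid_cell M (n : nat) i : set P :=
  (fun x : P => x + lattice_pt (n%:R^-1 *: M) i) @^-1` cell (n%:R^-1 *: M).

Lemma scale_unit M n : M \in unitmx -> (0 < n)%N -> n%:R^-1 *: M \in unitmx.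
Proof.
by move=> uM n0; rewrite unitmxZ// unitfE invr_eq0 pnatr_eq0 -lt0n.
Qed.

Lemma measurable_grid_cell M n i : measurable (grid_cell M n i).
Proof. by apply: measurable_shift; exact: measurable_cell. Qed.

Lemma grid_cell_cover M n (x : P) : M \in unitmx -> (0 < n)%N ->
  exists i, grid_cell M n i x.
Proof. by move=> uM n0; exact: (tile_cell (scale_unit uM n0)).2. Qed.

Lemma grid_cell_dist M n i (x y : P) : M \in unitmx -> (0 < n)%N ->
  grid_cell M n i x -> grid_cell M n i y ->
  `|(mulv (invmx M) (y - x)).1| < n%:R^-1 /\
  `|(mulv (invmx M) (y - x)).2| < n%:R^-1.
Proof.
move=> uM n0; have np : 0 < n%:R :> R by rewrite ltr0n.
have iE : invmx (n%:R^-1 *: M) = n%:R *: invmx M.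
  have uM' := scale_unit uM n0.
  rewrite -[LHS]mul1mx -(mulVmx uM) -mulmxA.
  rewrite [X in _ *m X](_ : _ = n%:R%:M) ?mul_mx_scalar//.
  rewrite -[X in X *m _](scalerKV (lt0r_neq0 np)).
  by rewrite -scalemxAl mulmxV// scalemx1.
have sE (a : R) (N : 'M[R]_2) z : mulv (a *: N) z = (a * (mulv N z).1, a * (mulv N z).2).
  by rewrite /mulv !mxE /=; congr (_, _); ring.
have cE (N : 'M[R]_2) (z : P) : cell N z ->
    0 <= (mulv (invmx N) z).1 < 1 /\ 0 <= (mulv (invmx N) z).2 < 1.
  by move=> [/=]; rewrite !in_itv.
rewrite /grid_cell => Ex Ey; move: (cE _ _ Ex) (cE _ _ Ey).
rewrite iE !sE !mulvD mulvN; set L := mulv _ (lattice_pt _ _).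
case: (mulv _ x) (mulv _ y) L => [a1 a2] [b1 b2] [L1 L2].
rewrite /= !mulrDr.
move=> [/andP[x1 x1'] /andP[x2 x2']] [/andP[y1 y1'] /andP[y2 y2']].
have E (a b c : R) : 0 <= n%:R * a + n%:R * c -> n%:R * a + n%:R * c < 1 ->
    0 <= n%:R * b + n%:R * c -> n%:R * b + n%:R * c < 1 -> `|b - a| < n%:R^-1.
  move=> h1 h2 h3 h4; rewrite -[n%:R^-1]mul1r ltr_pdivlMr// -[X in _ * X](gtr0_norm np) -normrM.
  by rewrite ltr_norml; apply/andP; split; lra.
by split; [exact: E x1 x1' y1 y1'|exact: E x2 x2' y2 y2'].
Qed.

Lemma packing_grid_cell M n i : M \in unitmx -> (0 < n)%N -> packing M (grid_cell M n i).
Proof.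
move=> uM n0 k x Ex Ek; have := grid_cell_dist uM n0 Ex Ek.
rewrite [x + _]addrC addrK lattice_ptE mulvK//= => -[h1 h2].
have E (z : int) : `|z%:~R : R| < n%:R^-1 -> z = 0.
  move=> h; have : `|z%:~R : R| < 1.
    by apply: lt_le_trans h _; rewrite invf_le1 ?ltr0n// ler1n.
  by rewrite -intr_norm ltrz1; lia.
apply/matrixP => a b; rewrite (ord1 b) [RHS]mxE; case: a => -[|[|//]] ha.
  by rewrite -(E _ h1); congr (k _ _); exact: val_inj.
by rewrite -(E _ h2); congr (k _ _); exact: val_inj.
Qed.

Lemma int_dist (w : R) : (forall z : int, z%:~R != w) ->
  exists2 n : nat, (0 < n)%N & forall z : int, n%:R^-1 <= `|z%:~R - w|.
Proof.
move=> nw; pose f := Num.floor w.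
have /andP[f1 f2] : f%:~R <= w < (f + 1)%:~R by rewrite floor_le_tmp floorD1_gt.
have f1' : f%:~R < w by rewrite lt_neqAle nw.
pose d := Num.min (w - f%:~R) ((f + 1)%:~R - w).
have d0 : 0 < d by rewrite lt_min !subr_gt0 f1' f2.
exists (Num.truncn d^-1).+1 => // z.
apply: (@le_trans _ _ d).
  rewrite -[leRHS]invrK lef_pV2 ?posrE ?invr_gt0// ?ltr0n//.
  by apply: ltW; exact: truncnS_gt.
have [zf|zf] := leP z f.
  apply: (@le_trans _ _ (w - f%:~R)); first by rewrite ge_min lexx.
  rewrite distrC; apply: le_trans (ler_norm _); rewrite lerD2l lerN2 ler_int//.
apply: (@le_trans _ _ ((f + 1)%:~R - w)); first by rewrite ge_min lexx orbT.
by apply: le_trans (ler_norm _); rewrite lerD2r ler_int; lia.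
Qed.

(** If [v] is no lattice point, one of its lattice coordinates keeps a fixed distance from the
    integers. Two points of a cell finer than that distance cannot differ by [v] modulo the
    lattice. *)
Lemma small_grid_cell M (v : P) : M \in unitmx -> (forall k, lattice_pt M k <> v) ->
  exists2 n, (0 < n)%N & forall i x y k, grid_cell M n i x -> grid_cell M n i y ->
    y <> x + v + lattice_pt M k.
Proof.
move=> uM nv; set w := mulv (invmx M) v.
have [n [n0 hn]] : exists n, (0 < n)%N /\ forall z1 z2 : int,
    n%:R^-1 <= `|z1%:~R - w.1| \/ n%:R^-1 <= `|z2%:~R - w.2|.
  have [h1|h1] := pselect (forall z : int, z%:~R != w.1).
    by have [n n0 hn] := int_dist h1; exists n; split=> // z1 z2; left.
  have [h2|h2] := pselect (forall z : int, z%:~R != w.2).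
    by have [n n0 hn] := int_dist h2; exists n; split=> // z1 z2; right.
  exfalso.
  have [z1 e1] : exists z : int, z%:~R = w.1.
    by apply: contrapT => h; apply: h1 => z; apply/eqP => e; apply: h; exists z.
  have [z2 e2] : exists z : int, z%:~R = w.2.
    by apply: contrapT => h; apply: h2 => z; apply/eqP => e; apply: h; exists z.
  apply: (nv (\col_i (if i == 0 then z1 else z2))).
  rewrite lattice_ptE !mxE /= e1 e2 -(mulvVK v uM) -/w -surjective_pairing //.
exists n => // i x y k Ex Ey e; have := grid_cell_dist uM n0 Ex Ey.
rewrite e -[x + v + _]addrA [x + _]addrC addrK mulvD -/w lattice_ptE mulvK//= => -[d1 d2].
have [h|h] := hn (- k 0 0) (- k 1 0).
  by move: h; rewrite leNgt -normrN opprB rmorphN opprK d1.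
by move: h; rewrite leNgt -normrN opprB rmorphN opprK d2.
Qed.

End small_cells.

(** * The multiplier equation when Λ is not contained in Γ *)

Section invariance.
Context {R : realType}.
Variables A C : 'M[R]_2.
Hypothesis uA : A \in unitmx.
Hypothesis uC : C \in unitmx.
Notation P := (plane R).
Notation mu := (@plane_measure R).
Hypothesis AC : (mu (cell A) <= mu (cell C))%E.
Variable h : P -> R[i].
Hypothesis hm : frame_multiplier A C h.
Implicit Types (k l j i : idx) (E S : set P).

Lemma count_packing S (x : P) : packing A S -> saturation A S x ->
  (\esum_(l in [set: idx]) (\1_S (x - lattice_pt A l) : R)%:E = 1%:E)%E.
Proof.
move=> pS [k Sk]; rewrite (esum_single (k0 := - k)).
- by rewrite lattice_ptN opprK indicE mem_set.
- by rewrite lee_fin indicE.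
- move=> l lk; rewrite indicE memNset//; rewrite -lattice_ptN => Sl.
  by move/eqP: lk; apply; rewrite (packing_uniq pS Sk Sl) opprK.
Qed.

Lemma multiplier_unimodular : {ae mu, forall x, nsq (h x) = 1}.
Proof.
have H (i : idx * idx) : {ae mu, forall x, (grid_cell A 1 i.1 `&` grid_cell C 1 i.2) x -> nsq (h x) = 1}.
  set E := _ `&` _.
  have mE : measurable E by apply: measurableI; exact: measurable_grid_cell.
  have pA : packing A E.
    by apply: (@packing_sub _ _ (grid_cell A 1 i.1)); [move=> x []|exact: packing_grid_cell].
  have pC : packing C E.
    by apply: (@packing_sub _ _ (grid_cell C 1 i.2)); [move=> x []|exact: packing_grid_cell].
  have [Om [mOm EOm pAO pCO full]] := bipacking_extend uA uC AC mE pA pC.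
  suff Q : {ae mu, forall x, Om x -> nsq (h x) = 1}.
    by apply: (ae_imp Q) => x Qx /EOm.
  apply: (@test_unimodular R A C uC Om set0 0 0 0 mOm measurable0) => //.
  - by rewrite preimage_set0 !setU0.
  - exists (~` saturation A Om); split=> //.
      by apply: measurableC; exact: measurable_saturation.
    move=> x /= nx sx; apply: nx; rewrite -(count_packing pAO sx).
    by apply: eq_esum => l _; rewrite expr0n /= mulr0 mul0r addr0.
apply: (ae_imp (ae_forall H)) => x Hx.
have [a ea] := grid_cell_cover x uA (isT : 0 < 1)%N.
have [b eb] := grid_cell_cover x uC (isT : 0 < 1)%N.
by apply: (Hx (a, b)).
Qed.

(** For fixed [j] this is invariance of [h x * conj (h (x - γ))] under translation by λ, whence the
    group properties in [l]. *)
Definition four_point_eq l j (x : P) :=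
  h x * (h (x - lattice_pt C j))^*%C =
  h (x - lattice_pt A l) * (h (x - lattice_pt A l - lattice_pt C j))^*%C.

Lemma ae_shift (Q : P -> Prop) (v : P) : {ae mu, forall x, Q x} ->
  {ae mu, forall x, Q (x + v)}.
Proof.
move=> [N [mN N0 QN]]; exists ((fun x : P => x + v) @^-1` N); split.
- exact: measurable_shift.
- by rewrite -[RHS]N0; exact: plane_measure_translate.
- by move=> x /= nq; exact: QN.
Qed.

Lemma four_point_eqDl l l' j : {ae mu, forall x, four_point_eq l j x} ->
  {ae mu, forall x, four_point_eq l' j x} ->
  {ae mu, forall x, four_point_eq (l + l') j x}.
Proof.
move=> Q /(ae_shift (- lattice_pt A l)) Q'.
apply: (ae_imp (ae_and Q Q')) => x; rewrite /four_point_eq lattice_ptD => -[-> ->].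
by rewrite opprD addrA.
Qed.

(** Unimodularity inserts [h (x - γ) * conj (h (x - γ)) = 1], which splits the product for [j + j']
    into those for [j] and [j']. *)
Lemma four_point_eqDr l j j' : {ae mu, forall x, four_point_eq l j x} ->
  {ae mu, forall x, four_point_eq l j' x} ->
  {ae mu, forall x, four_point_eq l (j + j') x}.
Proof.
move=> Q /(ae_shift (- lattice_pt C j)) Q'.
have U := multiplier_unimodular.
have U1 := ae_shift (- lattice_pt C j) U.
have U2 := ae_shift (- lattice_pt C j) (ae_shift (- lattice_pt A l) U).
apply: (ae_imp (ae_and (ae_and Q Q') (ae_and U1 U2))) => x [].
rewrite /four_point_eq lattice_ptD.
rewrite [x - lattice_pt C j - lattice_pt A l]addrAC !opprD !addrA.
move: (h x) (h (x - lattice_pt C j)) (h (x - lattice_pt C j - lattice_pt C j'))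
  (h (x - lattice_pt A l)) (h (x - lattice_pt A l - lattice_pt C j))
  (h (x - lattice_pt A l - lattice_pt C j - lattice_pt C j')).
move=> a b c a' b' c' [e1 e2] [/unimodular_mulJ n1 /unimodular_mulJ n2].
have -> : a * c^*%C = (a * b^*%C) * (b * c^*%C).
  by rewrite -[LHS]mulr1 -n1; ring.
by rewrite e1 e2 -[RHS]mulr1 -n2; ring.
Qed.

(** When Γ lies in Λ, the sets [E] and [E - γ] occupy the same Λ-cosets. A full Λ-cell [E] then
    leaves no room for [Om], and each coset is counted twice: [2 * ka ^+ 2 * 2 = 1] forces
    [ka = 1/2]. *)
Lemma four_point_sublattice l0 j : (forall j, exists l, lattice_pt C j = lattice_pt A l) ->
  (forall k, lattice_pt C k <> lattice_pt A l0) -> j != 0 ->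
  {ae mu, forall x, four_point_eq l0 j x}.
Proof.
move=> CA nl0 j0.
have H i : {ae mu, forall x, grid_cell A 1 i x -> four_point_eq l0 j x}.
  set E := grid_cell A 1 i.
  have mE : measurable E by exact: measurable_grid_cell.
  have tE : tile A E.
    by rewrite /E /grid_cell; apply: tile_shift; rewrite invr1 scale1r; exact: tile_cell.
  have pE := tE.1.
  have l00 : l0 != 0.
    by apply/eqP => e; apply: (nl0 0); rewrite e !lattice_pt0.
  apply: (@four_point R A C uC set0 E l0 j 2^-1) => //.
  - rewrite set0U => k x [Ex|Ex] [Ek|Ek].
    + have [l e] := CA k; rewrite e in Ek; have l0' := pE _ _ Ex Ek.
      by apply: (lattice_pt_inj uC); rewrite e l0' !lattice_pt0.
    + have [l e] := CA k; rewrite /= e -addrA -lattice_ptD in Ek.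
      exfalso; have := pE _ _ Ex Ek => /eqP; rewrite addrC addr_eq0 => /eqP e'.
      by apply: (nl0 (- k)); rewrite lattice_ptN e -lattice_ptN e'.
    + have [l e] := CA k; rewrite e in Ek.
      have Ek' : E (x + lattice_pt A l0 + lattice_pt A (l - l0)).
        by rewrite -addrA -lattice_ptD [l0 + _]addrC subrK.
      exfalso; have := pE _ _ Ex Ek' => /eqP; rewrite subr_eq0 => /eqP e'.
      by apply: (nl0 k); rewrite e e'.
    + have [l e] := CA k; rewrite /= e addrAC in Ek.
      have l0' := pE _ _ Ex Ek.
      by apply: (lattice_pt_inj uC); rewrite e l0' !lattice_pt0.
  - move=> x Ex Ex'; move/eqP: l00; apply; exact: pE Ex Ex'.
  - exists set0; split=> //.
    move=> x /= nx; exfalso; apply: nx.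
    rewrite (eq_esum (b := fun l => (2^-1%:E * ((\1_E (x - lattice_pt A l) : R)%:E +
       (\1_E (x + lattice_pt C j - lattice_pt A l) : R)%:E))%E)); last first.
      by move=> l _; rewrite -EFinD -EFinM indic0 add0r; congr EFin; field.
    rewrite esumZl//; last by move=> l; rewrite adde_ge0// lee_fin indicE.
    rewrite esumD//; try by move=> l _; rewrite lee_fin indicE.
    rewrite !count_packing//; try exact: tE.2.
    by rewrite -EFinD -EFinM; congr EFin; field.
apply: (ae_imp (ae_forall H)) => x Hx.
by have [a ea] := grid_cell_cover x uA (isT : 0 < 1)%N; exact: Hx ea.
Qed.

(** [Ev] is [E - λ - γ]: modulo Γ it stands for [E - λ], modulo Λ for [E - γ]. Hence the pieces of
    the test function pack by Γ because [Om1] does, and for [2 * ka ^+ 2 = 1] their count over Λ is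
    that of [Om1]. *)
Lemma four_point_generic l0 j : (forall k, lattice_pt A k <> lattice_pt C j) ->
  (forall k, lattice_pt C k <> lattice_pt A l0) ->
  {ae mu, forall x, four_point_eq l0 j x}.
Proof.
move=> nj nl0.
have l00 : l0 != 0 by apply/eqP => e; apply: (nl0 0); rewrite e !lattice_pt0.
have j0 : j != 0 by apply/eqP => e; apply: (nj 0); rewrite e !lattice_pt0.
(* Since γ is outside Λ and λ outside Γ, [v] avoids both lattices; this lets small sets [E] and
   [E - v] pack together for each of them. *)
pose v := lattice_pt A l0 + lattice_pt C j.
have nvA k : lattice_pt A k <> v.
  move=> e; apply: (nj (k - l0)); rewrite lattice_ptB e /v addrC addKr//.
have nvC k : lattice_pt C k <> v.
  by move=> e; apply: (nl0 (k - j)); rewrite lattice_ptB e /v addrK.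
have [n n0 hn] := small_grid_cell uA nvA.
have [m m0 hm'] := small_grid_cell uC nvC.
have H (i : idx * idx) : {ae mu, forall x, (grid_cell A n i.1 `&` grid_cell C m i.2) x ->
    four_point_eq l0 j x}.
  set E := _ `&` _.
  have mE : measurable E by apply: measurableI; exact: measurable_grid_cell.
  have pA : packing A E.
    by apply: (@packing_sub _ _ (grid_cell A n i.1)); [move=> x []|exact: packing_grid_cell].
  have pC : packing C E.
    by apply: (@packing_sub _ _ (grid_cell C m i.2)); [move=> x []|exact: packing_grid_cell].
  have EA x y k : E x -> E y -> y <> x + v + lattice_pt A k.
    by move=> [Ex _] [Ey _]; exact: hn Ex Ey.
  have EC x y k : E x -> E y -> y <> x + v + lattice_pt C k.
    by move=> [_ Ex] [_ Ey]; exact: hm' Ex Ey.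
  pose Ev := (fun x : P => x + v) @^-1` E.
  have mEv : measurable Ev by exact: measurable_shift.
  have union M : packing M E -> (forall x y k, E x -> E y -> y <> x + v + lattice_pt M k) ->
      packing M (E `|` Ev).
    move=> pM EM k x [Ex|Ex] [Ek|Ek].
    - exact: pM Ek.
    - by exfalso; apply: (EM _ _ k Ex Ek); rewrite addrAC.
    - exfalso; apply: (EM _ _ (- k) Ek Ex); by rewrite lattice_ptN [RHS]addrAC addrK.
    - by rewrite /Ev /= addrAC in Ek; exact: pM Ek.
  have [Om1 [mOm1 EOm pAO pCO full]] :=
    bipacking_extend uA uC AC (measurableU _ _ mE mEv) (union _ pA EA) (union _ pC EC).
  pose Om := Om1 `\` (E `|` Ev).
  have mOm : measurable Om by apply: measurableD => //; exact: measurableU.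
  have E1 : E `<=` Om1 by move=> x Ex; apply: EOm; left.
  have Ev1 : Ev `<=` Om1 by move=> x Ex; apply: EOm; right.
  have EEv x : E x -> Ev x -> False.
    by move=> Ex Exv; apply: (EA _ _ 0 Ex Exv); rewrite lattice_pt0 addr0.
  have ka2 : (Num.sqrt 2^-1 : R) ^+ 2 = 2^-1 by rewrite sqr_sqrtr.
  have E'v (x : P) : E (x + lattice_pt A l0) -> Ev (x - lattice_pt C j).
    by rewrite /Ev /= /v -addrA [- _ + _]addrCA addNr addr0.
  have nEv (x : P) : E (x + lattice_pt A l0) -> Om1 x -> False.
    move=> /E'v /Ev1; rewrite -lattice_ptN => Ox' Ox; move/eqP: j0; apply.
    by apply: oppr_inj; rewrite oppr0; exact: pCO Ox Ox'.
  apply: (@four_point R A C uC Om E l0 j (Num.sqrt 2^-1)) => //.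
  - have Om1' x : (Om `|` E) x -> Om1 x /\ ~ Ev x.
      case=> [[Ox nE]|Ex]; first by split=> // ?; apply: nE; right.
      by split; [exact: E1|exact: EEv].
    rewrite setUA => k x [Ox|Ex] [Ok|Ek].
    + by apply: (pCO _ _ (Om1' _ Ox).1 (Om1' _ Ok).1).
    + exfalso; have /Om1'[Ox1 nx] := Ox; have := E'v _ Ek.
      rewrite -addrA -lattice_ptB => Ek'; have := pCO _ _ Ox1 (Ev1 _ Ek') => e.
      by rewrite e lattice_pt0 addr0 in Ek'.
    + exfalso; have /Om1'[Ok1 nk] := Ok; have Ex' := E'v _ Ex.
      have : Om1 (x - lattice_pt C j + lattice_pt C (j + k)).
        by rewrite lattice_ptD addrA subrK.
      move=> /(pCO _ _ (Ev1 _ Ex')) /eqP; rewrite addrC addr_eq0 => /eqP e.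
      by apply: nk; rewrite e lattice_ptN.
    + by rewrite /= addrAC in Ek; exact: pC Ek.
  - by move=> x [_ nE] Ex; apply: nE; left.
  - by move=> x [Ox _] /nEv; exact.
  - by move=> x Ex /nEv; apply; exact: E1.
  - exists (~` saturation A Om1); split=> //.
      by apply: measurableC; exact: measurable_saturation.
    move=> x /= nx sx; apply: nx; rewrite -(count_packing pAO sx) ka2.
    pose a l : R := \1_Om (x - lattice_pt A l) + \1_E (x - lattice_pt A l).
    pose b l : R := \1_E (x + lattice_pt C j - lattice_pt A l).
    have a0 l : (0 <= (a l)%:E)%E by rewrite lee_fin addr_ge0// indicE.
    have b0 l : (0 <= (b l)%:E)%E by rewrite lee_fin /b indicE.
    rewrite [LHS](eq_esum (b := fun l => ((a l)%:E + (b l)%:E)%E)); last first.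
      by move=> l _; rewrite -EFinD /a /b; congr EFin; field.
    (* Shifting the index by [l0] turns the translates of [E - γ] into those of [Ev]. *)
    rewrite esumD// (@reindex_esumT _ _ _ (fun l => l - l0) (fun l => (b l)%:E)); last first.
      by exists (fun l => l + l0) => l; rewrite ?addrK ?subrK.
    rewrite -esumD//; apply: eq_esum => l _; rewrite -EFinD; congr EFin.
    have -> : b (l - l0) = \1_Ev (x - lattice_pt A l).
      rewrite /b /Ev !indicE lattice_ptB opprB; congr (_%:R).
      rewrite (_ : x + _ + _ = x - lattice_pt A l + v)// /v.
      by rewrite -!addrA; congr (_ + _); rewrite addrC -addrA addrCA addrA.
    rewrite /a; set y := x - lattice_pt A l.
    have [Ey|nE] := pselect (E y).
      have nO : ~ Om y by move=> [_]; apply; left.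
      by rewrite (indic_notin nO) (indic_in Ey) (indic_notin (EEv _ Ey)) (indic_in (E1 _ Ey)) add0r addr0.
    have [Ey|nEv'] := pselect (Ev y).
      have nO : ~ Om y by move=> [_]; apply; right.
      by rewrite (indic_notin nO) (indic_notin nE) (indic_in Ey) (indic_in (Ev1 _ Ey)) !add0r.
    rewrite (indic_notin nE) (indic_notin nEv') !addr0.
    have [Oy|nO] := pselect (Om1 y).
      by rewrite (indic_in Oy) indic_in//; split=> // -[].
    by rewrite (indic_notin nO) indic_notin// => -[].
apply: (ae_imp (ae_forall H)) => x Hx.
have [a ea] := grid_cell_cover x uA n0.
have [b eb] := grid_cell_cover x uC m0.
by apply: (Hx (a, b)).
Qed.

End invariance.

(** * Series estimates behind the Blaschke factor *)

Section sums.
Context {R : realType}.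

(* Iterating the hypothesis n times leaves a remainder 2^-n (size s) M. *)
Lemma contraction_sum_bound (I : eqType) (a d : I -> R) (tau : I -> I) (M Y : R) :
  injective tau -> (forall i, 0 <= d i) ->
  (forall i, a i <= 2 * d i + 2^-1 * a (tau i)) -> (forall i, a i <= M) ->
  (forall s : seq I, uniq s -> \sum_(i <- s) d i <= Y) ->
  forall s : seq I, uniq s -> \sum_(i <- s) a i <= 4 * Y.
Proof.
move=> tinj d0 ad aM dY s us.
have H n : forall s : seq I, uniq s ->
    \sum_(i <- s) a i <= 4 * Y + 2^-1 ^+ n * ((size s)%:R * M).
  elim: n => [|n ih] t ut.
    have Y0 : 0 <= Y by have := dY [::] isT; rewrite big_nil.
    apply: (@le_trans _ _ ((size t)%:R * M)); last by rewrite expr0 mul1r lerDr mulr_ge0.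
    elim: t {ut} => [|i t iht]; first by rewrite big_nil mul0r.
    by rewrite big_cons /= -natr1 mulrDl mul1r addrC lerD.
  have ut' : uniq (map tau t) by rewrite map_inj_uniq.
  apply: (@le_trans _ _ (\sum_(i <- t) (2 * d i + 2^-1 * a (tau i)))).
    by apply: ler_sum => i _; exact: ad.
  rewrite big_split /= -!mulr_sumr.
  have := ih _ ut'; rewrite big_map size_map => h1; have h2 := dY _ ut.
  rewrite exprS -mulrA; set X := _ * (_ * M) in h1 *; lra.
apply/ler_addgt0Pr => e e0.
pose B := `|(size s)%:R * M| + 1.
have [n hn] : exists n : nat, 2^-1 ^+ n * B < e.
  pose n := (Num.truncn (B / e)).+1; exists n.
  have h : B / e < n%:R by exact: truncnS_gt.
  have h2 : n%:R <= 2 ^+ n :> R by rewrite -natrX ler_nat; exact: ltnW (ltn_expl _ _).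
  rewrite exprVn mulrC ltr_pdivrMr ?exprn_gt0//.
  by rewrite mulrC -ltr_pdivrMr//; exact: lt_le_trans h h2.
apply: le_trans (H n s us) _; rewrite lerD2l; apply: le_trans (ltW hn).
by apply: ler_wpM2l; rewrite ?exprn_ge0// /B; have := ler_norm ((size s)%:R * M); lra.
Qed.

Lemma esum_le_eq (I : choiceType) (a b : I -> R) (r : R) :
  (forall i, 0 <= a i) -> (forall i, a i <= b i) ->
  (\esum_(i in [set: I]) (a i)%:E = r%:E)%E ->
  (\esum_(i in [set: I]) (b i)%:E = r%:E)%E -> forall i, a i = b i.
Proof.
move=> a0 ab ea eb i.
have d0 k : (0 <= (b k - a k)%:E)%E by rewrite lee_fin subr_ge0.
have : (r%:E + \esum_(k in [set: I]) (b k - a k)%:E = r%:E)%E.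
  rewrite -{1}ea -eb -esumD//; last by move=> k _; rewrite lee_fin.
  by apply: eq_esum => k _; rewrite -EFinD addrC subrK.
have := sum_le_esum (isT : uniq [:: i]) d0; rewrite big_seq1.
case: (\esum_(k in _) (b k - a k)%:E)%E => [x| |]//; rewrite lee_fin => h [e].
by apply/eqP; rewrite eq_le ab/=; have := d0 i; rewrite lee_fin; lra.
Qed.

(* [|c' - c/2|^2 - |c - c'/2|^2 = 3/4 (|c'|^2 - |c|^2)] telescopes; the
   boundedness of c makes the series of [|c|^2] finite. *)
Lemma blaschke_sum (I : choiceType) (c : I -> R[i]) (tau : I -> I) (M Y : R) :
  bijective tau -> (forall p, nsq (c p) <= M) ->
  (\esum_(p in [set: I]) (nsq (c p - 2^-1%:C * c (tau p)))%:E = Y%:E)%E ->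
  (\esum_(p in [set: I]) (nsq (c (tau p) - 2^-1%:C * c p))%:E = Y%:E)%E.
Proof.
move=> btau cM.
pose d p := nsq (c p - 2^-1%:C * c (tau p)).
pose d' p := nsq (c (tau p) - 2^-1%:C * c p).
pose a p := nsq (c p).
rewrite -/(d _) -/(d' _) => EY.
have d0 p : (0 <= (d p)%:E)%E by rewrite lee_fin; exact: nsq_ge0.
have a0 p : (0 <= (a p)%:E)%E by rewrite lee_fin; exact: nsq_ge0.
have d'0 p : (0 <= (d' p)%:E)%E by rewrite lee_fin; exact: nsq_ge0.
have a0' p : (0 <= (3 / 4)%:E * (a p)%:E)%E by rewrite mule_ge0// lee_fin.
have S_fin : (\esum_(p in [set: I]) (a p)%:E <= (4 * Y)%:E)%E.
  apply: esum_le_sums => t ut; rewrite sumEFin lee_fin.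
  apply: (@contraction_sum_bound _ a d tau M) => //.
  - exact: bij_inj.
  - move=> p; rewrite /a /d; have := nsqD_le (c p - 2^-1%:C * c (tau p)) (2^-1%:C * c (tau p)).
    by rewrite subrK nsqM nsq_real; have := nsq_ge0 (c (tau p)); lra.
  - by move=> t' ut'; rewrite -lee_fin -sumEFin -EY; exact: sum_le_esum.
have S0 : (0 <= \esum_(p in [set: I]) (a p)%:E)%E by exact: esum_ge0.
have : ((\esum_(p in [set: I]) (d' p)%:E) + (3/4)%:E * (\esum_(p in [set: I]) (a p)%:E) =
    (\esum_(p in [set: I]) (d p)%:E) + (3/4)%:E * (\esum_(p in [set: I]) (a p)%:E))%E.
  rewrite [in RHS](@reindex_esumT _ _ _ tau (fun p => (a p)%:E))//.
  rewrite -!esumZl// -!esumD//.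
  apply: eq_esum => p _; rewrite -!EFinM -!EFinD /d /d' /a; congr EFin.
  by case: (c p) (c (tau p)) => x y [z w]; rewrite /nsq /=; field.
move: S_fin S0; rewrite EY; case: (\esum_(p in _) (a p)%:E)%E => [x| |]// _ _.
by case: (\esum_(p in _) (d' p)%:E)%E => [y| |]//=; rewrite -!EFinM -!EFinD => -[e]; congr EFin; lra.
Qed.

End sums.

(** * Blaschke products along the lattice *)

Section blaschke.
Context {R : realType}.
Variables A C : 'M[R]_2.
Notation P := (plane R).
Notation mu := (@plane_measure R).
Implicit Types (k l i : idx) (f g phi psi : P -> R[i]).

(** A crude Cauchy-Schwarz inequality, from nonnegativity of the squared norm of [f - c g] for [c]
    among 1, -1, i, -i. It provides a bound on the coefficients that is uniform in the index. *)
Lemma nsq_inner_le f g : L2 f -> L2 g ->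
  nsq (inner f g) <= (fine (N2 f) + fine (N2 g)) ^+ 2.
Proof.
move=> Lf Lg; set z := inner f g; set m := fine (N2 f) + fine (N2 g).
have H (c : R[i]) : nsq c = 1 -> 2 * complex.Re (c^*%C * z) <= m.
  move=> c1; have := N2_ge0 (fun x => f x - c * g x).
  rewrite (N2B Lf (L2Z c Lg)) lee_fin innerZr// N2Z; last exact: Lg.1.
  by rewrite c1 mul1e /m; lra.
have n1 (a b : R) : a ^+ 2 + b ^+ 2 = 1 -> nsq (a +i* b) = 1 by [].
have h1 := H (1 +i* 0) (n1 1 0 _); have h2 := H ((-1) +i* 0) (n1 _ _ _).
have h3 := H (0 +i* 1) (n1 _ _ _); have h4 := H (0 +i* (-1)) (n1 _ _ _).
move: h1 h2 h3 h4; case: z {H} => x y /=.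
rewrite !expr2 !(mulr0, mul0r, mulr1, mulrN1, addr0, add0r, opprK).
move=> /(_ erefl) h1 /(_ erefl) h2 /(_ erefl) h3 /(_ erefl) h4.
rewrite /nsq /=.
have u1 : 0 <= m / 2 - x by lra.
have u2 : 0 <= m / 2 + x by lra.
have u3 : 0 <= m / 2 - y by lra.
have u4 : 0 <= m / 2 + y by lra.
have := mulr_ge0 u1 u2; have := mulr_ge0 u3 u4; have := sqr_ge0 m; rewrite !expr2; lra.
Qed.

Lemma coef_inner f g k : coef C (fun x => f x * (g x)^*%C) k =
  inner f (fun x => g x * chr C k x).
Proof. by apply: eq_cintegral => x; rewrite -[RHS]/(f x * (g x * chr C k x)^*%C) conjcM mulrA. Qed.

Lemma coef_bounded f g k : L2 f -> L2 g ->
  nsq (coef C (fun x => f x * (g x)^*%C) k) <= (fine (N2 f) + fine (N2 g)) ^+ 2.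
Proof.
move=> Lf Lg; rewrite coef_inner; apply: le_trans (nsq_inner_le Lf (L2_chr C k Lg)) _.
rewrite [N2 (fun x => g x * _)](_ : _ = N2 g)//.
by apply: eq_integral => x _; rewrite nsqM nsq_chr mulr1.
Qed.

Lemma coefBZ f g g' (r : R[i]) k : L2 f -> L2 g -> L2 g' ->
  coef C (fun x => f x * (g x - r * g' x)^*%C) k =
  coef C (fun x => f x * (g x)^*%C) k - r^*%C * coef C (fun x => f x * (g' x)^*%C) k.
Proof.
move=> Lf Lg Lg'; have h := coefD C k Lf Lg (L2Z (- r^*%C) Lf) Lg'.
rewrite (_ : (fun x => f x * (g x - r * g' x)^*%C) =
    fun x => f x * (g x)^*%C + - r^*%C * f x * (g' x)^*%C); last first.
  by apply/funext => x; rewrite -mulNr conjcD conjcM rmorphN; ring.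
rewrite h -mulNr; congr (_ + _).
rewrite /coef -cintegralZ; last exact: cintegrable_coef.
by apply: eq_cintegral => x; rewrite !mulrA.
Qed.

(** Passing from [phi] to the new function multiplies its symbol by (z - 1/2) / (1 - z/2), of
    modulus 1 on the circle. For the coefficients against a fixed [f] this is [blaschke_sum]. *)
Lemma parseval_blaschke phi psi s : L2 psi ->
  (forall x, phi x = psi x - 2^-1%:C * psi (x - lattice_pt A s)) ->
  parseval_frame A C phi ->
  parseval_frame A C (fun x => psi (x - lattice_pt A s) - 2^-1%:C * psi x).
Proof.
move=> Lp phiE [Lphi hphi]; have Ls l := L2_shift (- lattice_pt A l) Lp.
split; first by apply: L2B => //; exact: L2Z.
move=> f Lf; have := hphi f Lf; rewrite /frame_sum.
pose c (p : idx * idx) := coef C (fun x => f x * (psi (x - lattice_pt A p.1))^*%C) p.2.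
pose tau (p : idx * idx) : idx * idx := (p.1 + s, p.2).
have r_real : (2^-1%:C : R[i])^*%C = 2^-1%:C by rewrite conjc_real.
have sE x l : psi (x - lattice_pt A l - lattice_pt A s) = psi (x - lattice_pt A (l + s)).
  by rewrite lattice_ptD opprD addrA.
have dE l k : coef C (fun x => f x * (phi (x - lattice_pt A l))^*%C) k =
    c (l, k) - 2^-1%:C * c (tau (l, k)).
  rewrite -r_real -coefBZ// /coef; apply: eq_cintegral => x.
  by rewrite phiE sE.
have d'E l k : coef C (fun x => f x *
    (psi (x - lattice_pt A l - lattice_pt A s) - 2^-1%:C * psi (x - lattice_pt A l))^*%C) k =
    c (tau (l, k)) - 2^-1%:C * c (l, k).
  rewrite -r_real -coefBZ// /coef; apply: eq_cintegral => x.
  by rewrite sE r_real.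
rewrite !esum_pair; try by move=> l k; rewrite lee_fin nsq_ge0.
rewrite (eq_esum (b := fun p => (nsq (c p - 2^-1%:C * c (tau p)))%:E)); last first.
  by move=> -[l k] _; rewrite dE.
rewrite [X in _ -> X = _](eq_esum (b := fun p => (nsq (c (tau p) - 2^-1%:C * c p))%:E)); last first.
  by move=> -[l k] _; rewrite d'E.
have fY : N2 f \is a fin_num by rewrite ge0_fin_numE ?N2_ge0// Lf.2.
rewrite -(fineK fY).
apply: (blaschke_sum (M := (fine (N2 f) + fine (N2 psi)) ^+ 2)).
  by exists (fun p => (p.1 - s, p.2)) => -[l k]; rewrite /tau /= ?addrK ?subrK.
move=> [l k]; have := coef_bounded k Lf (Ls l).
by rewrite (N2_shift _ Lp.1).
Qed.

Lemma parseval_lattice_shift g s : parseval_frame A C g ->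
  parseval_frame A C (fun x => g (x + lattice_pt A s)).
Proof.
move=> [Lg hg]; split; first exact: L2_shift.
move=> f Lf; rewrite -(hg f Lf) /frame_sum.
rewrite [RHS](@reindex_esumT _ _ _ (fun l => l - s)); last first.
  by exists (fun l => l + s) => l; rewrite ?addrK ?subrK.
apply: eq_esum => l _; apply: eq_esum => k _; congr (EFin (nsq (coef C _ k))).
by apply/funext => x; rewrite lattice_ptB opprB [in RHS]addrA [x + _ - _]addrAC.
Qed.

End blaschke.

(** * Step functions on the cells *)

Section step_functions.
Context {R : realType}.
Variable C : 'M[R]_2.
Hypothesis uC : C \in unitmx.
Notation P := (plane R).
Notation mu := (@plane_measure R).
Notation K := (`|\det C|).
Implicit Types (k l j s : idx) (u v w : idx -> R).

(** A tile moves [x] into the cell by adding a lattice point; the opposite sign gives the index of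
    the cell that contains [x]. *)
Definition cell_index (x : P) : idx := - projT1 (cid ((tile_cell uC).2 x)).

Lemma cell_indexP x : cell C (x - lattice_pt C (cell_index x)).
Proof. by rewrite /cell_index lattice_ptN opprK; case: cid. Qed.

Lemma cell_index_uniq x l : cell C (x - lattice_pt C l) -> cell_index x = l.
Proof.
move=> cl; apply: oppr_inj.
apply: (@packing_uniq _ C (cell C) x _ _ (tile_cell uC).1); rewrite lattice_ptN //.
exact: cell_indexP.
Qed.

Lemma cell_index_shift x l : cell_index (x - lattice_pt C l) = cell_index x - l.
Proof.
apply: cell_index_uniq; rewrite lattice_ptB opprB addrA subrK.
exact: cell_indexP.
Qed.

Lemma cell_index_cell x : cell C x -> cell_index x = 0.
Proof. by move=> cx; apply: cell_index_uniq; rewrite lattice_pt0 subr0. Qed.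

(** The factor that makes [step_fun] an isometry from square-summable sequences into L^2, by
    [N2_step]. *)
Definition root_covolume : R := (Num.sqrt K)^-1.

Lemma root_covolume_sqr : K * root_covolume ^+ 2 = 1.
Proof.
have K0 : 0 < K by rewrite normr_gt0 -unitfE -unitmxE.
by rewrite /root_covolume exprVn sqr_sqrtr ?divff ?lt0r_neq0// ltW.
Qed.

Definition step_fun u (x : P) : R[i] := (root_covolume * u (cell_index x))%:C.

Lemma measurable_step u : measurable_fun [set: P] (fun x => u (cell_index x)).
Proof.
move=> _ B mB; rewrite setTI.
rewrite (_ : _ @^-1` B = \bigcup_l ([set x : P | B (u l)] `&`
    ((fun x : P => x + - lattice_pt C l) @^-1` cell C))).
  apply: countable_bigcupT_measurable => // l; apply: measurableI.
    have [Bl|nB] := pselect (B (u l)).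
      by rewrite (_ : [set x | _] = setT)//; apply/seteqP; split.
    by rewrite (_ : [set x | _] = set0)//; apply/seteqP; split.
  by apply: measurable_shift; exact: measurable_cell.
apply/seteqP; split=> [x /= Bx|x [l _ [Bl cl]]].
  by exists (cell_index x) => //; split=> //; exact: cell_indexP.
by rewrite /= (cell_index_uniq cl).
Qed.

Lemma cmeasurable_step u : cmeasurable (step_fun u).
Proof. by apply: cmeasurable_real; apply: measurable_funM => //; exact: measurable_step. Qed.

Lemma N2_step u : N2 (step_fun u) = (\esum_(l in [set: idx]) (u l ^+ 2)%:E)%E.
Proof.
rewrite /N2 (ge0_integral_tile (tile_cell uC) (measurable_cell C)); last 2 first.
- by apply: measurable_ensq; exact: cmeasurable_step.
- by move=> x; rewrite lee_fin nsq_ge0.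
pose S := (\esum_(l in [set: idx]) (u l ^+ 2)%:E)%E.
rewrite (eq_integral (fun=> (root_covolume ^+ 2)%:E * S)%E); last first.
  move=> x /set_mem cx; rewrite -esumZl ?sqr_ge0//; last by move=> l; rewrite lee_fin sqr_ge0.
  apply: eq_esum => l _; rewrite /step_fun nsq_real -EFinM exprMn.
  by rewrite -[l]opprK lattice_ptN cell_index_shift cell_index_cell// add0r.
have S0 : (0 <= S)%E by apply: esum_ge0 => l _; rewrite lee_fin sqr_ge0.
rewrite integral_cst; last exact: measurable_cell.
rewrite [mu _]cell_measure// muleAC -EFinM mulrC.
by rewrite root_covolume_sqr mul1e.
Qed.

Lemma step_shift u l x : step_fun u (x - lattice_pt C l) = step_fun (fun i => u (i - l)) x.
Proof. by rewrite /step_fun cell_index_shift. Qed.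

Definition parseval_step u := parseval_frame C C (step_fun u).

Lemma step_sum_bound u (t : seq idx) : L2 (step_fun u) -> uniq t ->
  \sum_(l <- t) u l ^+ 2 <= fine (N2 (step_fun u)).
Proof.
move=> [_ Lu] ut; rewrite -lee_fin fineK ?ge0_fin_numE ?N2_ge0// N2_step -sumEFin.
by apply: sum_le_esum => // l; rewrite lee_fin sqr_ge0.
Qed.

(** The sequence [w] is [u] divided by 1 - z/2. Being bounded, it is square-summable by
    [contraction_sum_bound], so [parseval_blaschke] applies to its step function. *)
Lemma blaschke_step u w s (M : R) : (forall l, w l ^+ 2 <= M) ->
  (forall l, u l = w l - 2^-1 * w (l - s)) -> parseval_step u ->
  parseval_step (fun l => w (l - s) - 2^-1 * w l).
Proof.
move=> wM uw pu; have Lw : L2 (step_fun w).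
  split; first exact: cmeasurable_step.
  apply: (@le_lt_trans _ _ (4 * fine (N2 (step_fun u)))%:E); last exact: ltry.
  rewrite N2_step; apply: esum_le_sums => t ut; rewrite sumEFin lee_fin.
  apply: (@contraction_sum_bound _ _ _ (fun l => u l ^+ 2) (fun l => l - s) M) => //.
  - by move=> l l' /addIr.
  - by move=> l; exact: sqr_ge0.
  - move=> l; rewrite uw; have := sqr_ge0 (w l - w (l - s)); rewrite !expr2; nra.
  - by move=> t' ut'; apply: step_sum_bound => //; exact: pu.1.
have := parseval_blaschke (phi := step_fun u) Lw (s := s) _ pu.
rewrite (_ : (fun x => _ - _) = step_fun (fun l => w (l - s) - 2^-1 * w l)).
  apply => x; rewrite step_shift /step_fun -rmorphM -rmorphB; congr (_%:C).
  by rewrite uw; ring.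
by apply/funext => x; rewrite step_shift /step_fun -rmorphM -rmorphB; congr (_%:C); ring.
Qed.

Lemma shift_step u s : parseval_step u -> parseval_step (fun l => u (l + s)).
Proof.
move=> pu; have := parseval_lattice_shift s pu; congr (parseval_frame C C _).
by apply/funext => x; rewrite -[s]opprK lattice_ptN step_shift opprK.
Qed.

Lemma parseval_step_delta : parseval_step (fun l => (l == 0)%:R).
Proof.
have tc := tile_cell uC; have mc := measurable_cell C.
have e0 (x : P) : \1_set0 x = 0 :> R by rewrite indicE in_set0.
have := @parseval_test_fun R C C uC (cell C) set0 0 0 0 mc measurable0 _ _ _ _ _.
rewrite (_ : test_fun _ _ _ _ _ _ _ = step_fun (fun l => (l == 0)%:R)).
  apply=> //.
  - by rewrite preimage_set0 !setU0; exact: tc.1.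
  - exists set0; split=> // x nx; exfalso; apply: nx.
    rewrite -(count_packing tc.1 (tc.2 x)); apply: eq_esum => l _.
    by rewrite expr0n /= mulr0 mul0r addr0.
apply/funext => x; rewrite /test_fun /step_fun !e0 !(addr0, subr0, mulr0).
congr (_%:C); congr (_ * _); rewrite indicE; congr (nat_of_bool _)%:R.
apply/idP/eqP => [/set_mem|h]; first exact: cell_index_cell.
by apply/mem_set; have := cell_indexP x; rewrite h lattice_pt0 subr0.
Qed.

Lemma step_test h u j (beta : P -> R[i]) : frame_multiplier C C h ->
  parseval_step u -> j != 0 -> cmeasurable beta ->
  {ae mu, forall x, cell C x ->
    (\esum_(l in [set: idx]) (nsq (h (x + lattice_pt C l) * (u l)%:C +
       beta x * (h (x + lattice_pt C (l + j)) * (u (l + j))%:C)))%:E =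
     (1 + nsq (beta x))%:E)%E}.
Proof.
(* The index is [- j] because [parseval_frame_ae] subtracts lattice points, which are added here. *)
move=> [_ hm] pu j0 cb; have jn0 : - j != 0 by rewrite oppr_eq0.
apply: (ae_imp (parseval_frame_ae uC (hm _ pu) jn0 cb)) => x <- cx.
rewrite [RHS](@reindex_esumT _ _ _ (fun l => - l)); last first.
  by exists (fun l => - l) => l; rewrite opprK.
apply: eq_esum => l _; congr EFin.
rewrite -lattice_ptN opprK -addrA -!lattice_ptN -lattice_ptD !opprK.
have sE a : step_fun u (x + lattice_pt C a) = (root_covolume * u a)%:C.
  by rewrite -[a]opprK lattice_ptN step_shift /step_fun cell_index_cell// add0r.
rewrite !sE [j + l]addrC -[LHS]mul1r -root_covolume_sqr -mulrA; congr (_ * _).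
by rewrite -nsq_real -nsqM; congr nsq; rewrite !rmorphM /=; ring.
Qed.

End step_functions.

(** * Generation of the index group by two vectors *)

Section span.
Context {R : realType}.
Variables A C : 'M[R]_2.
Hypothesis uA : A \in unitmx.
Hypothesis uC : C \in unitmx.
Notation P := (plane R).
Notation mu := (@plane_measure R).
Implicit Types (k l j : idx).

Definition pt (a b : int) : idx := \col_i (if i == 0 then a else b).

Lemma ptD a b c d : pt a b + pt c d = pt (a + c) (b + d).
Proof. by apply/matrixP => i j; rewrite !mxE; case: ifP. Qed.

Lemma pt0 : pt 0 0 = 0.
Proof. by apply/matrixP => i j; rewrite !mxE; case: ifP. Qed.

Lemma idx_eta l : l = pt (l 0 0) (l 1 0).
Proof.
apply/matrixP => i j; rewrite (ord1 j) mxE; case: i => -[|[|//]] hi; congr (l _ _);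
exact: val_inj.
Qed.

Lemma pt_inj a b c d : pt a b = pt c d -> a = c /\ b = d.
Proof. by move/matrixP => h; have := h 0 0; have := h 1 0; rewrite !mxE. Qed.

Lemma idx_span (S : idx -> Prop) : (forall a b, S a -> S b -> S (a + b)) ->
  (forall a, S a -> S (- a)) -> S (pt 1 0) -> S (pt 0 1) -> forall l, S l.
Proof.
move=> SD SN S1 S2.
have S0 : S 0 by rewrite -(subrr (pt 1 0)); apply: SD => //; exact: SN.
have Sn a (n : nat) : S a -> S (a *+ n).
  by move=> Sa; elim: n => [|n ih]; rewrite ?mulr0n// mulrS; exact: SD.
have Sz a (z : int) : S a -> S (a *~ z).
  move=> Sa; case: z => n; first exact: Sn.
  by rewrite NegzE mulrNz; apply: SN; exact: (Sn a n.+1 Sa).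
move=> l; rewrite (_ : l = pt 1 0 *~ l 0 0 + pt 0 1 *~ l 1 0).
  by apply: SD; exact: Sz.
have zE a b (z : int) : pt a b *~ z = pt (a * z) (b * z).
  have nE (n : nat) : pt a b *+ n = pt (a * n%:Z) (b * n%:Z).
    elim: n => [|n ih]; first by rewrite mulr0n !mulr0 pt0.
    by rewrite mulrS ih ptD; congr (pt _ _); rewrite intS mulrDr mulr1.
  case: z => n; first exact: nE.
  rewrite NegzE mulrNz !mulrN -[_ *~ _]/(_ *+ _) nE.
  by apply/matrixP => i j; rewrite !mxE; case: ifP.
by rewrite !zE ptD !mul1r !mul0r addr0 add0r -idx_eta.
Qed.

Variable h : P -> R[i].

Lemma four_point_eqNl l j : {ae mu, forall x, four_point_eq A C h l j x} ->
  {ae mu, forall x, four_point_eq A C h (- l) j x}.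
Proof.
move=> /(ae_shift (lattice_pt A l)) Q; apply: (ae_imp Q) => x.
by rewrite /four_point_eq lattice_ptN opprK addrK => ->.
Qed.

Lemma four_point_eqNr l j : {ae mu, forall x, four_point_eq A C h l j x} ->
  {ae mu, forall x, four_point_eq A C h l (- j) x}.
Proof.
move=> /(ae_shift (lattice_pt C j)) Q; apply: (ae_imp Q) => x.
rewrite /four_point_eq lattice_ptN opprK addrK => /(f_equal (@conjc R)).
rewrite !conjcM !conjcK => e; rewrite mulrC e mulrC.
by rewrite [x + _ - lattice_pt A l]addrAC addrK.
Qed.

End span.

Section blaschke_sequence.
Context {R : realType}.

(** Taylor coefficients of 1 / (1 - z/2), extended by 0 so that the recursion [geoE] holds at every
    integer. *)
Definition geo (n : int) : R := if n is Posz k then 2^-1 ^+ k else 0.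

Lemma geoE n : geo n = (n == 0)%:R + 2^-1 * geo (n - 1).
Proof.
case: n => [[|n]|n].
- by rewrite /geo /= mulr0 addr0 expr0.
- rewrite (_ : n.+1%:Z - 1 = n%:Z); last by lia.
  by rewrite /geo exprS /= add0r.
- rewrite (_ : Negz n - 1 = Negz n.+1); last by lia.
  by rewrite /geo mulr0 addr0.
Qed.

Lemma geo_itv n : 0 <= geo n <= 1.
Proof.
case: n => n /=; last by rewrite lexx ler01.
by rewrite exprn_ge0//= exprn_ile1//; lra.
Qed.

(* Taylor coefficients of the Blaschke factor (z - 1/2) / (1 - z/2). *)
Definition blaschke_coef n : R := geo (n - 1) - 2^-1 * geo n.

Lemma blaschke_coef0 : blaschke_coef 0 = - 2^-1.
Proof. by rewrite /blaschke_coef /geo /= expr0 mulr1 sub0r. Qed.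

Lemma blaschke_coef_pos (n : nat) : blaschke_coef n.+1 = 3 / 4 * 2^-1 ^+ n.
Proof.
rewrite /blaschke_coef (_ : n.+1%:Z - 1 = n%:Z); last by lia.
by rewrite /geo exprS; field.
Qed.

Lemma blaschke_coef_neg n : blaschke_coef (Negz n) = 0.
Proof.
rewrite /blaschke_coef (_ : Negz n - 1 = Negz n.+1); last by lia.
by rewrite /geo mulr0 subr0.
Qed.

Lemma blaschke_coef_gt0 (n : nat) : 0 < blaschke_coef n.+1.
Proof. by rewrite blaschke_coef_pos mulr_gt0// exprn_gt0. Qed.

Lemma blaschke_coef_sqr n : blaschke_coef n ^+ 2 <= 1.
Proof.
rewrite /blaschke_coef; have /andP[a0 a1] := geo_itv (n - 1).
by have /andP[b0 b1] := geo_itv n; nra.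
Qed.

(** Only the coefficient at 0 is negative and its left neighbour vanishes, so the one negative
    product of neighbours sits at [n = 0]. *)
Lemma blaschke_coef_mul n : n != 0 -> 0 <= blaschke_coef n * blaschke_coef (n + 1).
Proof.
case: n => [[|n]|n]// _; last by rewrite blaschke_coef_neg mul0r.
rewrite (_ : n.+1%:Z + 1 = n.+2%:Z); last by lia.
by apply: mulr_ge0; apply: ltW; exact: blaschke_coef_gt0.
Qed.

Variable C : 'M[R]_2.
Hypothesis uC : C \in unitmx.
Implicit Types (l s : idx).

(** [nu] is a coordinate raised by 1 along [s], and [v] a profile constant along [s]. The auxiliary
    sequence is [geo (nu l) * v l]; multiplication by the Blaschke symbol replaces the unit mass in
    [nu] by the coefficients of the factor. *)
Lemma parseval_step_line s (nu : idx -> int) (v : idx -> R) :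
  (forall l, nu (l - s) = nu l - 1) -> (forall l, v (l - s) = v l) ->
  (forall l, v l ^+ 2 <= 1) ->
  parseval_step uC (fun l => (nu l == 0)%:R * v l) ->
  parseval_step uC (fun l => blaschke_coef (nu l) * v l).
Proof.
move=> nus vs v1 pu.
have := @blaschke_step _ _ uC _ (fun l => geo (nu l) * v l) s 1 _ _ pu.
rewrite (_ : (fun l => _ - _) = fun l => blaschke_coef (nu l) * v l).
  apply=> l.
    rewrite exprMn -[leRHS]mulr1; apply: ler_pM => //; try exact: sqr_ge0.
    by have /andP[a b] := geo_itv (nu l); nra.
  by rewrite nus vs [in RHS]geoE; ring.
by apply/funext => l; rewrite nus vs /blaschke_coef; ring.
Qed.

Let parseval_delta : parseval_step uC (fun l => (l 0 0 == 0)%:R * (l 1 0 == 0)%:R).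
Proof.
have := parseval_step_delta uC; congr (parseval_step uC _); apply/funext => l.
rewrite -natrM mulnb; congr (nat_of_bool _)%:R.
by apply/eqP/andP => [->|[/eqP a /eqP b]]; rewrite ?mxE//; rewrite (idx_eta l) a b pt0.
Qed.

Let bool_sqr (b : bool) : (b%:R : R) ^+ 2 <= 1.
Proof. by case: b; rewrite ?expr1n// expr0n. Qed.

Lemma parseval_step_e1 :
  parseval_step uC (fun l => blaschke_coef (l 0 0) * (l 1 0 == 0)%:R).
Proof.
apply: (@parseval_step_line (pt 1 0) (fun l => l 0 0) (fun l => (l 1 0 == 0)%:R)).
- by move=> l; rewrite !mxE.
- by move=> l; rewrite !mxE /= subr0.
- by move=> l; exact: bool_sqr.
- exact: parseval_delta.
Qed.

Lemma parseval_step_e2 :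
  parseval_step uC (fun l => blaschke_coef (l 1 0) * (l 0 0 == 0)%:R).
Proof.
apply: (@parseval_step_line (pt 0 1) (fun l => l 1 0) (fun l => (l 0 0 == 0)%:R)).
- by move=> l; rewrite !mxE.
- by move=> l; rewrite !mxE /= subr0.
- by move=> l; exact: bool_sqr.
- by under eq_fun do rewrite mulrC; exact: parseval_delta.
Qed.

Lemma parseval_step_diag :
  parseval_step uC (fun l => blaschke_coef (l 0 0) * (l 0 0 == l 1 0)%:R).
Proof.
apply: (@parseval_step_line (pt 1 1) (fun l => l 0 0) (fun l => (l 0 0 == l 1 0)%:R)).
- by move=> l; rewrite !mxE.
- by move=> l; rewrite !mxE /= (inj_eq (addIr _)).
- by move=> l; exact: bool_sqr.
- move: parseval_delta; congr (parseval_step uC _); apply/funext => l.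
  by case: eqP => [->|_]; [rewrite eq_sym|rewrite !mul0r].
Qed.

(** A second Blaschke factor, along the other axis, applied to the generator of
    [parseval_step_e1]. *)
Lemma parseval_step_square :
  parseval_step uC (fun l => blaschke_coef (l 1 0) * blaschke_coef (l 0 0)).
Proof.
apply: (@parseval_step_line (pt 0 1) (fun l => l 1 0) (fun l => blaschke_coef (l 0 0))).
- by move=> l; rewrite !mxE.
- by move=> l; rewrite !mxE /= subr0.
- by move=> l; exact: blaschke_coef_sqr.
- by under eq_fun do rewrite mulrC; exact: parseval_step_e1.
Qed.

End blaschke_sequence.

(** * The case of equal lattices *)

Section equal_lattices.
Context {R : realType}.
Variable C : 'M[R]_2.
Hypothesis uC : C \in unitmx.
Notation P := (plane R).
Notation mu := (@plane_measure R).
Notation L := (lattice_pt C).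
Variable h : P -> R[i].
Hypothesis hm : frame_multiplier C C h.
Implicit Types (l j s p : idx).

(** The test with this multiplier gives the comparison sum of [norm_test]. *)
Lemma frame_multiplier1 : frame_multiplier C C (fun=> 1 : R[i]).
Proof.
split; first exact: cmeasurable_cst.
by move=> g; rewrite (_ : (fun x => 1 * g x) = g)//; apply/funext => x; rewrite mul1r.
Qed.

Lemma unimodular_lattice : {ae mu, forall x, forall l, nsq (h (x + L l)) = 1}.
Proof.
apply: ae_forall => l; apply: (@ae_shift _ (fun x => nsq (h x) = 1)).
apply: (multiplier_unimodular uC uC _ hm); exact: lexx.
Qed.

Lemma ae_cell (Q : P -> Prop) :
  (forall p, {ae mu, forall x, cell C x -> Q (x + L p)}) -> {ae mu, forall x, Q x}.
Proof.
move=> H; have H' p : {ae mu, forall x, cell C (x - L p) -> Q x}.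
  apply: (ae_imp (ae_shift (- L p) (H p))) => x Hx cx.
  by have := Hx cx; rewrite subrK.
by apply: (ae_imp (ae_forall H')) => x; apply; exact: (cell_indexP uC x).
Qed.

Definition step_shifted (u : idx -> R) p l := u (l - p).

Lemma parseval_step_shifted u p : parseval_step uC u -> parseval_step uC (step_shifted u p).
Proof. exact: shift_step. Qed.

Lemma beta_measurable p s : cmeasurable (fun x => h (x + L p) * (h (x + L (p + s)))^*%C).
Proof.
have ch := hm.1.
by apply: cmeasurableM; [|apply: cmeasurableJ]; exact: cmeasurable_shift.
Qed.

Lemma esum_at_base (u : idx -> R) p s (x : P) :
  (\esum_(l in [set: idx]) (nsq (h (x + L l) * (step_shifted u p l)%:C +
      h (x + L p) * (h (x + L (p + s)))^*%C *
      (h (x + L (l + s)) * (step_shifted u p (l + s))%:C)))%:E = 2%:E)%E ->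
  (\esum_(l in [set: idx]) (nsq (h (x + L p + L l) * (u l)%:C +
      h (x + L p) * (h (x + L p + L s))^*%C *
      (h (x + L p + L (l + s)) * (u (l + s))%:C)))%:E = 2%:E)%E.
Proof.
move=> <-; rewrite [RHS](@reindex_esumT _ _ _ (fun l => l + p)); last first.
  by exists (fun l => l - p) => l; rewrite ?addrK ?subrK.
apply: eq_esum => l _; rewrite /step_shifted.
have -> : l + p + s - p = l + s by rewrite addrAC addrK.
have -> : l + p + s = p + (l + s) by rewrite [l + p]addrC addrA.
by rewrite addrK [l + p]addrC !(lattice_ptD _ p) !addrA.
Qed.

(** The choice [beta = h x * conj (h (x + L s))] gives both values in the term at [l = 0] the phase
    of [h x]. Since [step_test] bears on the base cell only, [u] is shifted by [p] to reach the cell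
    of index [p]. *)
Lemma base_test (u : idx -> R) s : parseval_step uC u -> s != 0 ->
  {ae mu, forall x, (\esum_(l in [set: idx]) (nsq (h (x + L l) * (u l)%:C +
      h x * (h (x + L s))^*%C * (h (x + L (l + s)) * (u (l + s))%:C)))%:E = 2%:E)%E}.
Proof.
move=> pu s0; apply: ae_cell => p.
have T := step_test hm (parseval_step_shifted p pu) s0 (beta_measurable p s).
apply: (ae_imp (ae_and T unimodular_lattice)) => x [Tx Ux] cx.
apply: esum_at_base => //; rewrite Tx// nsqM nsqJ !Ux mulr1 -natr1.
by congr EFin; rewrite addrC.
Qed.

End equal_lattices.

Section unimodular_pairs.
Context {R : realType}.
Implicit Types (z w : R[i]) (a b : R).

Lemma nsq_combination z w a b : nsq z = 1 -> nsq w = 1 ->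
  nsq (z * a%:C + w * b%:C) = a ^+ 2 + b ^+ 2 + 2 * (a * b) * complex.Re (z * w^*%C).
Proof.
case: z w => z1 z2 [w1 w2]; rewrite /nsq /= => hz hw.
rewrite -[a ^+ 2]mulr1 -[b ^+ 2]mulr1 -{1}hz -{1}hw; ring.
Qed.

Lemma Re_mulJ_le1 z w : nsq z = 1 -> nsq w = 1 -> complex.Re (z * w^*%C) <= 1.
Proof.
move=> hz hw; have := nsq_ge0 (z - w); rewrite nsqD nsqN hz hw.
by case: z w {hz hw} => z1 z2 [w1 w2] /=; lra.
Qed.

Lemma Re_mulJ_eq1 z w : nsq z = 1 -> nsq w = 1 -> complex.Re (z * w^*%C) = 1 -> z = w.
Proof.
move=> hz hw h; apply/eqP; rewrite -subr_eq0; apply/eqP/nsq_eq0.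
rewrite nsqD nsqN hz hw; move: h.
by case: z w {hz hw} => z1 z2 [w1 w2] /=; lra.
Qed.

Lemma conjc_unimodular z : nsq z = 1 -> z^*%C = z^-1.
Proof.
move=> /unimodular_mulJ e; have z0 : z != 0.
  by apply/eqP => z0; move: e; rewrite z0 mul0r => /eqP; rewrite eq_sym oner_eq0.
by apply: (mulfI z0); rewrite e divff.
Qed.

Lemma unimodular_neq0 z : nsq z = 1 -> z != 0.
Proof. by move=> h; apply/eqP => z0; move: h; rewrite z0 nsq0 => /eqP; rewrite eq_sym oner_eq0. Qed.

End unimodular_pairs.

Section equal_lattices_tests.
Context {R : realType}.
Variable C : 'M[R]_2.
Hypothesis uC : C \in unitmx.
Notation P := (plane R).
Notation mu := (@plane_measure R).
Notation L := (lattice_pt C).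
Variable h : P -> R[i].
Hypothesis hm : frame_multiplier C C h.
Implicit Types (l j s p : idx).

Lemma norm_test (u : idx -> R) s : parseval_step uC u -> s != 0 ->
  {ae mu, forall x : P, (\esum_(l in [set: idx]) ((u l + u (l + s)) ^+ 2)%:E = 2%:E)%E}.
Proof.
move=> pu s0; apply: (ae_imp (base_test (frame_multiplier1 C) pu s0)) => x <-.
apply: eq_esum => l _; rewrite conjc1 !mul1r -rmorphD nsq_real.
by [].
Qed.

(* The sum of [base_test] is dominated termwise by that of [norm_test]; both
   equal 2, so that equality holds in the triangle inequality at [l = s]. *)
Lemma line_test (u : idx -> R) s : parseval_step uC u -> s != 0 ->
  (forall l, l != 0 -> 0 <= u l * u (l + s)) -> 0 < u s * u (s + s) ->
  {ae mu, forall x, h (x + L s) ^+ 2 = h x * h (x + L (s + s))}.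
Proof.
move=> pu s0 upos us.
apply: (ae_imp (ae_and (base_test hm pu s0) (ae_and (norm_test pu s0) (unimodular_lattice uC hm)))).
move=> x [B [N U]].
have U0 : nsq (h x) = 1 by have := U 0; rewrite lattice_pt0 addr0.
set be := h x * (h (x + L s))^*%C in B.
have be1 : nsq be = 1 by rewrite nsqM nsqJ U0 U mulr1.
have W l : nsq (be * h (x + L (l + s))) = 1 by rewrite nsqM be1 U mulr1.
have T l : nsq (h (x + L l) * (u l)%:C + be * (h (x + L (l + s)) * (u (l + s))%:C)) =
    u l ^+ 2 + u (l + s) ^+ 2 +
    2 * (u l * u (l + s)) * complex.Re (h (x + L l) * (be * h (x + L (l + s)))^*%C).
  by rewrite mulrA nsq_combination.
have le l : nsq (h (x + L l) * (u l)%:C + be * (h (x + L (l + s)) * (u (l + s))%:C)) <=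
    (u l + u (l + s)) ^+ 2.
  (* At [l = 0], where the product of the two values of [u] may be negative, the phases agree by the
     choice of [be] and equality holds. *)
  have [->|l0] := eqVneq l 0.
    rewrite lattice_pt0 addr0 add0r /be.
    rewrite (_ : _ + _ = h x * ((u 0)%:C + (h (x + L s) * (h (x + L s))^*%C) * (u s)%:C)); last by ring.
    by rewrite (unimodular_mulJ (U s)) mul1r -rmorphD nsqM U0 mul1r nsq_real.
  rewrite T sqrrD -mulr_natl.
  have := ler_wpM2l (upos l l0) (Re_mulJ_le1 (U l) (W l)); lra.
have E := esum_le_eq (fun l => nsq_ge0 _) le B N s.
rewrite T in E.
have Re1 : complex.Re (h (x + L s) * (be * h (x + L (s + s)))^*%C) = 1.
  apply: (mulfI (lt0r_neq0 us)); move: E; rewrite sqrrD; lra.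
have e := Re_mulJ_eq1 (U s) (W s) Re1.
rewrite expr2 {1}e /be -mulrA mulrACA; rewrite [(_^*%C) * _]mulrC.
by rewrite (unimodular_mulJ (U s)) mulr1.
Qed.

Lemma line_test_e1 : {ae mu, forall x,
  h (x + L (pt 1 0)) ^+ 2 = h x * h (x + L (pt 2 0))}.
Proof.
have s0 : pt 1 0 != 0 by rewrite -pt0; apply/eqP => /pt_inj[].
have -> : pt 2 0 = pt 1 0 + pt 1 0 by rewrite ptD.
apply: (line_test (parseval_step_e1 uC) s0) => [l l0|]; rewrite !mxE /=.
  rewrite addr0 mulrACA -natrM mulnb andbb.
  have [l1|_] := eqVneq (l 1 0) 0; last by rewrite mulr0.
  rewrite mulr1; apply: blaschke_coef_mul; apply: contra l0 => /eqP l00.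
  by rewrite (idx_eta l) l00 l1 pt0.
by rewrite !mulr1; apply: mulr_gt0; [exact: (blaschke_coef_gt0 0)|exact: (blaschke_coef_gt0 1)].
Qed.

Lemma line_test_e2 : {ae mu, forall x,
  h (x + L (pt 0 1)) ^+ 2 = h x * h (x + L (pt 0 2))}.
Proof.
have s0 : pt 0 1 != 0 by rewrite -pt0; apply/eqP => /pt_inj[].
have -> : pt 0 2 = pt 0 1 + pt 0 1 by rewrite ptD.
apply: (line_test (parseval_step_e2 uC) s0) => [l l0|]; rewrite !mxE /=.
  rewrite addr0 mulrACA -natrM mulnb andbb.
  have [l1|_] := eqVneq (l 0 0) 0; last by rewrite mulr0.
  rewrite mulr1; apply: blaschke_coef_mul; apply: contra l0 => /eqP l10.
  by rewrite (idx_eta l) l10 l1 pt0.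
by rewrite !mulr1; apply: mulr_gt0; [exact: (blaschke_coef_gt0 0)|exact: (blaschke_coef_gt0 1)].
Qed.

Lemma diag_neq0 : pt 1 1 != 0.
Proof. by rewrite -pt0; apply/eqP => /pt_inj[]. Qed.

Lemma line_test_diag : {ae mu, forall x,
  h (x + L (pt 1 1)) ^+ 2 = h x * h (x + L (pt 2 2))}.
Proof.
have -> : pt 2 2 = pt 1 1 + pt 1 1 by rewrite ptD.
apply: (line_test (parseval_step_diag uC) diag_neq0) => [l l0|]; rewrite !mxE /=.
  rewrite (inj_eq (addIr _)) mulrACA -natrM mulnb andbb.
  have [l1|_] := eqVneq (l 0 0) (l 1 0); last by rewrite mulr0.
  rewrite mulr1; apply: blaschke_coef_mul; apply: contra l0 => /eqP l00.
  by rewrite (idx_eta l) -l1 l00 pt0.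
by rewrite !mulr1; apply: mulr_gt0; [exact: (blaschke_coef_gt0 0)|exact: (blaschke_coef_gt0 1)].
Qed.

(* The three line tests only give [q ^+ 2 = 1] for the quotient q of the two
   sides; if [q = -1], four terms of [base_test] already exceed 2. *)
Lemma square_test : {ae mu, forall x,
  h x * h (x + L (pt 1 1)) = h (x + L (pt 1 0)) * h (x + L (pt 0 1))}.
Proof.
have at_pt p (Q : P -> Prop) : {ae mu, forall x, Q x} -> {ae mu, forall x, Q (x + L p)}.
  exact: ae_shift.
have B := base_test hm (parseval_step_square uC) diag_neq0.
apply: (ae_imp (ae_and (ae_and B (unimodular_lattice uC hm)) (ae_and
  (ae_and line_test_e1 (at_pt (pt 0 1) _ line_test_e1))
  (ae_and (ae_and (at_pt (pt 1 0) _ line_test_e2) (at_pt (pt 2 0) _ line_test_e2))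
    line_test_diag)))).
move=> x [[{}B U] [[r1 r2] [[r3 r4] r5]]].
pose M a b := h (x + L (pt a b)).
have ME a b c d : h (x + L (pt a b) + L (pt c d)) = M (a + c) (b + d).
  by rewrite -addrA -lattice_ptD ptD.
have U0 : nsq (h x) = 1 by have := U 0; rewrite lattice_pt0 addr0.
have UM a b : nsq (M a b) = 1 by exact: U.
rewrite !ME in r2 r3 r4.
set a := h x in U0 r1 r5 B *; rewrite -/(M 1 1) -/(M 1 0) -/(M 0 1).
have {}r1 : M 1 0 ^+ 2 = a * M 2 0 := r1.
have {}r2 : M 1 1 ^+ 2 = M 0 1 * M 2 1 := r2.
have {}r3 : M 1 1 ^+ 2 = M 1 0 * M 1 2 := r3.
have {}r4 : M 2 1 ^+ 2 = M 2 0 * M 2 2 := r4.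
have {}r5 : M 1 1 ^+ 2 = a * M 2 2 := r5.
have Mn0 i k : M i k != 0 by exact: unimodular_neq0.
(* Eliminating [M 2 0], [M 2 1] and [M 2 2] from [r1], [r2], [r4] and [r5] leaves the two
   squares. *)
have sq : (a * M 1 1) ^+ 2 = (M 1 0 * M 0 1) ^+ 2.
  have d2 : M 1 1 ^+ 2 != 0 by rewrite expf_neq0.
  have dd : M 1 1 ^+ 2 * M 1 1 ^+ 2 = M 0 1 ^+ 2 * (M 2 0 * M 2 2).
    by rewrite -r4 r2; ring.
  by apply: (mulIf d2); rewrite exprMn -mulrA dd exprMn r1 r5; ring.
move/eqP: sq; rewrite eqf_sqr => /orP[/eqP//|/eqP q].
exfalso.
pose G l := nsq (h (x + L l) * (blaschke_coef (l 1 0) * blaschke_coef (l 0 0) : R)%:C +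
  a * (M 1 1)^*%C * (h (x + L (l + pt 1 1)) *
    (blaschke_coef ((l + pt 1 1) 1 0) * blaschke_coef ((l + pt 1 1) 0 0) : R)%:C)).
pose t : seq idx := [:: pt 0 0; pt 1 0; pt 0 1; pt 1 1].
have ut : uniq t.
  by rewrite /t /= !inE !negb_or; do ?[apply/andP; split] => //; apply/eqP => /pt_inj[].
have : (\sum_(l <- t) (G l)%:E <= \esum_(l in [set: idx]) (G l)%:E)%E.
  by apply: sum_le_esum => // l; rewrite lee_fin nsq_ge0.
rewrite [X in (_ <= X)%E]B sumEFin lee_fin !big_cons big_nil addr0.
have bcE : (a * (M 1 1)^*%C) = a / M 1 1 by rewrite conjc_unimodular.
have GE' i k : G (pt i k) = nsq (M i k * (blaschke_coef k * blaschke_coef i)%:C +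
    a / M 1 1 * M (i + 1) (k + 1) * (blaschke_coef (k + 1) * blaschke_coef (i + 1))%:C).
  by rewrite /G bcE ptD !mxE /= -[in RHS]mulrA.
have b1 : blaschke_coef 1 = 3 / 4 :> R by rewrite (blaschke_coef_pos 0) expr0 mulr1.
have b2 : blaschke_coef 2 = 3 / 8 :> R by rewrite (blaschke_coef_pos 1) expr1; field.
have e00 : a / M 1 1 * M 1 1 = M 0 0.
  by rewrite divfK// /M pt0 lattice_pt0 addr0.
(* Under [q] the phases in the terms at (1,0) and (0,1) are opposite. The products of coefficients
   there, [b0 * b1] and [b1 * b2], have opposite signs as well, so the moduli add up instead of
   cancelling. *)
have e10 : a / M 1 1 * M 2 1 = - M 1 0.
  apply: (mulIf (Mn0 0 1)); rewrite mulNr -q.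
  apply: (mulIf (Mn0 1 1)); rewrite -!mulrA [M 2 1 * _]mulrA [M 2 1 * M 0 1]mulrC -r2.
  by field.
have e01 : a / M 1 1 * M 1 2 = - M 0 1.
  apply: (mulIf (Mn0 1 0)); rewrite mulNr [M 0 1 * _]mulrC -q.
  by rewrite -!mulrA [M 1 2 * _]mulrC -r3; field.
have e11 : a / M 1 1 * M 2 2 = M 1 1.
  by rewrite mulrAC -r5; field.
have comb z (r : R) : nsq z = 1 -> nsq (z * r%:C) = r ^+ 2.
  by move=> z1; rewrite nsqM z1 mul1r nsq_real.
rewrite !GE'.
rewrite -[M (0 + 1) (0 + 1)]/(M 1 1) -[M (1 + 1) (0 + 1)]/(M 2 1).
rewrite -[M (0 + 1) (1 + 1)]/(M 1 2) -[M (1 + 1) (1 + 1)]/(M 2 2).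
rewrite e00 e10 e01 e11 !mulNr -!mulrBr -!mulrDr -!rmorphB -!rmorphD.
rewrite !comb//.
rewrite -[blaschke_coef (0 + 1)]/(blaschke_coef 1) -[blaschke_coef (1 + 1)]/(blaschke_coef 2).
(* The four terms are (13/16)^2, (21/32)^2 twice and (45/64)^2; their sum 8257/4096 barely exceeds
   2. *)
by rewrite blaschke_coef0 b1 b2; lra.
Qed.

(** Translating by the point of [l + j] and writing conjugates as inverses turns the product rule on
    a parallelogram into the invariance equation. *)
Lemma four_point_of_product l j : {ae mu, forall x,
    h (x + L (l + j)) * h x = h (x + L l) * h (x + L j)} ->
  {ae mu, forall x, four_point_eq C C h l j x}.
Proof.
move=> /(ae_shift (- L (l + j))) Q; have U := unimodular_lattice uC hm.
apply: (ae_imp (ae_and Q U)) => x [{}Q {}U].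
have Un k : nsq (h (x - L k)) = 1 by rewrite -lattice_ptN.
have U0 : nsq (h x) = 1 by have := U 0; rewrite lattice_pt0 addr0.
have E1 : x - L (l + j) + L l = x - L j by rewrite lattice_ptD opprD addrA addrAC subrK.
have E2 : x - L (l + j) + L j = x - L l by rewrite lattice_ptD opprD addrA subrK.
rewrite subrK E1 E2 in Q.
have E3 : x - L l - L j = x - L (l + j) by rewrite lattice_ptD opprD addrA.
rewrite /four_point_eq E3 !conjc_unimodular//.
have n1 := unimodular_neq0 (Un j); have n2 := unimodular_neq0 (Un (l + j)).
apply: (mulIf n1); apply: (mulIf n2); rewrite divfK//.
by rewrite Q mulrAC divfK// mulrC.
Qed.

Lemma equal_lattices_four_point l j : {ae mu, forall x, four_point_eq C C h l j x}.
Proof.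
have le : (mu (cell C) <= mu (cell C))%E by exact: lexx.
have T1 : {ae mu, forall x, four_point_eq C C h (pt 1 0) (pt 1 0) x}.
  apply: four_point_of_product; apply: (ae_imp line_test_e1) => x e.
  by rewrite ptD mulrC -e expr2.
have T2 : {ae mu, forall x, four_point_eq C C h (pt 0 1) (pt 0 1) x}.
  apply: four_point_of_product; apply: (ae_imp line_test_e2) => x e.
  by rewrite ptD mulrC -e expr2.
have T3 : {ae mu, forall x, four_point_eq C C h (pt 1 0) (pt 0 1) x}.
  apply: four_point_of_product; apply: (ae_imp square_test) => x e.
  by rewrite ptD mulrC e.
have T4 : {ae mu, forall x, four_point_eq C C h (pt 0 1) (pt 1 0) x}.
  apply: four_point_of_product; apply: (ae_imp square_test) => x e.
  by rewrite ptD mulrC e mulrC.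
have D a : {ae mu, forall x, four_point_eq C C h a (pt 1 0) x} ->
    {ae mu, forall x, four_point_eq C C h a (pt 0 1) x} ->
    forall j, {ae mu, forall x, four_point_eq C C h a j x}.
  move=> S1 S2; apply: idx_span => // b.
    by move=> c; exact: (four_point_eqDr uC uC le hm).
  exact: four_point_eqNr.
move: j; apply: (idx_span (S := fun l => forall j, {ae mu, forall x, four_point_eq C C h l j x})).
- by move=> a b Sa Sb j; exact: four_point_eqDl.
- by move=> a Sa j; exact: four_point_eqNl.
- exact: D.
- exact: D.
Qed.

End equal_lattices_tests.

(** * Conclusion *)

Section assembly.
Context {R : realType}.
Variables A C : 'M[R]_2.
Hypothesis uA : A \in unitmx.
Hypothesis uC : C \in unitmx.
Notation P := (plane R).
Notation mu := (@plane_measure R).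
Hypothesis AC : `|\det A| <= `|\det C|.
Implicit Types (k l j : idx).

Lemma cell_measure_le : (mu (cell A) <= mu (cell C))%E.
Proof. by rewrite [X in (X <= _)%E]cell_measure// [X in (_ <= X)%E]cell_measure// lee_fin. Qed.

(** The columns of [N] are the coordinates of the Λ-basis in Γ. By [AC] its integer determinant has
    modulus at most 1, and it is nonzero since [A] is nonsingular. *)
Lemma sublattice_matrix : (forall l, exists k, lattice_pt C k = lattice_pt A l) ->
  exists2 N : 'M[int]_2, A = C *m map_mx intr N & N \in unitmx.
Proof.
move=> sub; have [k hk] : exists k : 'I_2 -> idx, forall i,
    lattice_pt C (k i) = lattice_pt A (\col_j (j == i)%:R).
  exists (fun i => projT1 (cid (sub (\col_j (j == i)%:R)))) => i.
  by case: cid.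
pose N : 'M[int]_2 := \matrix_(i, j) k j i 0.
have e : A = C *m map_mx intr N.
  apply/matrixP => i j; have := hk j; rewrite !lattice_ptE /mulv !mxE /= => -[e1 e2].
  rewrite !big_ord_recl big_ord0 addr0 /N !mxE (_ : lift ord0 ord0 = 1); last exact/val_inj.
  have j01 : j = 0 \/ j = 1.
    by case: j {e1 e2} => -[|[|//]] hj; [left|right]; exact/val_inj.
  have i01 : i = 0 \/ i = 1.
    by case: i => -[|[|//]] hi; [left|right]; exact/val_inj.
  by case: i01 e1 e2 => ->; case: j01 => -> /= e1 e2; rewrite ?e1 ?e2;
    rewrite !(mulr0, mulr1, addr0, add0r).
exists N => //.
have dA : \det A = \det C * (\det N)%:~R by rewrite e det_mulmx det_map_mx.
have dC : 0 < `|\det C| by rewrite normr_gt0 -unitfE -unitmxE.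
have dN0 : \det N != 0.
  apply/eqP => d0; move: uA; rewrite unitmxE dA d0 mulr0 unitfE eqxx//.
have dN1 : `|\det N| <= 1.
  move: AC; rewrite dA normrM -[leRHS]mulr1 ler_pM2l//.
  by rewrite -intr_norm -[1 in X in X -> _]/(1%:~R) ler_int.
rewrite unitmxE; apply/unitrP; exists (\det N).
suff : \det N = 1 \/ \det N = -1 by move=> [->|->]; rewrite ?mulr1// mulrNN mulr1.
by move: dN0 dN1; lia.
Qed.

Lemma frame_sum_same_lattice (N : 'M[int]_2) (g f : P -> R[i]) :
  A = C *m map_mx intr N -> N \in unitmx -> frame_sum A C g f = frame_sum C C g f.
Proof.
move=> e uN; rewrite /frame_sum [RHS](@reindex_esumT _ _ _ (fun l => N *m l)); last first.
  by exists (fun l => invmx N *m l) => l; rewrite ?mulKmx ?mulKVmx.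
apply: eq_esum => l _; apply: eq_esum => k _.
by rewrite /lattice_pt e map_mxM mulmxA.
Qed.

Variable h : P -> R[i].
Hypothesis hm : frame_multiplier A C h.

(** As soon as one λ lies outside Γ, every λ in Γ is a sum of two points of Λ outside Γ; the same
    holds for γ with the lattices exchanged. So the exceptional indices follow from additivity in
    [l] and in [j]. *)
Lemma four_point_ae l j : j != 0 -> {ae mu, forall x, four_point_eq A C h l j x}.
Proof.
move=> j0; have le := cell_measure_le.
have [[l0 nl0]|sub] := pselect (exists l0, forall k, lattice_pt C k <> lattice_pt A l0); last first.
  have [|N e uN] := sublattice_matrix.
    move=> l'; apply: contrapT => nk; apply: sub; exists l' => k ek.
    by apply: nk; exists k.
  have pE g : parseval_frame A C g <-> parseval_frame C C g.
    have fE f := frame_sum_same_lattice g f e uN.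
    split=> -[Lg H]; (split; first exact: Lg) => f Lf; rewrite -(H f Lf); [exact: esym|exact: fE].
  have hC : frame_multiplier C C h.
    exact: (conj hm.1 (fun g pg => (pE _).1 (hm.2 g ((pE g).2 pg)))).
  apply: (ae_imp (equal_lattices_four_point uC hC (N *m l) j)) => x.
  by rewrite /four_point_eq /lattice_pt e map_mxM mulmxA.
have extend j' : (forall l', (forall k, lattice_pt C k <> lattice_pt A l') ->
      {ae mu, forall x, four_point_eq A C h l' j' x}) ->
    forall l', {ae mu, forall x, four_point_eq A C h l' j' x}.
  move=> H l'; have [[k ek]|nk] := pselect (exists k, lattice_pt C k = lattice_pt A l'); last first.
    by apply: H => k ek; apply: nk; exists k.
  rewrite -(subrK l0 l'); apply: four_point_eqDl; last exact: H.
  apply: H => k' ek'; apply: (nl0 (k - k')).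
  by rewrite lattice_ptB ek ek' lattice_ptB opprB addrC subrK.
have [[i nj0]|sub] := pselect (exists j0, forall k, lattice_pt A k <> lattice_pt C j0); last first.
  (* In this branch all of Γ lies in Λ. *)
  apply: extend => l' nl'; apply: four_point_sublattice => // j'.
  by apply: contrapT => nk; apply: sub; exists j' => k ek; apply: nk; exists k.
have good j' : (forall k, lattice_pt A k <> lattice_pt C j') ->
    forall l', {ae mu, forall x, four_point_eq A C h l' j' x}.
  by move=> nj'; apply: extend => l' nl'; exact: four_point_generic.
have [[k ek]|nk] := pselect (exists k, lattice_pt A k = lattice_pt C j); last first.
  by apply: good => k ek; apply: nk; exists k.
rewrite -(subrK i j); apply: (four_point_eqDr uA uC le hm); last exact: good.
apply: good => k' ek'; apply: (nj0 (k - k')).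
by rewrite lattice_ptB ek ek' lattice_ptB opprB addrC subrK.
Qed.

End assembly.

Theorem theorem1p4 (R : realType) (A B : 'M[R]_2) (h : plane R -> R[i]) :
  A \in unitmx -> B \in unitmx ->
  `|\det (A *m B)| <= 1 ->
  gabor_multiplier A B h ->
  {ae @plane_measure R, forall x, `|h x| = 1} /\
  (forall l k : 'cV[int]_2, k != 0 ->
    {ae @plane_measure R, forall x : plane R,
      h x * (h (x - lattice_pt (invmx B^T) k))^*%C =
      h (x - lattice_pt A l) *
        (h (x - lattice_pt A l - lattice_pt (invmx B^T) k))^*%C}).
Proof.
move=> uA uB dAB [[ch _] hm].
have uC : invmx B^T \in unitmx by rewrite unitmx_inv unitmx_tr.
have dB : 0 < `|\det B| by rewrite normr_gt0 -unitfE -unitmxE.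
have AC : `|\det A| <= `|\det (invmx B^T)|.
  rewrite det_inv det_tr normfV -[leRHS]mul1r ler_pdivlMr//.
  by rewrite -normrM -det_mulmx.
have fm : frame_multiplier A (invmx B^T) h.
  by split; [exact: ch|move=> g /parseval_gaborP/hm/parseval_gaborP].
split; last by move=> l k k0; exact: (four_point_ae uA uC AC fm l k0).
apply: (ae_imp (multiplier_unimodular uA uC (cell_measure_le uA uC AC) fm)) => x hx.
by rewrite normr_nsq hx sqrtr1.
Qed.
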